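(* Let $\xi$ be a positive random variable with $\mathbb{E}(\xi^\eta)<\infty$ for some $\eta>1$. Then there exists $p_c\in(0,1)$, depending only on the law of $\xi$, such that for every $p<p_c$, $$\mathbb{P}^\Lambda_p(o\leftrightarrow\infty)=0\quad\text{for }\upsilon_\xi\text{-almost every }\Lambda,$$ whereas for every $p>p_c$, $$\mathbb{P}^\Lambda_p(o\leftrightarrow\infty)>0\quad\text{for }\upsilon_\xi\text{-almost every }\Lambda.$$
   Context: Let $\xi$ be a positive random variable and let $\xi_1,\xi_2,\dots$ be i.i.d. copies of $\xi$. Set $x_0=0$ and $x_k=x_{k-1}+\xi_k$ for $k\ge1$, and let $\Lambda=\{x_0,x_1,x_2,\dots\}\subseteq\mathbb{R}$ (the environment); $\upsilon_\xi$ denotes the law of $\Lambda$. Given $\Lambda$, let $\mathcal{L}_\Lambda$ be the graph with vertex set $\{(x_i,n): i\in\mathbb{Z}_+,\ n\in\mathbb{Z}_+\}\subseteq\mathbb{R}^2$ (with $\mathbb{Z}_+=\{0,1,2,\dots\}$) and edge set $\{\{(x_i,n),(x_j,m)\}: |i-j|+|n-m|=1\}$. For $p\in[0,1]$, $\mathbb{P}^\Lambda_p$ is the probability measure on $\{0,1\}^{E(\mathcal{L}_\Lambda)}$ under which the edges are independently open with probability $p_e=p^{|e|}$, where $|e|$ is the Euclidean length of $e$ (so vertical edges have length $1$, and horizontal edges between the $i$-th and $(i+1)$-th column have length $\xi_{i+1}$). Let $o=(0,0)$ and let $\{o\leftrightarrow\infty\}$ be the event that the open cluster of $o$ (the set of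 vertices joined to $o$ by a path of open edges) is infinite. *)

(* Defs.v *)
From HB Require Import structures.
From mathcomp Require Import all_boot all_order all_algebra.
From mathcomp Require Import all_classical all_reals all_analysis.
Set Implicit Arguments. Unset Strict Implicit. Unset Printing Implicit Defensive.
Import Order.TTheory GRing.Theory Num.Theory.
Import numFieldNormedType.Exports.
Local Open Scope classical_set_scope.
Local Open Scope ring_scope.

Definition indep_real_rvs {R : realType} {d} {Omega : measurableType d}
  (P : probability Omega R) (I : eqType) (X : I -> Omega -> R) : Prop :=
  forall (J : seq I) (B : I -> set R), uniq J -> (forall i, measurable (B i)) ->
    P (\big[setI/setT]_(i <- J) (X i @^-1` B i)) =
    (\prod_(i <- J) P (X i @^-1` B i))%E.

(* Same for bool-valued random variables (discrete sigma-algebra on bool). *)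
Definition indep_bool_rvs {R : realType} {d} {Omega : measurableType d}
  (P : probability Omega R) (I : eqType) (X : I -> Omega -> bool) : Prop :=
  forall (J : seq I) (B : I -> set bool), uniq J ->
    P (\big[setI/setT]_(i <- J) (X i @^-1` B i)) =
    (\prod_(i <- J) P (X i @^-1` B i))%E.

(* xi k (k = 0,1,2,...) plays the role of xi_{k+1}: an i.i.d. sequence of
   random variables, each with law mu. *)
Definition iid_with_law {R : realType} {d} {Omega : measurableType d}
  (P : probability Omega R) (xi : nat -> Omega -> R) (mu : probability R R) : Prop :=
  [/\ forall k, measurable_fun setT (xi k),
      indep_real_rvs P xi &
      forall k (B : set R), measurable B -> P (xi k @^-1` B) = mu B].

(* Given the increments s k = xi_{k+1}, the column positions
   x_0 = 0, x_i = x_{i-1} + xi_i, i.e. x_i = \sum_{k<i} s k. *)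
Definition column_pos {R : realType} (s : nat -> R) (i : nat) : R :=
  \sum_(k < i) s k.

(* Vertices (x_i, n) of L_Lambda are indexed by (i, n) in Z_+ x Z_+
   (the x_i are pairwise distinct since xi > 0).
   Edges of L_Lambda, i.e. pairs {(x_i,n),(x_j,m)} with |i-j|+|n-m| = 1,
   are encoded as (h, (i, n)):
     (true,  (i, n)) is the horizontal edge {(x_i,n), (x_{i+1},n)},
     (false, (i, n)) is the vertical   edge {(x_i,n), (x_i,n+1)}. *)
Definition vertex := (nat * nat)%type.
Definition edge := (bool * (nat * nat))%type.

Definition edge_ends (e : edge) : vertex * vertex :=
  let: (h, (i, n)) := e in ((i, n), if h then (i.+1, n) else (i, n.+1)).

Definition edge_length {R : realType} (s : nat -> R) (e : edge) : R :=
  let: (h, (i, n)) := e in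
  if h then `|column_pos s i.+1 - column_pos s i| else 1.

Definition open_adj (w : edge -> bool) (u v : vertex) : Prop :=
  exists e, w e /\ (edge_ends e = (u, v) \/ edge_ends e = (v, u)).

Inductive open_connected (w : edge -> bool) : vertex -> vertex -> Prop :=
| oc_refl u : open_connected w u u
| oc_step u v z : open_connected w u v -> open_adj w v z -> open_connected w u z.

Definition origin : vertex := (0%N, 0%N).

Definition percolates (w : edge -> bool) : Prop :=
  infinite_set [set v | open_connected w origin v].

(* A realisation of P^Lambda_p on a probability space (Omega, P): independent
   edge indicators with P(edge e open) = p^{|e|}. *)
Definition bond_field {R : realType} {d} {Omega : measurableType d}
  (P : probability Omega R) (s : nat -> R) (p : R) (W : edge -> Omega -> bool) : Prop :=
  [/\ forall e b, measurable (W e @^-1` [set b]),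
      indep_bool_rvs P W &
      forall e, P (W e @^-1` [set true]) = (p `^ edge_length s e)%:E].

Definition perc_prob_zero {R : realType} (s : nat -> R) (p : R) : Prop :=
  forall d (Omega : measurableType d) (P : probability Omega R)
         (W : edge -> Omega -> bool),
    bond_field P s p W -> P [set om | percolates (fun e => W e om)] = 0%E.

Definition perc_prob_pos {R : realType} (s : nat -> R) (p : R) : Prop :=
  forall d (Omega : measurableType d) (P : probability Omega R)
         (W : edge -> Omega -> bool),
    bond_field P s p W -> (0 < P [set om | percolates (fun e => W e om)])%E.

(* Main.v *)
(** By Kolmogorov's zero-one law and monotonicity in [p], it suffices to find one [p < 1] at which
    the environment percolates with positive probability, and one [p > 0] at which it fails to.
    Both come from the same multiscale scheme. Columns are grouped into blocks; a block of level
    [n + 1] is good when at most one of its sub-blocks of level [n] is bad and no sub-block has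
    total spacing above [max_cost n]. The moment of order [eta > 1] gives, by truncation and
    Chebyshev's inequality, that a block of level [n] is bad with probability at most
    [2 ^ (- 32 n)], so that with positive probability all initial blocks of all levels are good.
    In such an environment, rows of good blocks are linked vertically along good sub-blocks, and
    horizontally across the bad sub-block by asking all its bonds in one row to be open: this is
    very unlikely in a given row, but exponentially many rows are available. For [p] close to [1]
    this links the origin to infinity. For [p] close to [0] it applies to the closed bonds of the
    dual lattice, whose horizontal bonds are all likely to be closed, and whose vertical bonds are
    so unless they cross a column of tiny spacing; a dual path then separates the origin from
    infinity. *)

Require Import Defs.
From HB Require Import structures.
From mathcomp Require Import all_boot all_order all_algebra.
From mathcomp Require Import all_classical all_reals all_analysis.
From mathcomp Require Import measurable_realfun.
From mathcomp Require Import zify ring lra.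
Set Implicit Arguments. Unset Strict Implicit. Unset Printing Implicit Defensive.
Import Order.TTheory GRing.Theory Num.Theory.
Import numFieldNormedType.Exports.
Local Open Scope classical_set_scope.
Local Open Scope ring_scope.

(** * Averages over independent bits *)

(** The obstacle is that a bad column is bad at every height: blocks in the same columns share their
    environment, so block arguments that treat the plane as independent in both directions do not
    apply. The environment is therefore renormalised horizontally only, and heights are adapted to
    it: crossing a bad sub-block has probability exponentially small in its cost, and coarse blocks
    are made exponentially high in that cost. So many rows are affordable because the many parallel
    sub-blocks of a spine multiply the failure exponent by [l / 32] from one level to the next,
    which outruns the cost of crossing. Since the branching [l] grows with the level, the width is
    [2 ^ (4 n (n - 1))]; a cost above [2 ^ n] times the width has probability at most of order
    [width ^ (1 - eta)], which for each [eta > 1] is eventually below [2 ^ (- C n)] for any [C].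
    Bond probabilities are written as finite averages in a fixed environment: they are explicit
    functions of the spacings, valid in every realisation of the bonds, and measure theory is left
    with events on sequences of spacings. *)

Section Averaging.
Context {R : realType} {I : eqType}.
Implicit Types (w v : I -> bool) (F : seq I) (pi : I -> R) (S : set I).

Definition upd w (e : I) (b : bool) : I -> bool := fun x => if x == e then b else w x.

(* Expectation when the bits in [F] are independent, [e] being true with probability [pi e], and
   the other bits are those of [w]. *)
Fixpoint avg pi F (f : (I -> bool) -> R) w : R :=
  if F is e :: F' then
    pi e * avg pi F' f (upd w e true) + (1 - pi e) * avg pi F' f (upd w e false)
  else f w.

Definition determined_by {X : Type} S (f : (I -> bool) -> X) :=
  forall w w', (forall e, S e -> w e = w' e) -> f w = f w'.

Definition increasing (D : (I -> bool) -> Prop) :=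
  forall w w', (forall e, w e -> w' e) -> D w -> D w'.

Definition prob_weights pi := forall e, 0 <= pi e <= 1.

Definition pr pi F (D : (I -> bool) -> Prop) w : R :=
  avg pi F (fun w => (`[< D w >])%:R) w.

Lemma updC w e e' b b' : e != e' -> upd (upd w e b) e' b' = upd (upd w e' b') e b.
Proof.
move=> ne; apply/funext => x; rewrite /upd.
by case: eqP => [->|//]; case: eqP => // e'e; rewrite e'e eqxx in ne.
Qed.

Lemma upd_same w e b b' : upd (upd w e b) e b' = upd w e b'.
Proof. by apply/funext => x; rewrite /upd; case: eqP. Qed.

Lemma determined_sub {X : Type} S S' (f : (I -> bool) -> X) :
  S `<=` S' -> determined_by S f -> determined_by S' f.
Proof. by move=> SS' df w w' ww'; apply: df => e /SS'; apply: ww'. Qed.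

Lemma avg_cat pi F F' f w : avg pi (F ++ F') f w = avg pi F (avg pi F' f) w.
Proof. by elim: F w => //= e F IH w; rewrite !IH. Qed.

Lemma avg_ext pi F f g w : f =1 g -> avg pi F f w = avg pi F g w.
Proof. by move=> /funext ->. Qed.

Lemma avg_cst pi F c w : avg pi F (fun=> c) w = c.
Proof. by elim: F w => //= e F IH w; rewrite !IH; ring. Qed.

Lemma avgD pi F f g w :
  avg pi F (fun w => f w + g w) w = avg pi F f w + avg pi F g w.
Proof. by elim: F w => //= e F IH w; rewrite !IH; ring. Qed.

Lemma avgZ pi F c f w : avg pi F (fun w => c * f w) w = c * avg pi F f w.
Proof. by elim: F w => //= e F IH w; rewrite !IH; ring. Qed.

Lemma avg_le pi F f g w : prob_weights pi -> (forall w, f w <= g w) ->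
  avg pi F f w <= avg pi F g w.
Proof.
move=> pi01 fg; elim: F w => //= e F IH w.
have /andP[p0 p1] := pi01 e.
by apply: lerD; apply: ler_wpM2l; rewrite ?subr_ge0.
Qed.

Lemma avg_determined {X : Type} pi F S f w w' : @determined_by X S f ->
  forall g : X -> R, (forall e, S e -> e \notin F -> w e = w' e) ->
  avg pi F (g \o f) w = avg pi F (g \o f) w'.
Proof.
move=> df g; elim: F w w' => [|e F IH] w w' ww' /=.
  by congr g; apply: df => e Se; apply: ww'.
congr (_ * _ + _ * _); apply: IH => x Sx xF; rewrite /upd; case: eqP => // xe;
  by apply: ww' => //; rewrite inE negb_or xF andbT; apply/eqP.
Qed.

Lemma avg_determined_upd pi F S f w e b : determined_by S f -> ~ S e ->
  avg pi F f (upd w e b) = avg pi F f w.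
Proof.
move=> df Se; apply: (@avg_determined _ _ _ _ _ _ _ df id) => x Sx _.
by rewrite /upd; case: eqP => // xe; rewrite -xe in Se.
Qed.

(** Each bit of [F] lies in [S] or in its complement, so one of the two factors ignores it, and the
    product splits one bit at a time. *)
Lemma avg_indep pi F S f g w : determined_by S f -> determined_by (~` S) g ->
  avg pi F (fun w => f w * g w) w = avg pi F f w * avg pi F g w.
Proof.
move=> df dg; elim: F w => //= e F IH w; rewrite !IH.
have [Se|Se] := pselect (S e).
  have nSe : ~ (~` S) e by move=> /(_ Se).
  by rewrite !(@avg_determined_upd _ F _ g _ e _ dg) //; ring.
by rewrite !(@avg_determined_upd _ F _ f _ e _ df) //; ring.
Qed.

Lemma avg1C pi F e f w :
  avg pi F (avg pi [:: e] f) w = avg pi [:: e] (avg pi F f) w.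
Proof.
elim: F w => //= x F IH w; rewrite !IH /=.
have [->|xe] := eqVneq x e; first by rewrite !upd_same; ring.
by rewrite !(@updC _ x e) //; ring.
Qed.

Lemma avgC pi F F' f w : avg pi F (avg pi F' f) w = avg pi F' (avg pi F f) w.
Proof.
elim: F' f w => [//|e F' IH] f w.
rewrite -[avg pi (e :: F')]/(avg pi ([:: e] ++ F')).
rewrite (avg_ext _ _ _ (avg_cat pi [:: e] F' f)) avg1C avg_cat.
by apply: avg_ext => w'; rewrite IH.
Qed.

(** An average over a list covering the support is constant, and averaging a constant over the other
    list changes nothing: each side equals a double average, and averages over two lists commute. *)
Lemma avg_cover pi F F' S f w w' : determined_by S f ->
  S `<=` [set` F] -> S `<=` [set` F'] -> avg pi F f w = avg pi F' f w'.
Proof.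
move=> df SF SF'.
have cF G v : S `<=` [set` G] -> avg pi G f v = avg pi G f w.
  move=> SG; apply: (@avg_determined _ _ _ _ _ _ _ df id) => e /SG /= eG.
  by rewrite eG.
rewrite (cF F' w') //.
rewrite -(avg_cst pi F' (avg pi F f w) w) -(avg_cst pi F (avg pi F' f w) w).
rewrite -(avg_ext _ _ _ (fun v => cF F v SF)).
by rewrite -(avg_ext _ _ _ (fun v => cF F' v SF')) avgC.
Qed.

(** Raising one weight moves mass from the configuration with the bit closed to the one with the bit
    open, where an increasing event is at least as likely ([mono]). *)
Lemma avg_mono_weights pi pi' F (D : (I -> bool) -> Prop) w : prob_weights pi ->
  prob_weights pi' -> (forall e, pi e <= pi' e) -> increasing D ->
  pr pi F D w <= pr pi' F D w.
Proof.
move=> pi01 pi'01 pipi' iD; rewrite /pr.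
have mono F' v v' : (forall e, v e -> v' e) ->
    avg pi F' (fun w => (`[< D w >])%:R) v <= avg pi F' (fun w => (`[< D w >])%:R) v'.
  elim: F' v v' => [|e F' IH] v v' vv' /=.
    rewrite ler_nat; case: asboolP => // Dv; case: asboolP => // Dv'.
    by case: Dv'; apply: iD Dv.
  have /andP[p0 p1] := pi01 e.
  by apply: lerD; apply: ler_wpM2l; rewrite ?subr_ge0 //; apply: IH => x;
    rewrite /upd; case: eqP => // _; apply: vv'.
elim: F w => //= e F IH w.
set a := avg pi' F _ (upd w e true); set b := avg pi' F _ (upd w e false).
have /andP[p0 p1] := pi01 e; have /andP[q0 q1] := pi'01 e.
set a' := avg pi F _ (upd w e true); set b' := avg pi F _ (upd w e false).
have aa' : a' <= a := IH _.
have bb' : b' <= b := IH _.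
have b'a' : b' <= a' by apply: mono => x; rewrite /upd; case: eqP.
have := pipi' e; nra.
Qed.

Lemma pr_ge0 pi F D w : prob_weights pi -> 0 <= pr pi F D w.
Proof. by move=> p01; rewrite -(avg_cst pi F 0 w); apply: avg_le => // v. Qed.

Lemma pr_le pi F (D D' : (I -> bool) -> Prop) w : prob_weights pi ->
  (forall w, D w -> D' w) -> pr pi F D w <= pr pi F D' w.
Proof.
move=> p01 DD'; apply: avg_le => // v; rewrite ler_nat.
by case: asboolP => // Dv; case: asboolP => // D'v; case: D'v; apply: DD'.
Qed.

Lemma pr_le1 pi F D w : prob_weights pi -> pr pi F D w <= 1.
Proof.
move=> p01; rewrite -[leRHS](avg_cst pi F 1 w); apply: avg_le => // v.
by rewrite lern1; case: asboolP.
Qed.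

Lemma pr_eq pi F (D D' : (I -> bool) -> Prop) w : (forall w, D w <-> D' w) ->
  pr pi F D w = pr pi F D' w.
Proof. by move=> DD'; apply: avg_ext => v; congr ((_ : bool)%:R); apply: asbool_equiv_eq. Qed.

Lemma pr_not pi F D w : pr pi F (fun w => ~ D w) w = 1 - pr pi F D w.
Proof.
rewrite /pr -[X in X - _](avg_cst pi F 1 w) -mulN1r -avgZ -avgD; apply: avg_ext => v.
by rewrite asbool_neg; case: asboolP => _ /=; ring.
Qed.

Lemma pr_or pi F (D D' : (I -> bool) -> Prop) w : prob_weights pi ->
  pr pi F (fun w => D w \/ D' w) w <= pr pi F D w + pr pi F D' w.
Proof.
move=> p01; rewrite -avgD; apply: avg_le => // v; rewrite -natrD ler_nat.
by rewrite asbool_or; case: asboolP => _; case: asboolP.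
Qed.

Lemma pr_exists_sum pi F (s : seq nat) (D : nat -> (I -> bool) -> Prop) (q : nat -> R) w :
  prob_weights pi -> (forall i, i \in s -> pr pi F (D i) w <= q i) ->
  pr pi F (fun w => exists2 i, i \in s & D i w) w <= \sum_(i <- s) q i.
Proof.
move=> p01; elim: s => [|i s IH] qi.
  rewrite big_nil -(avg_cst pi F 0 w); apply: avg_le => // v.
  by rewrite lern0 eqb0; apply/asboolP => -[].
apply: (@le_trans _ _ (pr pi F (D i) w + pr pi F (fun w => exists2 i, i \in s & D i w) w)).
  apply: le_trans (pr_or _ _ _ _ p01); apply: pr_le => // v [j].
  by rewrite inE => /orP[/eqP->|js] Dj; [left|right; exists j].
rewrite big_cons; apply: lerD; first by apply: qi; rewrite inE eqxx.
by apply: IH => j js; apply: qi; rewrite inE js orbT.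
Qed.

Lemma pr_exists pi F (s : seq nat) (D : nat -> (I -> bool) -> Prop) (q : R) w :
  prob_weights pi -> (forall i, i \in s -> pr pi F (D i) w <= q) ->
  pr pi F (fun w => exists2 i, i \in s & D i w) w <= (size s)%:R * q.
Proof.
move=> p01 Dq; apply: le_trans (pr_exists_sum (q := fun=> q) p01 Dq) _.
by rewrite big_const_seq count_predT iter_addr addr0 mulr_natl.
Qed.

Lemma pr_and_indep pi F S (D D' : (I -> bool) -> Prop) w :
  determined_by S D -> determined_by (~` S) D' ->
  pr pi F (fun w => D w /\ D' w) w = pr pi F D w * pr pi F D' w.
Proof.
move=> dD dD'; rewrite /pr -(@avg_indep _ _ S).
- by apply: avg_ext => v; rewrite asbool_and; case: asboolP; case: asboolP => /=; rewrite ?mulr0 ?mulr1.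
- by move=> v v' vv'; rewrite (dD v v').
- by move=> v v' vv'; rewrite (dD' v v').
Qed.

Lemma pr_forall_indep pi F (S : nat -> set I) (D : nat -> (I -> bool) -> Prop) (q : R) w m :
  prob_weights pi -> 0 <= q ->
  (forall t, (t < m)%N -> determined_by (S t) (D t)) ->
  (forall t t', (t < t' < m)%N -> S t `&` S t' = set0) ->
  (forall t, (t < m)%N -> pr pi F (D t) w <= q) ->
  pr pi F (fun w => forall t, (t < m)%N -> D t w) w <= q ^+ m.
Proof.
move=> p01 q0; elim: m => [|m IH] dD dS Dq; first by rewrite expr0 pr_le1.
rewrite (@pr_eq _ _ _ (fun w => D m w /\ forall t, (t < m)%N -> D t w)); last first.
  move=> v; split=> [Dv|[Dm Dv] t]; first by split=> [|t tm]; apply: Dv => //; apply: ltnW.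
  by rewrite ltnS leq_eqVlt => /orP[/eqP->//|]; apply: Dv.
rewrite (@pr_and_indep _ _ (S m)).
- rewrite exprS; apply: ler_pM; rewrite ?pr_ge0 //; first exact: Dq.
  apply: IH => [t tm|t t' /andP[tt' t'm]|t tm].
  + by apply: dD; apply: ltnW.
  + by apply: dS; rewrite tt' ltnW.
  + by apply: Dq; apply: ltnW.
- exact: dD.
- move=> v v' vv'.
  have E t : (t < m)%N -> D t v = D t v'.
    move=> tm; have h := dD t (leqW tm) v v'; apply: h => e Se; apply: vv' => Sme.
    have : (S t `&` S m) e by split.
    by rewrite dS // tm ltnS leqnn.
  by apply/propext; split=> Dv t tm; [rewrite -E|rewrite E] => //; apply: Dv.
Qed.

(** Only an inequality: if [e] is not in [F] it keeps the value it has in [w], which is why [w e] is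
    assumed. *)
Lemma pr_open pi F w e : prob_weights pi -> w e -> pi e <= pr pi F (fun w => w e) w.
Proof.
move=> p01; rewrite /pr; elim: F w => [|x F IH] w we /=.
  by rewrite asboolT //; case/andP: (p01 e).
have /andP[p0 p1] := p01 x; have /andP[q0 q1] := p01 e.
have [xe|xe] := eqVneq x e.
  rewrite xe in p0 p1 *.
  have [eF|eF] := boolP (e \in F).
    have h b : avg pi F (fun w => (`[< w e >])%:R) (upd w e b) =
       avg pi F (fun w => (`[< w e >])%:R) w.
      apply: (@avg_determined _ _ _ [set e] (fun w : I -> bool => (`[< w e >])%:R) _ _ _ id).
        by move=> v v' ->.
      by move=> _ ->; rewrite eF.
    by rewrite !h -mulrDl addrC subrK mul1r; apply: IH.
  have h b : avg pi F (fun w => (`[< w e >])%:R) (upd w e b) = b%:R.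
    rewrite -[RHS](avg_cst pi F _ w).
    elim: F eF {IH} w we => [|y F IH] eF w we /=.
      have -> : upd w e b e = b by rewrite /upd eqxx.
      by congr ((_ : bool)%:R); apply/idP/idP => /asboolP.
    move: eF; rewrite inE negb_or => /andP[ey eF].
    rewrite !(@updC w e y) //.
    have yb b' : upd w y b' e by rewrite /upd (negbTE ey).
    by rewrite !IH // !avg_cst.
  by rewrite !h mulr1 mulr0 addr0.
have wx b : upd w x b e by rewrite /upd eq_sym (negbTE xe).
have := IH _ (wx true); have := IH _ (wx false); nra.
Qed.

(* Opening [e] in advance turns [D] into a larger event that does not depend on [e]. *)
Lemma pr_and_open pi F (D : (I -> bool) -> Prop) e w : prob_weights pi -> w e ->
  increasing D -> pi e * pr pi F D w <= pr pi F (fun w => D w /\ w e) w.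
Proof.
move=> p01 we iD.
rewrite (@pr_eq _ _ (fun w => D w /\ w e) (fun w => w e /\ D (upd w e true))); last first.
  move=> v; split=> [[a b]|[a b]]; split => //.
    by apply: iD a => x; rewrite /upd; case: eqP.
  by apply: iD b => x; rewrite /upd; case: eqP => // ->.
rewrite (@pr_and_indep _ _ [set e]).
- apply: ler_pM => //; rewrite ?pr_ge0 //; first by case/andP: (p01 e).
    exact: pr_open.
  by apply: pr_le => // v; apply: iD => x; rewrite /upd; case: eqP.
- by move=> v v' ->.
- move=> v v' vv'; congr D; apply/funext => x; rewrite /upd; case: eqP => // xe.
  exact: vv'.
Qed.

Lemma increasing_and_open D (e : I) : increasing D -> increasing (fun w => D w /\ w e).
Proof. by move=> iD w w' ww' [Dw we]; split; [apply: iD Dw|apply: ww']. Qed.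

(** Plays the role of the Harris-FKG inequality when one of the two increasing events only asks for
    some bonds to be open. *)
Lemma pr_and_all_open pi F (D : (I -> bool) -> Prop) (s : seq I) w :
  prob_weights pi -> (forall e, w e) -> increasing D ->
  (\prod_(e <- s) pi e) * pr pi F D w <= pr pi F (fun w => D w /\ all w s) w.
Proof.
move=> p01 we; elim: s D => [|e s IH] D iD.
  by rewrite big_nil mul1r; apply: pr_le => // v Dv.
rewrite big_cons -mulrA mulrCA.
apply: (@le_trans _ _ (\prod_(e <- s) pi e * pr pi F (fun w => D w /\ w e) w)).
  apply: ler_wpM2l; last exact: pr_and_open.
  by apply: prodr_ge0 => x _; case/andP: (p01 x).
have /le_trans -> // := IH _ (@increasing_and_open D e iD).
by apply: pr_le => // v [[Dv ve] vs]; rewrite /= ve.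
Qed.

End Averaging.

(** Change of variables along a relabelling of the bits, where [tau] reads a configuration on [J] as
    one on [I]. It serves for the shift by one column. *)
Lemma avg_map {R : realType} {I J : eqType} (pi : I -> R) (pi' : J -> R) (sigma : I -> J)
    (tau : (J -> bool) -> I -> bool) F f w :
  (forall e, pi' (sigma e) = pi e) ->
  (forall w e b, tau (upd w (sigma e) b) = upd (tau w) e b) ->
  avg pi' [seq sigma e | e <- F] (f \o tau) w = avg pi F f (tau w).
Proof.
move=> pis tauE; elim: F w => //= e F IH w.
by rewrite !IH pis !tauE.
Qed.

(** Here the relabelled bits are also negated, whence the weights [1 - pi e]: this is the passage
    from bonds to dual bonds. *)
Lemma avg_map_neg {R : realType} {I J : eqType} (pi : I -> R) (pi' : J -> R)
    (sigma : I -> J) (tau : (I -> bool) -> J -> bool) F f w :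
  (forall e, pi' (sigma e) = 1 - pi e) ->
  (forall w e b, tau (upd w e b) = upd (tau w) (sigma e) (~~ b)) ->
  avg pi F (f \o tau) w = avg pi' [seq sigma e | e <- F] f (tau w).
Proof.
move=> pis tauE; elim: F w => //= e F IH w.
by rewrite !IH pis !tauE /=; ring.
Qed.

(** * Coarsening a row of blocks *)

Implicit Types w : edge -> bool.

Section Blocks.
Local Open Scope nat_scope.

Lemma open_connected_trans w u v z :
  open_connected w u v -> open_connected w v z -> open_connected w u z.
Proof. by move=> uv vz; elim: vz uv => // x y t _ IH yt ux; exact: oc_step (IH ux) yt. Qed.

Lemma open_adj_sym w u v : open_adj w u v -> open_adj w v u.
Proof. by case=> e [we [eE|eE]]; exists e; split=> //; [right|left]. Qed.

Lemma open_adj_connected w u v : open_adj w u v -> open_connected w u v.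
Proof. by apply: oc_step; exact: oc_refl. Qed.

Lemma open_connected_sym w u v : open_connected w u v -> open_connected w v u.
Proof.
elim=> [x|x y z _ yx yz]; first exact: oc_refl.
exact: open_connected_trans (open_adj_connected (open_adj_sym yz)) yx.
Qed.

Lemma open_connected_edge w e : w e -> open_connected w (edge_ends e).1 (edge_ends e).2.
Proof. by move=> we; apply: open_adj_connected; exists e; split=> //; left; case: edge_ends. Qed.

Lemma open_connected_mono w w' u v : (forall e, w e -> w' e) ->
  open_connected w u v -> open_connected w' u v.
Proof.
move=> ww'; elim=> [x|x y z _ xy [e [we ez]]]; first exact: oc_refl.
by apply: oc_step xy _; exists e; split=> //; apply: ww'.
Qed.

Lemma open_connected_row w y a b : a <= b ->
  (forall i, a <= i < b -> w (true, (i, y))) -> open_connected w (a, y) (b, y).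
Proof.
move=> /subnKC <-; elim: (b - a) => [|d IH] wo; first by rewrite addn0; exact: oc_refl.
apply: (open_connected_trans (IH _)) => [i /andP[ai ib]|].
  by apply: wo; rewrite ai addnS ltnW.
rewrite addnS; apply: (@open_connected_edge _ (true, (a + d, y))).
by apply: wo; lia.
Qed.

Definition block (l J : nat) : set nat := [set j | J * l <= j < J.+1 * l].

(* The spine of a block is a half of its sub-blocks: a single bad sub-block leaves one of the
   two halves free of bad sub-blocks. *)
Definition spine_start l (E : nat -> Prop) (J : nat) : nat :=
  if `[< forall j, J * l <= j < J * l + l./2 -> E j >] then J * l else J * l + l./2.

Definition one_bad l (E : nat -> Prop) (J : nat) : Prop :=
  exists b, forall j, block l J j -> j <> b -> E j.

Definition spine l E J : set nat :=
  [set j | spine_start l E J <= j < spine_start l E J + l./2].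

Lemma spine_good l E J j : one_bad l E J -> spine l E J j -> E j.
Proof.
case=> b Eb; rewrite /spine /spine_start /=.
have hl : l./2 + l./2 <= l by rewrite addnn -[leqRHS]odd_double_half leq_addl.
case: asboolP => [Ej jJ|nE jJ]; first exact: Ej.
apply: (Eb) => [|jb]; first by rewrite /block /=; lia.
apply: nE => i iJ; apply: Eb; first by rewrite /block /=; lia.
by move=> ib; move: iJ jJ; rewrite ib jb; lia.
Qed.

Lemma spine_block l E J : spine l E J `<=` block l J.
Proof.
move=> j; rewrite /spine /spine_start /block /=.
have hl : l./2 + l./2 <= l by rewrite addnn -[leqRHS]odd_double_half leq_addl.
by case: asboolP => _ /=; rewrite mulSn; lia.
Qed.

Lemma spine_start_spine l E J : 1 < l -> spine l E J (spine_start l E J).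
Proof. by case: l => [|[|m]] //= _; rewrite /spine /= leqnn; lia. Qed.

Section Coarsening.
Variables (L H l N : nat) (E E' : nat -> Prop) (G : nat -> nat -> (edge -> bool) -> Prop).

Definition spine_clear J r w := forall j, spine l E J j -> G j r w.

(** The column runs through [2 * l] rows, while [vertical_link] asks for a clear spine within [l]
    rows: the clear row found from [r + 1] on then meets the columns selected at [r] and at
    [r + 1]. *)
Definition spine_column J r w :=
  exists j, spine l E J j /\ forall r', r <= r' < r + 2 * l -> G j r' w.

Definition vertical_link J r w :=
  (exists r', r <= r' < r + l /\ spine_clear J r' w) /\ spine_column J r w.

Definition pair_range J : set nat := [set j | J * l <= j < J.+2 * l].

Definition pair_clear J r w := forall j, pair_range J j -> E j -> G j r w.

(** The neighbours of a bad sub-block are included because a bridge has to reach the representatives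
    of the good sub-blocks on either side, whose position inside their sub-block is not known. *)
Definition bridged J j :=
  exists j', [/\ pair_range J j', ~ E j', j <= j'.+1 & j' <= j.+1].

(** The bonds lie in row [r * H], where [linked_level] puts the representatives of fine row [r]. *)
Definition bridge J r : seq edge :=
  [seq (true, (i, r * H)) | i <- iota (J * l * L) (2 * l * L) & `[< bridged J (i %/ L) >]].

Definition horizontal_link J r w := pair_clear J r w /\ all w (bridge J r).

(* One row of the coarse level consists of [N] rows of the fine level.  Clear spines and a full
   spine column tie the rows together inside a block; two neighbouring blocks are tied along one
   row in which the good sub-blocks are linked and the bonds at the bad ones are simply open. *)
Definition coarse_good J R w :=
  (forall r, R * N <= r < R.+1 * N -> vertical_link J r w) /\
  (E' J.+1 -> exists r, R * N <= r < R.+1 * N /\ horizontal_link J r w).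

(** The whole interface between two levels: connectivity at the coarse level uses nothing else about
    [G], so the coarsening can be iterated. The position clause lets a bridge, which is a bare
    segment of a row, start and end at representatives. *)
Definition linked_level (w : edge -> bool) (L H : nat) (E : nat -> Prop)
    (G : nat -> nat -> Prop) (rep : nat -> nat -> vertex) :=
  [/\ forall j r, E j -> G j r -> (rep j r).2 = r * H /\ j * L <= (rep j r).1 < j.+1 * L,
      forall j r, E j -> G j r -> G j r.+1 -> open_connected w (rep j r) (rep j r.+1) &
      forall j r, E j -> E j.+1 -> G j r -> G j.+1 r ->
        open_connected w (rep j r) (rep j.+1 r)].

Variables (w : edge -> bool) (rep : nat -> nat -> vertex).
Hypotheses (l_gt0 : 0 < l) (N_gt0 : 0 < N) (L_gt0 : 0 < L).
Hypothesis E'_one_bad : forall J, E' J -> one_bad l E J.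
Hypothesis lev : linked_level w L H E (fun j r => G j r w) rep.

Let conn := open_connected w.

Definition coarse_sel J r : nat :=
  xget 0 [set j | spine l E J j /\ forall r', r <= r' < r + 2 * l -> G j r' w].

Definition coarse_rep J R : vertex := rep (coarse_sel J (R * N)) (R * N).

Lemma coarse_selP J r : spine_column J r w ->
  spine l E J (coarse_sel J r) /\
  forall r', r <= r' < r + 2 * l -> G (coarse_sel J r) r' w.
Proof.
move=> sc; exact: (@xgetPex _ 0 [set j | spine l E J j /\
  forall r', r <= r' < r + 2 * l -> G j r' w] sc).
Qed.

Lemma column_connected j a b : E j -> a <= b ->
  (forall r, a <= r <= b -> G j r w) -> conn (rep j a) (rep j b).
Proof.
case: lev => _ up _ Ej /subnKC <-; elim: (b - a) => [|d IH] Gj.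
  by rewrite addn0; exact: oc_refl.
apply: (@open_connected_trans _ _ (rep j (a + d))).
  by apply: IH => r rd; apply: Gj; lia.
by rewrite addnS; apply: up => //; apply: Gj; lia.
Qed.

Lemma spine_row_connected J r i j : E' J -> spine_clear J r w ->
  spine l E J i -> spine l E J j -> conn (rep i r) (rep j r).
Proof.
case: lev => _ _ right EJ cl.
wlog ij : i j / i <= j => [hw|] si sj.
  by case/orP: (leq_total i j) => /hw h; [|apply: open_connected_sym]; exact: h.
move: ij sj => /subnKC <-; elim: (j - i) => [|d IH] sj; first by rewrite addn0; exact: oc_refl.
have sd : spine l E J (i + d) by move: si sj; rewrite /spine /=; lia.
apply: (open_connected_trans (IH sd)); rewrite addnS in sj *.
apply: right; [| |exact: cl|exact: cl];
  by apply: (spine_good (E'_one_bad EJ)).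
Qed.

(** The clear row [r'] supplied for [r + 1] lies in the windows of both selected columns: follow the
    first one up to [r'], cross the spine there, and return along the second one. *)
Lemma sel_step J r : E' J -> vertical_link J r w -> vertical_link J r.+1 w ->
  conn (rep (coarse_sel J r) r) (rep (coarse_sel J r.+1) r.+1).
Proof.
move=> EJ [_ cr] [[r' [r'r clr']] cr1].
have [s1 g1] := coarse_selP cr; have [s2 g2] := coarse_selP cr1.
have ob := E'_one_bad EJ.
apply: (@open_connected_trans _ _ (rep (coarse_sel J r) r')).
  by apply: column_connected; [exact: spine_good s1|lia|move=> x xr; apply: g1; lia].
apply: (@open_connected_trans _ _ (rep (coarse_sel J r.+1) r')).
  exact: spine_row_connected clr' _ _.
apply: open_connected_sym.
by apply: column_connected; [exact: spine_good s2|lia|move=> x xr; apply: g2; lia].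
Qed.

Lemma sel_connected J R r : E' J ->
  (forall r, R * N <= r < R.+1 * N -> vertical_link J r w) -> R * N <= r < R.+1 * N ->
  conn (coarse_rep J R) (rep (coarse_sel J r) r).
Proof.
move=> EJ V /andP[/subnKC <-]; elim: (r - R * N) => [|d IH] rN.
  by rewrite addn0; exact: oc_refl.
apply: (@open_connected_trans _ _ (rep (coarse_sel J (R * N + d)) (R * N + d))).
  by apply: IH; lia.
by rewrite addnS; apply: sel_step => //; apply: V; lia.
Qed.

Lemma coarse_rep_spine J R r j : E' J -> coarse_good J R w ->
  R * N <= r < R.+1 * N -> spine_clear J r w -> spine l E J j ->
  conn (coarse_rep J R) (rep j r).
Proof.
move=> EJ [V _] rR cl sj.
apply: (open_connected_trans (sel_connected EJ V rR)).
by apply: (spine_row_connected EJ cl) => //; case: (coarse_selP (V r rR).2).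
Qed.

Lemma bridge_open J r i : all w (bridge J r) -> pair_range J (i %/ L) ->
  bridged J (i %/ L) -> w (true, (i, r * H)).
Proof.
move=> /allP wb /andP[i1 i2] bi; apply: wb; apply/mapP; exists i => //.
rewrite mem_filter mem_iota; apply/andP; split; first by apply/asboolP.
apply/andP; split.
  by apply: leq_trans (leq_trunc_div i L); rewrite leq_mul2r i1 orbT.
apply: leq_trans (ltn_ceil i L_gt0) _.
by rewrite -mulnDl leq_mul2r; apply/orP; right; lia.
Qed.

Lemma bridge_segment J r j a b : all w (bridge J r) -> pair_range J j -> bridged J j ->
  j * L <= a -> a <= b -> b <= j.+1 * L -> conn (a, r * H) (b, r * H).
Proof.
move=> wb jJ bj ja ab bj1; apply: open_connected_row => // i ib.
have ij : i %/ L = j.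
  apply/eqP; rewrite eqn_leq -ltnS ltn_divLR // leq_divRL //; lia.
by apply: (bridge_open wb); rewrite ij.
Qed.

(** A bad sub-block has no representative; its left end in row [r * H] stands in for it, so that the
    walk along two neighbouring blocks is an induction over all sub-blocks, bad or not. *)
Definition row_vertex r j : vertex := if `[< E j >] then rep j r else (j * L, r * H).

Lemma pair_step J r j : horizontal_link J r w -> pair_range J j -> pair_range J j.+1 ->
  conn (row_vertex r j) (row_vertex r j.+1).
Proof.
case: lev => hrep _ right [cl wb] jJ j1J; rewrite /row_vertex.
have bad_bridged i k : pair_range J k -> ~ E k -> i <= k.+1 -> k <= i.+1 -> bridged J i.
  by move=> kJ Ek ik ki; exists k.
case: asboolP => Ej; case: asboolP => Ej1.
- by apply: right => //; apply: cl.
- have [h1 h2] := hrep j r Ej (cl j jJ Ej).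
  rewrite [rep j r]surjective_pairing h1.
  by apply: (bridge_segment wb jJ); [apply: (bad_bridged _ j.+1) => //| | |]; lia.
- have [h1 h2] := hrep j.+1 r Ej1 (cl j.+1 j1J Ej1).
  rewrite [rep j.+1 r]surjective_pairing h1.
  apply: (@open_connected_trans _ _ (j.+1 * L, r * H)).
    by apply: (bridge_segment wb jJ); [apply: (bad_bridged _ j) => //| | |]; lia.
  by apply: (bridge_segment wb j1J); [apply: (bad_bridged _ j) => //| | |]; lia.
- by apply: (bridge_segment wb jJ); [apply: (bad_bridged _ j) => //| | |]; lia.
Qed.

Lemma pair_connected J r i j : horizontal_link J r w -> pair_range J i -> pair_range J j ->
  conn (row_vertex r i) (row_vertex r j).
Proof.
move=> hl; wlog ij : i j / i <= j => [hw|] iJ jJ.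
  by case/orP: (leq_total i j) => /hw h; [|apply: open_connected_sym]; exact: h.
move: ij jJ => /subnKC <-; elim: (j - i) => [|d IH] jJ; first by rewrite addn0; exact: oc_refl.
have dJ : pair_range J (i + d) by move: iJ jJ; rewrite /pair_range /=; lia.
by apply: (open_connected_trans (IH dJ)); rewrite addnS in jJ *; exact: pair_step hl dJ jJ.
Qed.

Hypothesis l_gt1 : 1 < l.

Lemma coarse_rep_pair J K R r j : E' J -> E' J.+1 -> E' K -> J <= K <= J.+1 ->
  coarse_good K R w -> R * N <= r < R.+1 * N -> horizontal_link J r w ->
  pair_range J j -> E j -> conn (coarse_rep K R) (rep j r).
Proof.
move=> EJ EJ1 EK JK GK rR hl jJ Ej.
have sJ : spine l E K `<=` pair_range J.
  by move=> i /spine_block; rewrite /block /pair_range /= => iK; nia.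
have sE i : spine l E K i -> E i by apply: spine_good; apply: E'_one_bad.
have ss := spine_start_spine E K l_gt1.
apply: (@open_connected_trans _ _ (rep (spine_start l E K) r)).
  apply: coarse_rep_spine => // i si; apply: hl.1; [exact: sJ|exact: sE].
have := pair_connected hl (sJ _ ss) jJ.
by rewrite /row_vertex !asboolT //; exact: sE.
Qed.

Lemma coarse_linked_level :
  linked_level w (l * L) (N * H) E' (fun J R => coarse_good J R w) coarse_rep.
Proof.
have [hrep up right] := lev.
split=> [J R EJ GJ|J R EJ GJ GJ1|J R EJ EJ1 GJ GJ1].
- have RN : R * N <= R * N < R.+1 * N by lia.
  have [sJ sG] := coarse_selP (GJ.1 _ RN).2.
  have := hrep _ (R * N) (spine_good (E'_one_bad EJ) sJ) (sG _ _).
  move=> /(_ ltac:(lia)) [h1 h2]; split; first by rewrite h1 mulnA.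
  have /= := spine_block sJ; rewrite /block /= => bJ.
  apply/andP; split.
    by case/andP: h2 => h2 _; apply: leq_trans h2; rewrite mulnA leq_mul2r; lia.
  by case/andP: h2 => _ h2; apply: leq_trans h2 _; rewrite mulnA leq_mul2r; lia.
(* From the last fine row of coarse row [R], one more step of the selected columns leads into coarse
   row [R + 1]. *)
- have e : R.+1 * N = (R.+1 * N).-1.+1 by rewrite prednK // muln_gt0.
  have last_row : R * N <= (R.+1 * N).-1 < R.+1 * N by rewrite mulSn; lia.
  apply: (open_connected_trans (sel_connected EJ GJ.1 last_row)).
  rewrite /coarse_rep e; apply: sel_step => //; first exact: GJ.1.
  by rewrite -e; apply: GJ1.1; lia.
- have [r [rR hl]] := GJ.2 EJ1.
  have JJ : pair_range J (spine_start l E J).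
    by have := spine_block (spine_start_spine E J l_gt1); rewrite /block /pair_range /=; lia.
  have EJs := spine_good (E'_one_bad EJ) (spine_start_spine E J l_gt1).
  apply: (@open_connected_trans _ _ (rep (spine_start l E J) r)).
    by apply: (@coarse_rep_pair J J) => //; lia.
  by apply: open_connected_sym; apply: (@coarse_rep_pair J J.+1) => //; lia.
Qed.

End Coarsening.

End Blocks.


(** * Supports of the coarse events *)

Definition box_support (L H J R : nat) : set edge :=
  [set e | (J * L <= e.2.1 < (J + 3) * L)%N && (R * H <= e.2.2 < (R + 2) * H)%N].

Section CoarseSupport.
Local Open Scope nat_scope.
Variables (L H l N : nat) (E E' : nat -> Prop) (G : nat -> nat -> (edge -> bool) -> Prop).
Lemma bridge_edge J r e : e \in bridge L H l E J r ->
  e.2.2 = r * H /\ J * l * L <= e.2.1 < J.+2 * l * L.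
Proof.
case/mapP => i; rewrite mem_filter mem_iota => /andP[_ iJ] -> /=; split=> //.
by move: iJ; rewrite -mulnDl !mulSn; lia.
Qed.

Hypotheses (l_gt1 : 1 < l) (L_gt0 : 0 < L) (H_gt0 : 0 < H) (N_large : 2 * l <= N).
Hypothesis G_increasing : forall j r, increasing (G j r).
Hypothesis G_support : forall j r, determined_by (box_support L H j r) (G j r).

Lemma bridge_increasing J r : increasing (fun w => all w (bridge L H l E J r)).
Proof. by move=> w w' ww' /allP wb; apply/allP => e eb; apply/ww'/wb. Qed.

Lemma horizontal_link_increasing J r : increasing (horizontal_link L H l E G J r).
Proof.
move=> w w' ww' [cl br]; split; last exact: bridge_increasing br.
by move=> j jJ Ej; apply: G_increasing ww' _; exact: cl.
Qed.

Lemma coarse_good_increasing J R : increasing (coarse_good L H l N E E' G J R).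
Proof.
move=> w w' ww' [V Hl]; split=> [r rR|EJ1].
  have [[r' [r'r cl]] [j [sj Gj]]] := V r rR; split.
    by exists r'; split=> // j' sj'; apply: G_increasing ww' _; exact: cl.
  by exists j; split=> // r'' rr''; apply: G_increasing ww' _; exact: Gj.
have [r [rR hl]] := Hl EJ1; exists r; split=> //.
exact: horizontal_link_increasing hl.
Qed.

Lemma spine_clear_support J r :
  determined_by [set e | r * H <= e.2.2 < (r + 2) * H] (spine_clear l E G J r).
Proof.
move=> w w' ww'; rewrite /spine_clear; apply/propext.
have GE j : G j r w = G j r w' by apply: G_support => e /andP[_ eH]; apply: ww'.
by split=> cl j sj; [rewrite -GE|rewrite GE]; apply: cl.
Qed.

Lemma horizontal_link_support J r :
  determined_by [set e | r * H <= e.2.2 < (r + 2) * H] (horizontal_link L H l E G J r).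
Proof.
move=> w w' ww'; rewrite /horizontal_link /pair_clear; apply/propext.
have GE j : G j r w = G j r w' by apply: G_support => e /andP[_ eH]; apply: ww'.
have -> : all w (bridge L H l E J r) = all w' (bridge L H l E J r).
  apply: eq_in_all => e /bridge_edge [eH _]; apply: ww' => /=.
  by rewrite eH leqnn ltn_mul2r H_gt0 addn2 ltnS leqnSn.
by split=> -[cl al]; split=> // j jJ Ej; [rewrite -GE|rewrite GE]; apply: cl.
Qed.

(** The shape of three blocks by two rows reproduces itself. A coarse event looks at the sub-blocks
    of two neighbouring blocks, whose boxes overhang by two sub-blocks, at most one block as
    [l > 1]. Columns started in the last rows overhang, boxes included, by at most [2 * l] rows,
    which is at most one coarse row by [N_large]. *)
Lemma coarse_good_support J R :
  determined_by (box_support (l * L) (N * H) J R) (coarse_good L H l N E E' G J R).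
Proof.
suff imp w w' : (forall e, box_support (l * L) (N * H) J R e -> w e = w' e) ->
    coarse_good L H l N E E' G J R w -> coarse_good L H l N E E' G J R w'.
  by move=> w w' ww'; apply/propext; split; apply: imp => e /ww'.
move=> ww' [V Hl].
have GE j r : pair_range l J j -> R * N <= r -> r.+1 < (R + 2) * N -> G j r w -> G j r w'.
  move=> jJ rR r1R; rewrite (G_support (w' := w')) // => e /andP[/andP[e1 e2] /andP[e3 e4]].
  apply: ww'; move: jJ; rewrite /pair_range /= => /andP[j1 j2].
  rewrite /box_support /= !mulnA; apply/andP; split; apply/andP; split.
  - by apply: leq_trans e1; rewrite leq_mul2r j1 orbT.
  - by apply: leq_trans e2 _; rewrite leq_mul2r; apply/orP; right; nia.
  - by apply: leq_trans e3; rewrite leq_mul2r rR orbT.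
  - by apply: leq_trans e4 _; rewrite leq_mul2r; apply/orP; right; lia.
have sJ j : spine l E J j -> pair_range l J j.
  by move=> /spine_block; rewrite /block /pair_range /= => jJ; nia.
have R2 : (R + 2) * N = R.+1 * N + N by rewrite addn2 [in LHS]mulSn addnC.
split=> [r rR|EJ1].
  have [[r' [r'r cl]] [j [sj Gj]]] := V r rR; split.
    exists r'; split=> // i si; apply: GE (cl i si); [exact: sJ|lia|lia].
  exists j; split=> // r'' rr''; apply: GE (Gj r'' rr''); [exact: sJ|lia|lia].
have [r [rR [cl br]]] := Hl EJ1; exists r; split=> //; split.
  by move=> j jJ Ej; apply: GE (cl j jJ Ej) => //; lia.
rewrite -(eq_in_all (a1 := w)) // => e /bridge_edge [eH eL]; apply: ww'.
rewrite /box_support /= eH !mulnA leq_mul2r ltn_mul2r H_gt0 /=.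
apply/andP; split; last by apply/andP; split; [apply/orP; right; lia|lia].
apply/andP; split; first by case/andP: eL.
by case/andP: eL => _ eL; apply: leq_trans eL _; rewrite leq_mul2r leq_mul2r; lia.
Qed.

End CoarseSupport.

(** * Probability of the coarse events *)

Section CoarseProbability.
Context {R : realType}.
Variables (L H lam N' : nat) (E E' : nat -> Prop) (G : nat -> nat -> (edge -> bool) -> Prop).
Variables (pi : edge -> R) (F : seq edge) (kappa : nat -> R) (M q : R).
Let l := (8 * lam)%N.
Let N := (2 * N')%N.
Let w0 : edge -> bool := fun=> true.
Hypotheses (lam_gt0 : (0 < lam)%N) (L_gt0 : (0 < L)%N) (H_gt0 : (0 < H)%N).
Hypothesis G_increasing : forall j r, increasing (G j r).
Hypothesis G_support : forall j r, determined_by (box_support L H j r) (G j r).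
Hypotheses (pi01 : prob_weights pi) (kappa_ge0 : forall i, 0 <= kappa i).
Hypothesis pi_horizontal : forall i y, expR (- kappa i) <= pi (true, (i, y)).
Hypothesis E'_one_bad : forall J, E' J -> one_bad l E J.
Hypothesis E'_cost : forall J j, E' J -> block l J j ->
  \sum_(j * L <= i < j.+1 * L) kappa i <= M.
Hypotheses (q_ge0 : 0 <= q) (q_small : (2 * l)%:R * q <= 1).
Hypothesis G_bad : forall j r, E j -> pr pi F (fun w => ~ G j r w) w0 <= q.

Let x := (2 * l)%:R * q.

Lemma sum_blocks (f : nat -> R) a b : (a <= b)%N ->
  \sum_(a * L <= i < b * L) f i = \sum_(a <= j < b) \sum_(j * L <= i < j.+1 * L) f i.
Proof.
move=> /subnKC <-; elim: (b - a)%N => [|d IH]; first by rewrite addn0 !big_geq.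
rewrite addnS big_nat_recr ?leq_addr //= -IH.
by rewrite (@big_cat_nat _ _ _ ((a + d) * L)) //= leq_mul2r ?leq_addr ?leqnSn orbT.
Qed.

Lemma M_ge0 J : E' J -> 0 <= M.
Proof.
move=> EJ; apply: le_trans (E'_cost (j := J * l) EJ _); last first.
  by rewrite /block /= leqnn mulSn /l; lia.
by apply: sumr_ge0 => i _.
Qed.

(** At most one bad sub-block in each of the two blocks, each counted with its two neighbours. *)
Lemma bridged_count J : E' J -> E' J.+1 ->
  (size [seq j <- index_iota (J * l) (J.+2 * l) | `[< bridged l E J j >]] <= 6)%N.
Proof.
move=> EJ EJ1; have [b Eb] := E'_one_bad EJ; have [b' Eb'] := E'_one_bad EJ1.
have -> : 6%N = size [:: b.-1; b; b.+1; b'.-1; b'; b'.+1] by [].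
apply: uniq_leq_size; first by rewrite filter_uniq // iota_uniq.
move=> j; rewrite mem_filter => /andP[/asboolP[j' [j'J Ej' jj' j'j]] _].
have : j' = b \/ j' = b'.
  have [jb|jb] := eqVneq j' b; first by left.
  have [jb'|jb'] := eqVneq j' b'; first by right.
  exfalso; apply: Ej'; move: j'J; rewrite /pair_range /= => j'J.
  case: (ltnP j' (J.+1 * l)) => j'l.
    by apply: Eb; [rewrite /block /=; lia|exact/eqP].
  by apply: Eb'; [rewrite /block /=; lia|exact/eqP].
by rewrite !inE; case=> ?; subst; lia.
Qed.

Lemma bridge_weight J r : E' J -> E' J.+1 ->
  expR (- (6 * M)) <= \prod_(e <- bridge L H l E J r) pi e.
Proof.
move=> EJ EJ1; rewrite /bridge big_map big_filter.
apply: (@le_trans _ _ (\prod_(i <- iota (J * l * L) (2 * l * L) | `[< bridged l E J (i %/ L) >])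
    expR (- kappa i))); last first.
  by apply: ler_prod => i _; rewrite expR_ge0 pi_horizontal.
rewrite -expR_sum ler_expR sumrN lerN2.
have -> : iota (J * l * L) (2 * l * L) = index_iota (J * l * L) (J.+2 * l * L).
  by rewrite /index_iota; congr iota; rewrite -mulnBl -mulnBl; congr (_ * _ * _)%N; lia.
rewrite big_mkcond sum_blocks; last by rewrite leq_mul2r; lia.
apply: (@le_trans _ _ (\sum_(J * l <= j < J.+2 * l | `[< bridged l E J j >]) M)).
  rewrite [leRHS]big_mkcond /= big_nat [leRHS]big_nat; apply: ler_sum => j jJ.
  have -> : \sum_(j * L <= i < j.+1 * L) (if `[< bridged l E J (i %/ L) >] then kappa i else 0) =
      \sum_(j * L <= i < j.+1 * L) (if `[< bridged l E J j >] then kappa i else 0).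
    rewrite big_nat [RHS]big_nat; apply: eq_bigr => i ij.
    suff -> : (i %/ L = j)%N by [].
    by apply/eqP; rewrite eqn_leq -ltnS ltn_divLR // leq_divRL //; lia.
  case: ifP => bj; last by rewrite big1.
  case: (ltnP j (J.+1 * l)) => jl; first by apply: (E'_cost EJ); rewrite /block /=; lia.
  by apply: (E'_cost EJ1); rewrite /block /=; lia.
rewrite -big_filter big_const_seq count_predT iter_addr addr0 -[M *+ _]mulr_natl.
by apply: ler_wpM2r; rewrite ?(M_ge0 EJ) // ler_nat bridged_count.
Qed.

Lemma pr_not_clear (P : set nat) a n r :
  (n <= 2 * l)%N -> (forall j, P j -> (a <= j < a + n)%N) -> (forall j, P j -> E j) ->
  pr pi F (fun w => ~ forall j, P j -> G j r w) w0 <= x.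
Proof.
move=> nl Pa PE.
pose s := [seq j <- iota a n | `[< P j >]].
apply: (@le_trans _ _ ((size s)%:R * q)); last first.
  apply: ler_wpM2r => //; rewrite ler_nat; apply: leq_trans nl.
  by rewrite size_filter -[leqRHS](size_iota a) count_size.
apply: le_trans (@pr_exists _ _ pi F s (fun j w => ~ G j r w) q w0 pi01 _).
  apply: pr_le => // w /existsNP[j /not_implyP[Pj nG]]; exists j => //.
  by rewrite mem_filter mem_iota (Pa j Pj) andbT; apply/asboolP.
by move=> j; rewrite mem_filter => /andP[/asboolP Pj _]; apply: G_bad; exact: PE.
Qed.

Lemma pr_no_clear_row J r : E' J ->
  pr pi F (fun w => ~ exists r', (r <= r' < r + l)%N /\ spine_clear l E G J r' w) w0 <= x ^+ lam.
Proof.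
move=> EJ; apply: le_trans (@pr_forall_indep _ _ pi F
  (fun t => [set e : edge | (r + 2 * t) * H <= e.2.2 < (r + 2 * t + 2) * H]%N)
  (fun t w => ~ spine_clear l E G J (r + 2 * t) w) x w0 lam pi01 _ _ _ _).
- apply: pr_le => // w nE t tl cl; apply: nE; exists (r + 2 * t)%N; split=> //.
  by rewrite /l; lia.
- by rewrite /x mulr_ge0.
- by move=> t _ w w' ww'; rewrite (spine_clear_support l E G_support J ww').
- move=> t t' /andP[tt' _]; apply/seteqP; split=> // e [/= /andP[_ e1] /andP[e2 _]].
  have := leq_trans e1 _; move=> /(_ _ (leq_trans _ e2)).
  suff : ((r + 2 * t + 2) * H <= (r + 2 * t') * H)%N by lia.
  by rewrite leq_mul2r; lia.
- move=> t _; apply: (@pr_not_clear (spine l E J) (spine_start l E J) l./2).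
  + by rewrite /l; lia.
  + by [].
  + by move=> j; apply: spine_good; exact: E'_one_bad.
Qed.

(** Supports are three sub-blocks wide, so the columns [a + 3 * t] are independent; [lam] of them
    fit into a spine, which has [4 * lam] sub-blocks. *)
Lemma pr_no_column J r : E' J ->
  pr pi F (fun w => ~ spine_column l E G J r w) w0 <= x ^+ lam.
Proof.
move=> EJ; set a := spine_start l E J.
have al : l./2 = (4 * lam)%N by rewrite /l; lia.
apply: le_trans (@pr_forall_indep _ _ pi F
  (fun t => [set e : edge | (a + 3 * t) * L <= e.2.1 < (a + 3 * t + 3) * L]%N)
  (fun t w => exists2 r', r' \in iota r (2 * l) & ~ G (a + 3 * t) r' w) x w0 lam pi01 _ _ _ _).
- apply: pr_le => // w nE t tl; apply: contrapT => nG; apply: nE; exists (a + 3 * t)%N; split.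
    by rewrite /spine /= -/a al; lia.
  by move=> r' rr'; apply: contrapT => nG'; apply: nG; exists r' => //; rewrite mem_iota.
- by rewrite /x mulr_ge0.
- move=> t _ w w' ww'.
  have GE r' : G (a + 3 * t) r' w = G (a + 3 * t) r' w'.
    by apply: G_support => e /andP[e1 _]; apply: ww'.
  by apply/propext; split=> -[r' rr' nG]; exists r'; rewrite // ?GE // -GE.
- move=> t t' /andP[tt' _]; apply/seteqP; split=> // e [/= /andP[_ e1] /andP[e2 _]].
  suff : ((a + 3 * t + 3) * L <= (a + 3 * t') * L)%N by lia.
  by rewrite leq_mul2r; lia.
- move=> t tl; rewrite /x -[in leRHS](size_iota r (2 * l)).
  apply: pr_exists => // r' _; apply: G_bad.
  apply: (spine_good (E'_one_bad EJ)).
  by rewrite /spine /= -/a al; lia.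
Qed.

(** A clear row is an increasing event, so opening the bridge on top of it costs at most the factor
    of [bridge_weight], even though both may look at the same bonds. *)
Lemma pr_no_horizontal_link J r : E' J -> E' J.+1 ->
  pr pi F (fun w => ~ horizontal_link L H l E G J r w) w0 <= 1 - (1 - x) * expR (- (6 * M)).
Proof.
move=> EJ EJ1; rewrite pr_not lerB // mulrC.
have icl : increasing (pair_clear l E G J r).
  by move=> w w' ww' cl j jJ Ej; apply: G_increasing ww' _; exact: cl.
apply: le_trans (pr_and_all_open F _ pi01 (fun=> erefl) icl).
apply: ler_pM; rewrite ?expR_ge0 ?subr_ge0 //; first exact: bridge_weight.
rewrite lerBlDr -lerBlDl -pr_not.
have := @pr_not_clear [set j | pair_range l J j /\ E j] (J * l) (2 * l) r.
move=> /(_ (leqnn _)) h; apply: le_trans (h _ _).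
- by apply: pr_le => // w ncl cl; apply: ncl => j jJ Ej; apply: cl.
- by move=> j [jJ _]; move: jJ; rewrite /pair_range /= !mulSn; lia.
- by move=> j [].
Qed.

(** Fine rows at distance two have disjoint supports, whence [N'] independent attempts among the
    [N = 2 * N'] rows. *)
Lemma pr_no_horizontal_row J K : E' J -> E' J.+1 ->
  pr pi F (fun w => ~ exists r, (K * N <= r < K.+1 * N)%N /\ horizontal_link L H l E G J r w) w0
    <= (1 - (1 - x) * expR (- (6 * M))) ^+ N'.
Proof.
move=> EJ EJ1; apply: le_trans (@pr_forall_indep _ _ pi F
  (fun t => [set e : edge | (K * N + 2 * t) * H <= e.2.2 < (K * N + 2 * t + 2) * H]%N)
  (fun t w => ~ horizontal_link L H l E G J (K * N + 2 * t) w) _ w0 N' pi01 _ _ _ _).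
- apply: pr_le => // w nE t tl cl; apply: nE; exists (K * N + 2 * t)%N; split=> //.
  by rewrite /N; lia.
- by apply: le_trans (pr_no_horizontal_link 0 EJ EJ1); exact: pr_ge0.
- by move=> t _ w w' ww'; rewrite (@horizontal_link_support L H l E G H_gt0 G_support J _ w w' ww').
- move=> t t' /andP[tt' _]; apply/seteqP; split=> // e [/= /andP[_ e1] /andP[e2 _]].
  suff : ((K * N + 2 * t + 2) * H <= (K * N + 2 * t') * H)%N by lia.
  by rewrite leq_mul2r; lia.
- by move=> t _; exact: pr_no_horizontal_link.
Qed.

Lemma pr_not_coarse_good J K : E' J ->
  pr pi F (fun w => ~ coarse_good L H l N E E' G J K w) w0 <=
    N%:R * (2 * x ^+ lam) + (1 - (1 - x) * expR (- (6 * M))) ^+ N'.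
Proof.
move=> EJ.
pose D1 w := exists2 r, r \in iota (K * N) N & ~ vertical_link l E G J r w.
pose D2 w := ~ (E' J.+1 -> exists r, (K * N <= r < K.+1 * N)%N /\
  horizontal_link L H l E G J r w).
apply: (@le_trans _ _ (pr pi F (fun w => D1 w \/ D2 w) w0)).
  apply: pr_le => // w nG; have [d2|d2] := pselect (D2 w); [by right|left].
  apply: contrapT => nd1; apply: nG; split; last exact: contrapT.
  move=> r rK; apply: contrapT => nV; apply: nd1; exists r => //.
  by rewrite mem_iota; rewrite mulSn addnC in rK.
apply: le_trans (pr_or _ _ _ _ pi01) _; apply: lerD.
  rewrite -[X in X%:R * _](size_iota (K * N)).
  apply: pr_exists => // r _.
  apply: (@le_trans _ _ (x ^+ lam + x ^+ lam)); last by rewrite mulr2n mulrDl mul1r.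
  apply: le_trans (lerD (pr_no_clear_row r EJ) (pr_no_column r EJ)).
  apply: le_trans (pr_or _ _ _ _ pi01); apply: pr_le => // w nV.
  by apply/not_andP.
have [EJ1|nEJ1] := pselect (E' J.+1).
  apply: le_trans (pr_no_horizontal_row K EJ EJ1).
  by apply: pr_le => // w d2 h; apply: d2.
(* If block [J + 1] is not good, no link towards it is asked for, and it remains to see that the
   second term of the bound is nonnegative. *)
apply: (@le_trans _ _ 0); last first.
  apply: exprn_ge0; rewrite subr_ge0 -[leRHS]mul1r; apply: ler_pM.
  - by rewrite subr_ge0.
  - exact: expR_ge0.
  - by rewrite gerBl mulr_ge0.
  - by rewrite -expR0 ler_expR oppr_le0 mulr_ge0 // (M_ge0 EJ).
rewrite -(avg_cst pi F 0 w0); apply: avg_le => // w.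
by rewrite lern0 eqb0; apply/asboolP => d2; apply: d2 => /nEJ1.
Qed.

End CoarseProbability.


(* A bridge over bad sub-blocks at level [n] is open with probability [exp (- O(max_cost n))],
   so [half_rows n] attempts suffice; a row at level [n] then fails with probability at most
   [exp (- decay n)]. *)
Definition branching (n : nat) : nat := 2 ^ (8 * n).
(** The product of [branching k] over [k < n]. *)
Definition width (n : nat) : nat := 2 ^ (4 * (n * n.-1)).
Definition max_cost (n : nat) : nat := 2 ^ n * width n.
Definition half_rows (n : nat) : nat := 2 ^ (20 * max_cost n).
Definition decay (n : nat) : nat := 2 ^ (4 * (n * n.-1) - 5 * n).

Lemma widthS n : width n.+1 = (branching n * width n)%N.
Proof.
rewrite /width /branching -expnD; congr (2 ^ _)%N.
by case: n => // n /=; nia.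
Qed.

Lemma branching8 n : (0 < n)%N -> branching n = (8 * 2 ^ (8 * n - 3))%N.
Proof. by move=> n0; rewrite /branching (_ : 8 = 2 ^ 3)%N // -expnD; congr (2 ^ _)%N; lia. Qed.

Lemma width_gt0 n : (0 < width n)%N. Proof. by rewrite expn_gt0. Qed.

(** * Numerical recursion between consecutive levels *)

Section ScaleNumerics.
Context {R : realType}.

Lemma expR_nat_ge2X (m : nat) : (2 ^ m)%:R <= expR m%:R :> R.
Proof.
rewrite natrX -[X in expR X]mulr1 expRM_natl.
apply: lerXn2r; rewrite ?nnegrE ?expR_ge0 //.
by have := @expR_ge1Dx R 1; lra.
Qed.

Lemma expR_nat_le4X (m : nat) : expR m%:R <= (2 ^ (2 * m))%:R :> R.
Proof.
rewrite expnM natrX -[X in expR X]mulr1 expRM_natl.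
apply: lerXn2r; rewrite ?nnegrE ?expR_ge0 //.
have h := @expR_ge1Dx R (- 2^-1).
have e1 : expR (- 2^-1) * expR 2^-1 = 1 :> R by rewrite -expRD addNr expR0.
have e2 : expR 2^-1 * expR 2^-1 = expR 1 :> R by rewrite -expRD; congr expR; lra.
have e3 := @expR_gt0 R 2^-1.
have e4 : expR 2^-1 <= 2 :> R by nra.
rewrite (_ : (2 ^ 2)%:R = 2 * 2 :> R); last by rewrite -natrM.
by rewrite -e2; nra.
Qed.

(** With [branching n = 8 * lam], [lam] independent attempts multiply the exponent by
    [2 ^ (8 n - 3)]. A factor 4 is given away: half of the exponent pays for the union bound over
    sub-blocks, and half of the rest for the number of rows. *)
Lemma decayS n : (9 <= n)%N -> (4 * decay n.+1 = decay n * 2 ^ (8 * n - 3))%N.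
Proof.
move=> n9; rewrite /decay (_ : 4 = 2 ^ 2)%N // -!expnD; congr (2 ^ _)%N.
by case: n n9 => // n n9 /=; nia.
Qed.

Lemma decay_large n : (9 <= n)%N -> (2 ^ (27 * n) <= decay n)%N.
Proof.
move=> n9; rewrite /decay leq_exp2l //.
by case: n n9 => // n n9 /=; nia.
Qed.

(** The constant 23 is 20, the exponent of [half_rows] per unit of cost, plus 3 for a remaining
    factor 8. The upper bound keeps [decay n.+1] below [2 ^ (3 * max_cost n)]. *)
Lemma decay_max_cost n : (9 <= n)%N ->
  (23 * max_cost n <= decay n.+1)%N /\ (decay n.+1 <= 2 ^ (2 * n) * max_cost n)%N.
Proof.
move=> n9; have e : (2 ^ (2 * n - 5) * max_cost n = decay n.+1)%N.
  rewrite /max_cost /width /decay -!expnD; congr (2 ^ _)%N.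
  by case: n n9 => // n n9 /=; nia.
rewrite -e !leq_mul2r; split; apply/orP; right; last by rewrite leq_exp2l //; lia.
apply: (@leq_trans (2 ^ 5)) => //; rewrite leq_exp2l //; lia.
Qed.

(** Each term takes half of the target. Since [exp 1 <= 4], a bridge is open with probability at
    least [2 ^ (- 12 M)], so [2 ^ (20 M)] attempts all fail with probability at most
    [exp (- 2 ^ (3 M))], while the target exponent is at most [2 ^ (2 n) * M]. In the other term the
    number of rows is absorbed by half of the exponent. *)
Lemma recursion_numerics n (x := (2 * branching n)%:R * expR (- (decay n)%:R) : R)
    (M := (max_cost n)%:R : R) : (9 <= n)%N ->
  x <= 1 /\
  (2 * half_rows n)%:R * (2 * x ^+ (2 ^ (8 * n - 3))) +
    (1 - (1 - x) * expR (- (6 * M))) ^+ half_rows n <= expR (- (decay n.+1)%:R).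
Proof.
move=> n9; set u := (decay n)%:R : R; set u' := (decay n.+1)%:R.
have u_big : (16 * n + 4 <= decay n)%N.
  apply: leq_trans (decay_large n9); apply: leq_trans (ltnW (ltn_expl _ (ltnSn 1))); lia.
have hx : x <= expR (- (u / 2)).
  have -> : expR (- (u / 2)) = expR (u / 2) * expR (- u) by rewrite -expRD; congr expR; lra.
  apply: ler_wpM2r; first exact: expR_ge0.
  rewrite /branching -expnS; apply: le_trans (expR_nat_ge2X _) _; rewrite ler_expR.
  suff : (2 * (8 * n).+1)%:R <= u by rewrite natrM; lra.
  by rewrite ler_nat; lia.
have x0 : 0 <= x by rewrite mulr_ge0 ?expR_ge0.
have u2 : 2 <= u by rewrite ler_nat; lia.
have x12 : x <= 2^-1.
  apply: le_trans hx _; apply: (@le_trans _ _ (expR (- 1))); first by rewrite ler_expR; lra.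
  have h := @expR_ge1Dx R 1.
  by rewrite expRN lef_pV2 ?posrE ?expR_gt0 //; lra.
split; first lra.
have [Mu uM] := decay_max_cost n9.
have half : expR (- (u' + 1)) <= expR (- u') / 2.
  rewrite opprD expRD; apply: ler_wpM2l; rewrite ?expR_ge0 // expRN lef_pV2 ?posrE ?expR_gt0 //.
  by have h := @expR_ge1Dx R 1; lra.
rewrite [leRHS]splitr; apply: lerD; last first.
  apply: le_trans half.
  have y0 : 0 <= 1 - (1 - x) * expR (- (6 * M)).
    have : expR (- (6 * M)) <= 1 by rewrite -expR0 ler_expR oppr_le0 mulr_ge0.
    by have := @expR_ge0 R (- (6 * M)); nra.
  apply: (@le_trans _ _ (expR (- ((1 - x) * expR (- (6 * M)))) ^+ half_rows n)).
    apply: lerXn2r; rewrite ?nnegrE ?expR_ge0 //.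
    exact: expR_ge1Dx.
  rewrite -expRM_natl ler_expR mulrN lerN2.
  have e1 : 2^-1 * expR (- (6 * M)) <= (1 - x) * expR (- (6 * M)).
    by apply: ler_wpM2r; [exact: expR_ge0|lra].
  apply: le_trans (ler_wpM2l _ e1); last exact: ler0n.
  have e2 : ((2 ^ (12 * max_cost n))%:R)^-1 <= expR (- (6 * M)) :> R.
    rewrite expRN lef_pV2 ?posrE ?expR_gt0 // ?ltr0n ?expn_gt0 //.
    rewrite /M -natrM; apply: le_trans (expR_nat_le4X _) _.
    by rewrite mulnA.
  have e3 : u' + 1 <= (2 ^ (3 * max_cost n))%:R :> R.
    rewrite /u' natr1 ler_nat; apply: leq_ltn_trans uM _.
    have M2n : (2 ^ n <= max_cost n)%N by rewrite /max_cost leq_pmulr ?width_gt0.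
    apply: (@leq_ltn_trans (max_cost n * max_cost n * max_cost n)).
      by rewrite leq_mul2r mul2n -addnn expnD leq_mul // orbT.
    have mlt := ltn_expl (max_cost n) (ltnSn 1).
    rewrite (_ : 3 * max_cost n = max_cost n + max_cost n + max_cost n)%N; last lia.
    by rewrite !expnD; apply: ltn_mul => //; apply: ltn_mul.
  apply: le_trans e3 _.
  apply: (@le_trans _ _ ((half_rows n)%:R * (2^-1 * ((2 ^ (12 * max_cost n))%:R)^-1))); last first.
    by rewrite ler_wpM2l // ler_wpM2l // invr_ge0.
  rewrite -invfM -natrM -expnS ler_pdivlMr ?ltr0n ?expn_gt0 //.
  rewrite -natrM ler_nat /half_rows -expnD leq_exp2l //.
  by have : (0 < max_cost n)%N; [rewrite muln_gt0 expn_gt0 width_gt0|lia].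
have hxl : x ^+ (2 ^ (8 * n - 3)) <= expR (- (2 * u')).
  apply: (@le_trans _ _ (expR (- (u / 2)) ^+ (2 ^ (8 * n - 3)))).
    by apply: lerXn2r; rewrite ?nnegrE ?expR_ge0.
  rewrite -expRM_natl ler_expR mulrN lerN2.
  have := decayS n9 => /(congr1 (fun m => m%:R : R)); rewrite !natrM -/u -/u'; lra.
apply: (@le_trans _ _ ((2 * half_rows n)%:R * (2 * expR (- (2 * u'))))).
  by rewrite ler_wpM2l // ler_wpM2l.
have e1 : (8 * half_rows n)%:R <= expR u'.
  rewrite (_ : 8 = 2 ^ 3)%N // /half_rows -expnD; apply: le_trans (expR_nat_ge2X _) _.
  rewrite ler_expR ler_nat.
  by have : (0 < max_cost n)%N; [rewrite muln_gt0 expn_gt0 width_gt0|lia].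
have -> : expR (- (2 * u')) = expR (- u') * expR (- u') by rewrite -expRD; congr expR; lra.
have e3 : expR u' * expR (- u') = 1 by rewrite -expRD subrr expR0.
have e2 := @expR_gt0 R (- u').
move: e1; rewrite !natrM => e1; nra.
Qed.

End ScaleNumerics.

(** * The hierarchy of good blocks *)


(** Level [k] is scale [c + k]: a large starting scale makes the estimates valid from the outset.
    The costs [kappa] and the condition [E0] on base blocks are parameters, chosen once for the
    bonds and once for the dual bonds. *)
Fixpoint good_env {R : realType} (c : nat) (kappa : nat -> R) (E0 : nat -> Prop) (k : nat) :
    nat -> Prop :=
  if k is k'.+1 then fun J =>
    one_bad (branching (c + k')) (good_env c kappa E0 k') J /\
    forall j, block (branching (c + k')) J j ->
      \sum_(j * width (c + k') <= i < j.+1 * width (c + k')) kappa i <= (max_cost (c + k'))%:R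
  else E0.

Fixpoint height (c k : nat) : nat :=
  if k is k'.+1 then (2 * half_rows (c + k') * height c k')%N else 1%N.

(** The vertical bond sits in the second column of the block with a view to the dual bonds: dual
    column [i + 1] crosses the horizontal bonds of length [s i], whereas dual column 0 lies outside
    the quadrant. *)
Definition base_edges (L j r : nat) : seq edge :=
  (false, ((j * L).+1, r)) :: [seq (true, (i, r)) | i <- index_iota (j * L) (j.+1 * L)].

Fixpoint good {R : realType} (c : nat) (kappa : nat -> R) (E0 : nat -> Prop) (k : nat) :
    nat -> nat -> (edge -> bool) -> Prop :=
  if k is k'.+1 then
    coarse_good (width (c + k')) (height c k') (branching (c + k')) (2 * half_rows (c + k'))
      (good_env c kappa E0 k') (good_env c kappa E0 k'.+1) (good c kappa E0 k')
  else fun j r w => all w (base_edges (width c) j r).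

Fixpoint rep {R : realType} (c : nat) (kappa : nat -> R) (E0 : nat -> Prop) (k : nat) w :
    nat -> nat -> vertex :=
  if k is k'.+1 then
    coarse_rep (branching (c + k')) (2 * half_rows (c + k'))
      (good_env c kappa E0 k') (good c kappa E0 k') w (rep c kappa E0 k' w)
  else fun j r => ((j * width c).+1, r).

Lemma branching_gt1 n : (0 < n)%N -> (1 < branching n)%N.
Proof. by move=> n0; rewrite /branching -{1}(expn0 2) ltn_exp2l //; lia. Qed.

Lemma half_rows_gt0 n : (0 < half_rows n)%N. Proof. by rewrite expn_gt0. Qed.

Lemma rows_large n : (9 <= n)%N -> (2 * branching n <= 2 * half_rows n)%N.
Proof.
move=> n9; rewrite leq_mul2l /= /branching /half_rows leq_exp2l // /max_cost.
have := ltn_expl n (ltnSn 1); have := width_gt0 n; nia.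
Qed.

Section Hierarchy.
Context {R : realType}.
Variables (c : nat) (kappa : nat -> R) (E0 : nat -> Prop).
Hypothesis c9 : (9 <= c)%N.

Local Notation Ev := (good_env c kappa E0).
Local Notation Gd := (good c kappa E0).
Local Notation Rp := (rep c kappa E0).

Lemma ck_gt0 k : (0 < c + k)%N. Proof. by lia. Qed.

Lemma height_gt0 k : (0 < height c k)%N.
Proof. by elim: k => //= k IH; rewrite !muln_gt0 half_rows_gt0. Qed.

Lemma height_gt k : (k < height c k)%N.
Proof.
elim: k => //= k IH; rewrite -mulnA mul2n -addnn.
have := half_rows_gt0 (c + k); nia.
Qed.

Lemma width_c_gt1 : (1 < width c)%N.
Proof. by rewrite /width -{1}(expn0 2) ltn_exp2l //; nia. Qed.

Lemma good_env_one_bad k J : Ev k.+1 J -> one_bad (branching (c + k)) (Ev k) J.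
Proof. by case. Qed.

Lemma good_linked k w :
  linked_level w (width (c + k)) (height c k) (Ev k) (fun j r => Gd k j r w) (Rp k w).
Proof.
elim: k => [|k IH].
  rewrite addn0; have w1 := width_c_gt1.
  have row j r a b : Gd 0 j r w -> (j * width c <= a)%N -> (a <= b)%N ->
      (b <= j.+1 * width c)%N -> open_connected w (a, r) (b, r).
    rewrite -[good _ _ _ _ _ _ _]/(is_true (all w (base_edges (width c) j r))).
    move=> /allP wo ja ab bj; apply: open_connected_row => // i ib; apply: wo.
    rewrite inE; apply/orP; right; apply/mapP; exists i => //.
    by rewrite mem_index_iota; lia.
  split=> /= [j r _ _|j r _ gj _|j r _ _ gj gj1].
  - by rewrite muln1 mulSn; lia.
  - by move/andP: gj => [wv _]; exact: (open_connected_edge wv).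
  - apply: (@open_connected_trans _ _ (j.+1 * width c, r)%N).
      by apply: (row j r) => //; rewrite ?mulSn; lia.
    by apply: (row j.+1 r) => //; rewrite ?mulSn; lia.
rewrite addnS widthS.
apply: coarse_linked_level => //.
- by rewrite (ltn_trans _ (branching_gt1 (ck_gt0 k))).
- by rewrite muln_gt0 half_rows_gt0.
- exact: width_gt0.
- exact: good_env_one_bad.
- exact: branching_gt1 (ck_gt0 k).
Qed.

Lemma good_increasing k j r : increasing (Gd k j r).
Proof.
elim: k j r => [|k IH] j r; last exact: coarse_good_increasing.
by move=> w w' ww' /allP wo; apply/allP => e /wo; exact: ww'.
Qed.

Lemma good_support k j r :
  determined_by (box_support (width (c + k)) (height c k) j r) (Gd k j r).
Proof.
elim: k j r => [|k IH] j r.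
  move=> w w' ww'; rewrite /good; congr is_true; apply: eq_in_all => e.
  have w1 := width_c_gt1.
  rewrite inE => /orP[/eqP->|/mapP[i + ->]].
    by apply: ww'; rewrite /box_support /= addn0 !muln1; lia.
  rewrite mem_index_iota => ij; apply: ww'.
  by rewrite /box_support /= addn0 !muln1 mulnDl; move: ij; rewrite mulSn; lia.
rewrite addnS widthS; apply: coarse_good_support => //.
- exact: branching_gt1 (ck_gt0 k).
- exact: width_gt0.
- exact: height_gt0.
- by apply: rows_large; lia.
Qed.

Section Probability.
Variables (pi : edge -> R) (F : seq edge).
Hypotheses (pi01 : prob_weights pi) (kappa_ge0 : forall i, 0 <= kappa i).
Hypothesis pi_horizontal : forall i y, expR (- kappa i) <= pi (true, (i, y)).
Hypothesis pi_base : forall j r, E0 j ->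
  1 - expR (- (decay c)%:R) <= \prod_(e <- base_edges (width c) j r) pi e.

Lemma pr_not_good k J K : Ev k J ->
  pr pi F (fun w => ~ Gd k J K w) (fun=> true) <= expR (- (decay (c + k))%:R).
Proof.
elim: k J K => [|k IH] J K /=.
  move=> EJ; rewrite pr_not addn0 lerBlDr -lerBlDl; apply: le_trans (pi_base K EJ) _.
  have := @pr_and_all_open _ _ pi F (fun=> True) (base_edges (width c) J K) (fun=> true) pi01.
  move=> /(_ (fun=> erefl) (fun _ _ _ _ => I)).
  have -> : pr pi F (fun=> True) (fun=> true) = 1.
    by rewrite -[RHS](avg_cst pi F 1 (fun=> true)); apply: avg_ext => w; rewrite asboolT.
  rewrite mulr1 => /le_trans -> //; apply: pr_le => // w [] //.
move=> EJ; set n := (c + k)%N.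
have n9 : (9 <= n)%N by rewrite /n; lia.
have [x1 hx] := @recursion_numerics R n n9.
have b8 : branching n = (8 * 2 ^ (8 * n - 3))%N by apply: branching8; lia.
rewrite addnS -/n; apply: le_trans hx.
rewrite b8 in x1 *; apply: (@pr_not_coarse_good _ _ _ _ _ _ _ _ _ _ kappa) => //.
- by rewrite expn_gt0.
- exact: width_gt0.
- exact: height_gt0.
- exact: good_increasing.
- exact: good_support.
- by move=> J' [].
- by move=> J' j [_ h]; apply: h.
- by rewrite -b8.
Qed.

End Probability.

Lemma good_env_spine_start k : (forall j, (j < branching (c + k))%N -> Ev k j) ->
  spine_start (branching (c + k)) (Ev k) 0 = 0%N.
Proof. by move=> h; rewrite /spine_start asboolT // => j jl; apply: h; lia. Qed.

(** The spine of block 0 starts at sub-block 0, so a clear row of level [k + 1] meets the column of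
    good blocks, given by [col], that rises from the representative of level [k]. *)
Lemma rep_chain k w : (forall j, (j < branching (c + k))%N -> Ev k j) -> Ev k.+1 0 ->
  Gd k.+1 0 0 w -> (forall r, (r < 2 * branching (c + k))%N -> Gd k 0 r w) ->
  open_connected w (Rp k w 0 0) (Rp k.+1 w 0 0).
Proof.
move=> Ek Ek1 G1 col; set l := branching (c + k).
have l1 : (1 < l)%N := branching_gt1 (ck_gt0 k).
have s0 := good_env_spine_start Ek.
have sp0 : spine l (Ev k) 0 0 by have := spine_start_spine (Ev k) 0 l1; rewrite s0.
have N0 : (0 < 2 * half_rows (c + k))%N by rewrite muln_gt0 half_rows_gt0.
have bh : (2 * l <= 2 * half_rows (c + k))%N by apply: rows_large; lia.
have L0 := width_gt0 (c + k); have lev := good_linked k w.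
have [[r [rl' cl]] _] := G1.1 0%N ltac:(lia).
apply: (@open_connected_trans _ _ (Rp k w 0 r)).
  by apply: (column_connected (ltnW l1) N0 L0 lev (Ek 0%N (ltnW l1))) => // r' r'r;
    apply: col; lia.
apply: open_connected_sym.
by apply: (coarse_rep_spine (ltnW l1) N0 L0 (@good_env_one_bad k) lev Ek1 G1 _ cl sp0); lia.
Qed.

(** A horizontal link ties the representative to that of sub-block 0 one level down, and so on until
    a base row, whose bonds run to column 0. Such a link is only asked for next to a good block 1,
    whence the hypothesis on [E1s]; the descent never leaves the rows of the block it starts
    from. *)
Lemma rep_touches_left k w r : (forall i, (i <= k)%N -> Ev i 0) ->
  (forall i, (i < k)%N -> Ev i.+1 1) -> Gd k 0 r w ->
  exists2 y, (r * height c k <= y)%N & open_connected w (Rp k w 0 r) (0%N, y).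
Proof.
elim: k r => [|k IH] r E0s E1s Gr.
  exists r; rewrite ?muln1 //; apply: open_connected_sym; rewrite /= mul0n.
  apply: open_connected_row => // i i1; move/allP: Gr; apply.
  rewrite inE; apply/orP; right; apply/mapP; exists i => //.
  by rewrite mem_index_iota; have := width_c_gt1; lia.
have [r' [rr' hl]] := Gr.2 (E1s k (ltnSn k)).
have lev := good_linked k w.
have l1 := branching_gt1 (ck_gt0 k).
have j0 : pair_range (branching (c + k)) 0 0 by rewrite /pair_range /=; lia.
have Ek0 : Ev k 0 by apply: E0s.
have G0 := hl.1 0%N j0 Ek0.
have [y yr con] := IH r' (fun i ik => E0s i (leqW ik)) (fun i ik => E1s i (leqW ik)) G0.
exists y.
  apply: leq_trans yr; rewrite /= mulnA leq_mul2r; apply/orP; right.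
  by case/andP: rr'.
apply: open_connected_trans con.
have N0 : (0 < 2 * half_rows (c + k))%N by rewrite muln_gt0 half_rows_gt0.
apply: (coarse_rep_pair (ltnW l1) N0 (width_gt0 _) (@good_env_one_bad k) lev l1
  _ _ _ _ Gr rr' hl j0 Ek0) => //; [exact: E0s|exact: E1s|exact: E0s].
Qed.

End Hierarchy.

(** * Finite boxes *)


Section Realization.
Context {R : realType} {I : eqType} {d} {Omega : measurableType d}.
Variables (P : probability Omega R) (W : I -> Omega -> bool) (pi : I -> R).
Hypothesis mW : forall e b, measurable (W e @^-1` [set b]).
Hypothesis iW : indep_bool_rvs P W.
Hypothesis pW : forall e, P (W e @^-1` [set true]) = (pi e)%:E.

Let cyl (G : seq I) (w : I -> bool) : set Omega :=
  \big[setI/setT]_(i <- G) (W i @^-1` [set w i]).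

Let cyl_ext (G : seq I) (w w' : I -> bool) : (forall e, e \in G -> w e = w' e) -> cyl G w = cyl G w'.
Proof. by move=> ww'; apply: eq_big_seq => e eG; rewrite ww'. Qed.

Lemma pr_value e b : P (W e @^-1` [set b]) = (if b then pi e else 1 - pi e)%:E.
Proof.
case: b; first exact: pW.
rewrite (_ : _ @^-1` _ = ~` (W e @^-1` [set true])); last first.
  by apply/seteqP; split=> x /=; case: (W e x).
by rewrite probability_setC // pW.
Qed.

(** [G] lists the bits already revealed and [w] their values; with these as parameters, the bits of
    [F] are revealed one at a time by induction. *)
Let realization_cyl (D : (I -> bool) -> Prop) (F G : seq I) (w : I -> bool) :
  uniq (G ++ F) -> determined_by [set` G ++ F] D ->
  measurable (cyl G w `&` [set om | D (W ^~ om)]) /\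
  P (cyl G w `&` [set om | D (W ^~ om)]) =
    ((\prod_(g <- G) (if w g then pi g else 1 - pi g)) * pr pi F D w)%:E.
Proof.
have mcyl G' v : measurable (cyl G' v).
  by rewrite /cyl; elim: G' => [|g G' IH]; rewrite ?big_nil ?big_cons //; apply: measurableI.
have inG G' v om : cyl G' v om -> forall e, e \in G' -> W e om = v e.
  rewrite /cyl; elim: G' => // g G' IH; rewrite big_cons => -[/= h1 h2] e.
  by rewrite inE => /orP[/eqP->//|]; exact: IH.
elim: F G w => [|e F IH] G w.
  rewrite cats0 => uG dG; rewrite /pr /=.
  case: asboolP => Dw; rewrite ?mulr1 ?mulr0.
    rewrite setIidl; last first.
      move=> om /inG h /=; rewrite (dG _ w) //.
    by split=> //; rewrite iW //; rewrite -prodEFin; apply: eq_bigr => g _; exact: pr_value.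
  rewrite (_ : _ `&` _ = set0) ?measure0 //.
  apply/seteqP; split=> // om [/inG h] /=; rewrite (dG _ w) //.
move=> uGF dGF.
have eG : e \notin G by move: uGF; rewrite cat_uniq /= negb_or => /andP[_ /andP[/andP[]]].
have uGF' : uniq ((e :: G) ++ F) by move: uGF; rewrite -cat1s uniq_catCA.
have dGF' : determined_by [set` (e :: G) ++ F] D.
  apply: determined_sub dGF => x /=; rewrite inE !mem_cat inE => /or3P[]->;
    by rewrite ?orbT.
have split_cyl b : cyl (e :: G) (upd w e b) = W e @^-1` [set b] `&` cyl G w.
  rewrite /cyl big_cons {1}/upd eqxx; congr (_ `&` _); apply: cyl_ext => x xG.
  by rewrite /upd; case: eqP => // xe; rewrite -xe xG in eG.
have prodE b : \prod_(g <- e :: G) (if upd w e b g then pi g else 1 - pi g) =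
    (if b then pi e else 1 - pi e) * \prod_(g <- G) (if w g then pi g else 1 - pi g).
  rewrite big_cons {1}/upd eqxx; congr (_ * _); apply: eq_big_seq => x xG.
  by rewrite /upd; case: eqP => // xe; rewrite -xe xG in eG.
have [m1 p1] := IH (e :: G) (upd w e true) uGF' dGF'.
have [m0 p0] := IH (e :: G) (upd w e false) uGF' dGF'.
have -> : cyl G w `&` [set om | D (W ^~ om)] =
   (cyl (e :: G) (upd w e true) `&` [set om | D (W ^~ om)]) `|`
   (cyl (e :: G) (upd w e false) `&` [set om | D (W ^~ om)]).
  rewrite !split_cyl; apply/seteqP; split=> om /=.
    by move=> [c D']; case E: (W e om); [left|right].
  by move=> [[[_ c] D']|[[_ c] D']].
split; first exact: measurableU.
rewrite measureU //; last first.
  by rewrite !split_cyl; apply/seteqP; split=> om //= [[[/= -> _] _] [[]]].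
transitivity (((\prod_(g <- e :: G) (if upd w e true g then pi g else 1 - pi g)) *
    pr pi F D (upd w e true))%:E + ((\prod_(g <- e :: G) (if upd w e false g then pi g
    else 1 - pi g)) * pr pi F D (upd w e false))%:E)%E.
  by congr (_ + _)%E; [exact: p1|exact: p0].
by rewrite -EFinD !prodE /pr /=; congr (_%:E); ring.
Qed.

Lemma realization (D : (I -> bool) -> Prop) (F : seq I) (w : I -> bool) : uniq F -> determined_by [set` F] D ->
  measurable [set om | D (W ^~ om)] /\ P [set om | D (W ^~ om)] = (pr pi F D w)%:E.
Proof.
move=> uF dF; have := @realization_cyl D F [::] w uF dF.
by rewrite /cyl !big_nil setTI mul1r.
Qed.

End Realization.

Definition in_box (K : nat) (e : edge) : bool := (e.2.1 < K)%N && (e.2.2 < K)%N.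

Definition box_edges (K : nat) : seq edge :=
  [seq (b, v) | b <- [:: true; false],
                v <- [seq (i, n) | i <- iota 0 K, n <- iota 0 K]].

Lemma mem_box_edges K e : (e \in box_edges K) = in_box K e.
Proof.
case: e => b [i n]; rewrite /box_edges /in_box.
apply/allpairsP/idP => [[[b' [i' n']] /= [_ /allpairsP[[i'' n''] /= [ii nn]]]]|/andP[iK nK]].
  by case=> -> -> [_ -> ->]; move: ii nn; rewrite !mem_iota /= => -> ->.
exists (b, (i, n)); split; [by case: (b)| |by []].
by apply/allpairsP; exists (i, n); rewrite !mem_iota.
Qed.

Lemma uniq_box_edges K : uniq (box_edges K).
Proof.
apply: allpairs_uniq => //; last by move=> [? ?] [? ?] _ _ [-> ->].
by apply: allpairs_uniq; rewrite ?iota_uniq // => -[? ?] [? ?] _ _ [-> ->].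
Qed.

Definition outside (K : nat) (v : vertex) : Prop := (K <= v.1)%N \/ (K <= v.2)%N.

(** Only bonds whose lower left end is in the box may be used, so the event depends on finitely many
    bits; the last bond of a path may lead out of the box. *)
Definition reach (K : nat) w : Prop :=
  exists2 v, outside K v & open_connected (fun e => w e && in_box K e) origin v.

Lemma reach_increasing K : increasing (reach K).
Proof.
move=> w w' ww' [v vK c]; exists v => //; apply: open_connected_mono c => e /andP[we ->].
by rewrite ww'.
Qed.

Lemma reach_determined K : determined_by [set` box_edges K] (reach K).
Proof.
move=> w w' ww'; rewrite /reach.
have -> : (fun e => w e && in_box K e) = (fun e => w' e && in_box K e).
  apply/funext => e; have [eK|_] := boolP (in_box K e); last by rewrite !andbF.
  by rewrite ww' //= mem_box_edges.
by [].
Qed.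

Lemma connected_reach K w v : open_connected w origin v -> outside K v -> reach K w.
Proof.
move=> c vK; set wK := fun e => w e && in_box K e.
suff [//|[h1 h2 _]] : reach K w \/
    [/\ (v.1 < K)%N, (v.2 < K)%N & open_connected wK origin v].
  by case: vK; lia.
move: c; move E : origin => o c; elim: c E {vK} => {v} [u|u v z _ IH [e [we ends]]] E.
  rewrite -E; have [K0|K0] := posnP K; last by right; split=> //; exact: oc_refl.
  by left; exists origin; [left; rewrite K0|exact: oc_refl].
have [|[v1 v2 cv]] := IH E; first by left.
have eK : in_box K e.
  case: e we ends => h [i n] we /=; rewrite /in_box /=.
  by case=> -[] ev ez; move: v1 v2; rewrite -?ev -?ez /=; case: h {we ev ez} => /=; lia.
have cz : open_connected wK origin z.
  by rewrite E; apply: oc_step cv _; exists e; split=> //; rewrite /wK we.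
have [z1|z1] := leqP K z.1; first by left; exists z => //; left.
have [z2|z2] := leqP K z.2; first by left; exists z => //; right.
by right; rewrite -E.
Qed.

Lemma percolates_reach w : percolates w <-> forall K, reach K w.
Proof.
split=> [inf K|all_reach fin].
  apply: contrapT => nr; apply: inf.
  apply: (@sub_finite_set _ _ (`I_K `*` `I_K)); last exact: finite_setX.
  move=> v /= c; apply: contrapT => vK; apply: nr; apply: (connected_reach c).
  rewrite /outside; have [|v1] := leqP K v.1; first by left.
  by have [|v2] := leqP K v.2; [right|case: vK].
have [K bK] : exists K, forall v, open_connected w origin v -> ~ outside K v.
  have /finite_seqP[s sE] : finite_set [set v | open_connected w origin v] by [].
  exists (\max_(v <- s) maxn v.1 v.2).+1 => v cv.
  have vs : v \in s by have : [set` s] v by rewrite -sE.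
  have := @leq_bigmax_seq _ s xpredT (fun v : vertex => maxn v.1 v.2) v vs erefl.
  by rewrite geq_max => /andP[h1 h2] [h|h]; move: (leq_ltn_trans h1 h) (leq_ltn_trans h2 h); rewrite ltnn.
have [v vK c] := all_reach K.
by apply: (bK v) => //; apply: open_connected_mono c => e /andP[].
Qed.


Definition bond_weight {R : realType} (s : nat -> R) (p : R) (e : edge) : R :=
  p `^ edge_length s e.

(* [reach K] depends only on the bonds of [box_edges K], so the default [fun=> false] is
   immaterial. *)
Definition theta {R : realType} (s : nat -> R) (p : R) (K : nat) : R :=
  pr (bond_weight s p) (box_edges K) (reach K) (fun=> false).

Section Theta.
Context {R : realType}.
Implicit Types (s : nat -> R) (p : R).

Lemma edge_lengthE s h i n : edge_length s (h, (i, n)) = if h then `|s i| else 1.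
Proof. by rewrite /edge_length /column_pos big_ord_recr /= addrAC subrr add0r. Qed.

Lemma edge_length_ge0 s e : 0 <= edge_length s e.
Proof. by case: e => h [i n]; rewrite edge_lengthE; case: h. Qed.

Lemma bond_weight_prob s p : 0 <= p <= 1 -> prob_weights (bond_weight s p).
Proof.
move=> /andP[p0 p1] e; rewrite powR_ge0 /=.
have := @ge0_ler_powR R (edge_length s e) (edge_length_ge0 s e) p 1.
by rewrite powR1; apply; rewrite ?nnegrE.
Qed.

Lemma thetaE s p K F w : [set` box_edges K] `<=` [set` F] ->
  pr (bond_weight s p) F (reach K) w = theta s p K.
Proof.
move=> KF; apply: (@avg_cover _ _ _ _ _ [set` box_edges K]) => //.
by move=> v v' vv'; rewrite (reach_determined vv').
Qed.

Lemma theta_mono s p p' K : 0 <= p -> p <= p' -> p' <= 1 -> theta s p K <= theta s p' K.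
Proof.
move=> p0 pp' p'1; apply: avg_mono_weights.
- by apply: bond_weight_prob; rewrite p0 (le_trans pp').
- by apply: bond_weight_prob; rewrite p'1 (le_trans p0).
- move=> e; apply: (@ge0_ler_powR R _ (edge_length_ge0 s e)); rewrite ?nnegrE //.
  exact: le_trans pp'.
- exact: reach_increasing.
Qed.

Definition shift_edge (e : edge) : edge := (e.1, (e.2.1.+1, e.2.2)).

Lemma reach_shift K w : w (true, origin) -> reach K (w \o shift_edge) -> reach K w.
Proof.
move=> w0 [v vK c].
have c' : open_connected w (1%N, 0%N) (v.1.+1, v.2).
  move: c; move E : origin => o c.
  elim: c E {vK} => {v} [u <-|u v z _ IH [[h [i n]] [/andP[we _] ends]] E].
    exact: oc_refl.
  apply: (oc_step (IH E)); exists (shift_edge (h, (i, n))); split=> //.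
  move: we ends; rewrite /shift_edge /=; case: h => _ [[<- <-]|[<- <-]]; [left|right|left|right] => //.
apply: (@connected_reach _ _ (v.1.+1, v.2)).
  by apply: open_connected_trans c'; exact: (open_connected_edge w0).
by case: vK => h; [left; apply: leqW|right].
Qed.

(** A new column in front is crossed at the price of one bond at the origin. Percolation thus
    survives the insertion of columns, which is the one-sided invariance required by [zero_one]. *)
Lemma theta_shift s p K : 0 <= p <= 1 ->
  p `^ `|s 0%N| * theta (fun i => s i.+1) p K <= theta s p K.
Proof.
move=> p01; have pi01 := bond_weight_prob s p01.
set F := box_edges K.+1; set w1 : edge -> bool := fun=> true.
have KF : [set` box_edges K] `<=` [set` F].
  by move=> e /=; rewrite !mem_box_edges /in_box; lia.
rewrite -(thetaE s p w1 KF).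
pose D w := reach K (w \o shift_edge).
have iD : increasing D by move=> w w' ww'; apply: reach_increasing => e; exact: ww'.
have -> : p `^ `|s 0%N| = bond_weight s p (true, origin).
  by rewrite /bond_weight edge_lengthE.
have -> : theta (fun i => s i.+1) p K = pr (bond_weight s p) F D w1.
  rewrite /theta /pr -(@avg_map _ _ _ _ (bond_weight s p) shift_edge
    (fun w => w \o shift_edge) _ _ (fun=> false)).
  - apply: (@avg_cover _ _ _ _ _ [set` map shift_edge (box_edges K)]) => //.
    + move=> w w' ww' /=; rewrite (@reach_determined K (w \o shift_edge) (w' \o shift_edge)) //.
      by move=> e eK; apply: ww' => /=; apply: map_f.
    + by move=> e /= /mapP[e' + ->]; rewrite !mem_box_edges /in_box /=; lia.
  - by move=> [h [i n]]; rewrite /bond_weight !edge_lengthE.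
  - move=> w [h [i n]] b; apply/funext => -[h' [i' n']]; rewrite /upd /=.
    by rewrite /shift_edge /= !xpair_eqE eqSS.
apply: le_trans (pr_and_open _ pi01 _ iD) _ => //.
by apply: pr_le => // w [Dw w0]; apply: reach_shift.
Qed.

Lemma weighted_decay n : (9 <= n)%N ->
  (2 * branching n)%:R * expR (- (decay n)%:R) <= (2 ^+ n)^-1 :> R.
Proof.
move=> n9; have h : ((2 * branching n) * 2 ^ n <= 2 ^ decay n)%N.
  rewrite /branching -expnS -expnD leq_exp2l //.
  by apply: leq_trans (decay_large n9); apply: leq_trans (ltnW (ltn_expl _ (ltnSn 1))); lia.
rewrite expRN -natrX ler_pdivrMr ?expR_gt0 // mulrC ler_pdivlMr ?ltr0n ?expn_gt0 //.
by rewrite -natrM; apply: le_trans (expR_nat_ge2X _); rewrite ler_nat.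
Qed.

Lemma sum_weighted_decay c m : (9 <= c)%N ->
  \sum_(0 <= k < m) (2 * branching (c + k))%:R * expR (- (decay (c + k))%:R) <= 2^-1 :> R.
Proof.
move=> c9; suff : \sum_(0 <= k < m) (2 * branching (c + k))%:R * expR (- (decay (c + k))%:R)
    <= 2^-1 * (1 - (2 ^+ m)^-1) :> R.
  move=> /le_trans; apply; rewrite ler_piMr // gerBl invr_ge0 exprn_ge0 //.
elim: m => [|m IH]; first by rewrite big_geq // expr0 invr1 subrr mulr0.
rewrite big_nat_recr //=; apply: le_trans (lerD IH (weighted_decay (_ : 9 <= c + m)%N)) _.
  by lia.
have m0 : 0 < (2 ^+ m)^-1 :> R by rewrite invr_gt0 exprn_gt0.
have c0 : (2 ^+ c)^-1 <= 4^-1 :> R.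
  rewrite lef_pV2 ?posrE ?exprn_gt0 // (_ : 4 = 2 ^+ 2); last by rewrite expr2 -natrM.
  by rewrite ler_eXn2l // ?ltr1n //; lia.
rewrite exprD exprS !invfM; nra.
Qed.

(** * Percolation for [p] near 1 in a good environment *)

Section Primal.
Variables (c : nat) (s : nat -> R) (p T : R).
Let kappa i := `|s i|.
Let E0 (j : nat) : Prop := \sum_(j * width c <= i < j.+1 * width c) `|s i| <= T.
Hypotheses (c9 : (9 <= c)%N) (p1 : p <= 1) (p_large : expR (- 1) <= p).
Hypothesis p_base : - ln p * (1 + T) <= expR (- (decay c)%:R).
Hypothesis env_good : forall k j, (j < branching (c + k))%N -> good_env c kappa E0 k j.

(** What matters is that the bound does not depend on [K]. With probability at least 1/2, at all
    levels up to [K] the blocks of column 0 are good in the first [2 * branching (c + k)] rows;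
    representatives then form a chain from the origin to height [height c K], which exceeds [K]. A
    base row has total length at most [1 + T], so [p_base] controls the chance that it is not
    open. *)
Lemma theta_lower_bound K : 2^-1 <= theta s p K.
Proof.
have p0 : 0 < p by apply: lt_le_trans p_large; exact: expR_gt0.
have lnp1 : - 1 <= ln p by rewrite -(expRK (- 1)) ler_ln ?posrE ?expR_gt0.
have lnp0 : ln p <= 0 by apply: ln_le0.
have pi01 := bond_weight_prob s (_ : 0 <= p <= 1).
have {}pi01 : prob_weights (bond_weight s p) by apply: pi01; rewrite ltW.
have weightE e : bond_weight s p e = expR (edge_length s e * ln p).
  by rewrite /bond_weight /powR gt_eqF.
set F := box_edges K; set w1 : edge -> bool := fun=> true.
have hor i y : expR (- kappa i) <= bond_weight s p (true, (i, y)).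
  rewrite weightE edge_lengthE ler_expR /kappa.
  by have := normr_ge0 (s i); nra.
have base j r : E0 j -> 1 - expR (- (decay c)%:R) <=
    \prod_(e <- base_edges (width c) j r) bond_weight s p e.
  move=> Ej; rewrite /base_edges big_cons big_map weightE edge_lengthE mul1r.
  have -> : \prod_(i <- index_iota (j * width c) (j.+1 * width c)) bond_weight s p (true, (i, r))
     = expR ((\sum_(j * width c <= i < j.+1 * width c) `|s i|) * ln p).
    rewrite mulr_suml expR_sum; apply: eq_bigr => i _.
    by rewrite weightE edge_lengthE.
  rewrite -expRD; apply: le_trans (expR_ge1Dx _).
  move: p_base Ej; rewrite /E0; set S := \sum_(_ <= _ < _) _ => pb ST.
  nra.
have bound k r : pr (bond_weight s p) F (fun w => ~ good c kappa E0 k 0 r w) w1 <=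
    expR (- (decay (c + k))%:R).
  apply: pr_not_good => // [i|]; first exact: normr_ge0.
  exact: (env_good (ltnW (branching_gt1 (ck_gt0 c9 k)))).
pose bad k w := exists2 r, r \in iota 0 (2 * branching (c + k)) &
  ~ good c kappa E0 k 0 r w.
have Dbad : pr (bond_weight s p) F (fun w => exists2 k, k \in iota 0 K.+1 & bad k w) w1 <= 2^-1.
  apply: le_trans (sum_weighted_decay K.+1 c9).
  rewrite /index_iota subn0; apply: pr_exists_sum => // k _.
  rewrite -[X in X%:R * _](size_iota 0 (2 * branching (c + k))).
  by apply: pr_exists => // r _; exact: bound.
rewrite -(thetaE s p w1 (F := F)) //.
have -> : 2^-1 = 1 - 2^-1 :> R by lra.
apply: le_trans (lerB (lexx 1) Dbad) _; rewrite -pr_not; apply: pr_le => // w nbad.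
have G k r : (k <= K)%N -> (r < 2 * branching (c + k))%N -> good c kappa E0 k 0 r w.
  move=> kK rk; apply: contrapT => nG; apply: nbad; exists k.
    by rewrite mem_iota.
  by exists r => //; rewrite mem_iota.
have b1 k : (1 < branching (c + k))%N := branching_gt1 (ck_gt0 c9 k).
have chain k : (k <= K)%N ->
    open_connected w (rep c kappa E0 0 w 0 0) (rep c kappa E0 k w 0 0).
  elim: k => [|k IH] kK; first exact: oc_refl.
  apply: (open_connected_trans (IH (ltnW kK))); apply: rep_chain => //.
  - exact: env_good.
  - by apply: env_good; apply: ltnW.
  - by apply: G => //; have := b1 k.+1; lia.
  - by move=> r rk; apply: G => //; exact: ltnW.
have [hrep up _] := good_linked kappa E0 c9 K w.
have EK : good_env c kappa E0 K 0 by apply: env_good; exact: ltnW.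
have G0 : good c kappa E0 K 0 0 w by apply: G => //; have := b1 K; lia.
have G1 : good c kappa E0 K 0 1 w by apply: G => //; have := b1 K; lia.
apply: (@connected_reach _ _ (rep c kappa E0 K w 0 1)); last first.
  by right; rewrite (hrep 0%N 1%N EK G1).1 mul1n; exact: ltnW (height_gt c9 K).
apply: open_connected_trans (up 0%N 0%N EK G0 G1).
apply: open_connected_trans (chain K (leqnn K)).
(* The base representative sits in column 1, one bond away from the origin. *)
apply: (open_connected_row (a := 0) (b := 1)) => // i i1.
have /allP : all w (base_edges (width c) 0 0) := G 0%N 0%N (leq0n K) ltac:(have := b1 0%N; lia).
apply; rewrite inE; apply/orP; right; apply/mapP; exists i => //.
by rewrite mem_index_iota; have := width_c_gt1 c9; lia.
Qed.

End Primal.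
End Theta.

(** * The dual barrier *)


(* The dual vertex [(i, n)] is the face centred at [(i - 1/2, n - 1/2)], so the faces with [i = 0]
   or [n = 0] lie outside the quadrant and the edges between two of them cross no bond. *)
Definition dual w (e : edge) : bool :=
  match e with
  | (true, (i, n.+1)) => ~~ w (false, (i, n))
  | (false, (i.+1, n)) => ~~ w (true, (i, n))
  | _ => true
  end.

Definition dual_edge (e : edge) : edge :=
  let: (h, (i, n)) := e in if h then (false, (i.+1, n)) else (true, (i, n.+1)).

Definition dual_weight {R : realType} (pi : edge -> R) (e : edge) : R :=
  match e with
  | (true, (i, n.+1)) => 1 - pi (false, (i, n))
  | (false, (i.+1, n)) => 1 - pi (true, (i, n))
  | _ => 1
  end.

Lemma dual_upd w e b : dual (upd w e b) = upd (dual w) (dual_edge e) (~~ b).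
Proof.
apply/funext => -[[] [i n]]; case: e => -[] [i' n']; rewrite /upd /=.
all: case: i => [|i]; case: n => [|n]; rewrite /= ?xpair_eqE /= ?eqSS ?andbF //=.
all: by case: ifP.
Qed.

Lemma dual_weight_prob {R : realType} (pi : edge -> R) :
  prob_weights pi -> prob_weights (dual_weight pi).
Proof.
move=> pi01 [[] [i n]] /=.
  by case: n => [|n]; rewrite ?ler01 ?lexx //; have := pi01 (false, (i, n)); lra.
by case: i => [|i]; rewrite ?ler01 ?lexx //; have := pi01 (true, (i, n)); lra.
Qed.

Section Barrier.
Variables (w w' : edge -> bool) (K : nat).
Hypothesis w'_dual : forall e, w' e -> [&& dual w e, in_box K e & e != (false, (0%N, 0%N))].

Let right_of (x y : nat) (d : vertex) : bool := (d.2 == y.+1) && (x < d.1)%N.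

(* [S v] is the parity of the number of steps of the dual path that cross the horizontal ray
   from [v] to the right. *)
Lemma crossing_parity (a b : vertex) : open_connected w' a b ->
  exists S : vertex -> bool,
  [/\ forall x y, w (true, (x, y)) -> S (x, y) = S (x.+1, y),
      forall x y, w (false, (x, y)) ->
        S (x, y) (+) S (x, y.+1) = right_of x y a (+) right_of x y b,
      S origin = (a.2 == 0%N) (+) (b.2 == 0%N) &
      forall v, S v -> ~ outside K v].
Proof.
elim=> {a b} [u|u v z _ [S [S1 S2 S3 S4]] [[h [i n]] [we ends]]].
  by exists (fun=> false); split=> // *; rewrite ?addbb.
have /and3P[de eK e0] := w'_dual we.
have ends' (f : vertex -> bool) :
    f v (+) f z = f (i, n) (+) f (if h then (i.+1, n) else (i, n.+1)).
  by case: ends => -[-> ->] //; rewrite addbC.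
have zE (f : vertex -> bool) :
    f z = f v (+) (f (i, n) (+) f (if h then (i.+1, n) else (i, n.+1))).
  by rewrite -ends' addKb.
exists (fun x => S x (+) (~~ h && (x.2 == n) && (x.1 < i)%N)).
move: de eK e0 zE {ends ends' we}; case: h => /= de eK e0 zE.
  split=> [x y wxy|x y wxy||[x y]]; rewrite ?addbF.
  - exact: S1.
  - rewrite (S2 _ _ wxy) (zE (right_of x y)) /right_of /=.
    suff -> : (n == y.+1) && (x < i)%N (+) (n == y.+1) && (x < i.+1)%N = false.
      by rewrite addbF.
    case: eqP => //= ny; rewrite ltnS [(x <= i)%N]leq_eqVlt.
    case: (x =P i) => //= xi; last by rewrite addbb.
    by move: de; rewrite ny -xi wxy.
  - by rewrite S3 (zE (fun d => d.2 == 0%N)) /= addbb addbF.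
  - exact: S4.
split=> [x y wxy|x y wxy||[x y]] /=.
- rewrite (S1 _ _ wxy); congr (_ (+) _).
  case: eqP => //= yn; rewrite [(x < i)%N]leq_eqVlt.
  case: (x.+1 =P i) => //= xi.
  by move: de; rewrite -xi -yn wxy.
- rewrite addbACA (S2 _ _ wxy) (zE (right_of x y)) /right_of /= -addbA; congr (_ (+) (_ (+) _)).
  rewrite eqSS [n == y]eq_sym [n == y.+1]eq_sym.
  by case: (x < i)%N; rewrite ?andbT ?andbF // addbC.
(* A dual edge between rows 0 and 1 crosses the ray from the origin unless it is [(false, (0, 0))],
   which passes on the left of the origin; this is why that edge is excluded. *)
- rewrite S3 (zE (fun d => d.2 == 0%N)) /= -addbA; congr (_ (+) (_ (+) _)).
  rewrite addbF eq_sym; case: (n =P 0%N) => //= n0.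
  by move: e0; rewrite n0 !xpair_eqE /= andbT lt0n.
- case Sxy: (S (x, y)); first by move=> _; exact: S4.
  rewrite addFb => /andP[/eqP yn xi].
  by move: eK; rewrite /in_box /outside /= -yn; lia.
Qed.

(** A discrete Jordan argument. Both ends of the dual path lie outside the quadrant, where
    [right_of] does not see them, so [S] is constant along open bonds; it holds at the origin and
    fails outside the box. *)
Lemma barrier a b : (0 < b)%N -> open_connected w' (a, 0%N) (0%N, b) -> ~ reach K w.
Proof.
move=> b0 /crossing_parity[S [S1 S2 S3 S4]] [v vK c].
apply: (S4 v) vK.
have So : S origin by rewrite S3 /= gtn_eqF.
have SE x y : w (false, (x, y)) -> S (x, y) = S (x, y.+1).
  by move=> /S2; rewrite /right_of /= ltn0 andbF; case: (S (x, y)); case: (S (x, y.+1)).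
move: c So; move E : origin => o c.
elim: c E => {v} [//|u v z _ IH [[h [i n]] [/andP[we _] ends]] E So].
have := IH E So; case: h we ends => we /= [[<- <-]|[<- <-]];
  by rewrite ?(S1 _ _ we) ?(SE _ _ we).
Qed.

End Barrier.

(** * The barrier for [p] near 0 in a good environment *)

Section DualBound.
Context {R : realType}.
Variables (c : nat) (s : nat -> R) (p t : R).
Let kappa (i : nat) : R := 1.
Let E0 (j : nat) : Prop := t <= `|s (j * width c)%N|.
Hypotheses (c9 : (9 <= c)%N) (p0 : 0 <= p) (p_small : p <= 2^-1).
Hypothesis p_base : (width c)%:R * p + p `^ t <= expR (- (decay c)%:R).
Hypothesis t_gt0 : 0 < t.
Hypothesis env_good : forall k j, (j < branching (c + k))%N -> good_env c kappa E0 k j.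

(** The barrier starts on the lower side in block 1, climbs from row 0 to row 1 there, and turns
    left through block 0 of row 1 to column 0. Block 0 of row 0 is avoided, since its box contains
    the excluded dual edge. The factor 3 counts the blocks used, and [K] makes the box contain their
    supports. The cost 1 per column is admissible because [1 - p >= 1 / 2 >= exp (- 1)]. *)
Lemma theta_upper_bound k :
  exists K, theta s p K <= 3 * expR (- (decay (c + k))%:R).
Proof.
set L := width (c + k); set H := height c k; set K := (4 * L + 3 * H)%N; exists K.
have p0' := p0; have p_small' := p_small; have p_base' := p_base.
have p1 : p <= 1 by lra.
have pi01 : prob_weights (bond_weight s p) by apply: bond_weight_prob; rewrite p0.
pose pi' := dual_weight (bond_weight s p).
have pi'01 : prob_weights pi' := dual_weight_prob pi01.
pose F := map dual_edge (box_edges K); pose w1 : edge -> bool := fun=> true.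
have vert i n : bond_weight s p (false, (i, n)) = p.
  by rewrite /bond_weight edge_lengthE powRr1.
have hor i n : 1 - p <= pi' (true, (i, n)).
  by case: n => [|n] /=; [lra|rewrite vert].
have horE i y : expR (- kappa i) <= pi' (true, (i, y)).
  apply: le_trans (hor i y); rewrite /kappa expRN.
  have e1 := @expR_ge1Dx R 1.
  have : (expR 1)^-1 <= 2^-1 :> R by rewrite lef_pV2 ?posrE ?expR_gt0 //; lra.
  lra.
have prod_ge n (f : nat -> R) (r : seq nat) : (forall i, 1 - p <= f i <= 1) ->
    size r = n -> 1 - n%:R * p <= \prod_(i <- r) f i <= 1.
  move=> f1; elim: r n => [|i r IH] [|n] // => [_|[/IH /andP[h1 h2]]].
    by rewrite big_nil mul0r subr0 lexx.
  have /andP[f2 f3] := f1 i.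
  have n0 : 0 <= n%:R :> R by [].
  have pr0 : 0 <= \prod_(j <- r) f j.
    by apply: prodr_ge0 => j _; have := f1 j; lra.
  by rewrite big_cons -natr1; apply/andP; split; nra.
have base j r : E0 j -> 1 - expR (- (decay c)%:R) <=
    \prod_(e <- base_edges (width c) j r) pi' e.
  move=> Ej; rewrite /base_edges big_cons big_map.
  have := @prod_ge (width c) (fun i => pi' (true, (i, r))) (index_iota (j * width c) (j.+1 * width c)).
  have h i : 1 - p <= pi' (true, (i, r)) <= 1.
    by rewrite hor /=; have /andP[] := pi'01 (true, (i, r)).
  move=> /(_ h); rewrite size_iota mulSn addnK => /(_ erefl) /andP[q1 q2].
  have v1 : 1 - p `^ t <= pi' (false, ((j * width c).+1, r)).
    rewrite /pi' /= /bond_weight edge_lengthE lerB //.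
    have [->|pn0] := eqVneq p 0.
      have tn0 : t != 0 by rewrite gt_eqF.
      rewrite /powR eqxx (negbTE tn0) gt_eqF //.
      exact: lt_le_trans Ej.
    by rewrite /powR (negbTE pn0) ler_expR; have := @ln_le0 R p p1; move: Ej; rewrite /E0; nra.
  have v2 := pi'01 (false, ((j * width c).+1, r)).
  have pt := powR_ge0 p t.
  nra.
have bound J r : good_env c kappa E0 k J ->
    pr pi' F (fun w => ~ good c kappa E0 k J r w) w1 <= expR (- (decay (c + k))%:R).
  by apply: pr_not_good => // i; rewrite /kappa.
have b1 := branching_gt1 (ck_gt0 c9 k).
have Ek0 i : good_env c kappa E0 i 0.
  by apply: env_good; exact: ltnW (branching_gt1 (ck_gt0 c9 i)).
have Ek1 i : good_env c kappa E0 i 1.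
  by apply: env_good; exact: (branching_gt1 (ck_gt0 c9 i)).
pose G := good c kappa E0 k.
pose nbar w := ~ G 1%N 0%N w \/ (~ G 1%N 1%N w \/ ~ G 0%N 1%N w).
apply: (@le_trans _ _ (pr pi' F nbar w1)); last first.
  apply: le_trans (pr_or _ _ _ _ pi'01) _.
  have h1 := bound 1%N 0%N (Ek1 k); have h2 := bound 1%N 1%N (Ek1 k).
  have h3 := bound 0%N 1%N (Ek0 k).
  have h4 := pr_or F (fun w => ~ G 1%N 1%N w) (fun w => ~ G 0%N 1%N w) w1 pi'01.
  by rewrite /G in h4 *; lra.
(* The all-true dual configuration, from which the bound on bad blocks starts, is the dual of all
   bonds closed. *)
have w1E : w1 = dual (fun=> false) by apply/funext => -[[] [[|i] [|n]]].
rewrite w1E /pr -(@avg_map_neg _ _ _ (bond_weight s p)); first last.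
- exact: dual_upd.
- by move=> [[] [i n]] /=.
apply: pr_le => // w rw; apply: contrapT => bar; move: rw.
have [G10 G11 G01] : [/\ G 1%N 0%N (dual w), G 1%N 1%N (dual w) & G 0%N 1%N (dual w)].
  by split; apply: contrapT => nG; apply: bar; rewrite /nbar; tauto.
pose w' e := [&& dual w e, in_box K e & e != (false, (0%N, 0%N))].
have transfer J r : (J <= 1)%N -> (r <= 1)%N -> (0 < J + r)%N -> G J r (dual w) -> G J r w'.
  move=> J1 r1 Jr; rewrite /G (@good_support _ c kappa E0 c9 k J r (dual w) w') // => e; rewrite /box_support /= => He.
  have L0 : (0 < L)%N := width_gt0 _.
  have H0 : (0 < H)%N := height_gt0 c k.
  have eK : in_box K e by rewrite /in_box /K; move: He; rewrite -/L -/H; nia.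
  rewrite /w' eK /=; case: eqP => [e0|]; last by rewrite andbT.
  by move: He; rewrite e0 /= -/L -/H; nia.
have {}G10 := transfer 1%N 0%N erefl erefl erefl G10.
have {}G11 := transfer 1%N 1%N erefl erefl erefl G11.
have {}G01 := transfer 0%N 1%N erefl erefl erefl G01.
have [hrep up right] := good_linked kappa E0 c9 k w'.
have [y yH con] := rep_touches_left c9 (fun i _ => Ek0 i) (fun i _ => Ek1 i.+1) G01.
have rep0 := (hrep 1%N 0%N (Ek1 k) G10).1; rewrite mul0n in rep0.
apply: (@barrier w w' K _ (rep c kappa E0 k w' 1 0).1 y) => //.
- by apply: leq_trans yH; rewrite mul1n; exact: height_gt0.
- rewrite -[X in (_, X)]rep0 -surjective_pairing.
  apply: (open_connected_trans (up _ _ (Ek1 k) G10 G11)).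
  apply: open_connected_trans con; apply: open_connected_sym.
  exact: right.
Qed.

End DualBound.

(** * Sequences of column spacings *)

(** Carries [mf] as an argument, so that a measure, and then a probability, can be declared for it
    canonically. *)
Definition image_measure d1 d2 (T1 : measurableType d1) (T2 : measurableType d2)
    (R : realType) (m : {measure set T1 -> \bar R}) (f : T1 -> T2)
    (mf : measurable_fun setT f) : set T2 -> \bar R := pushforward m f.

Section ImageMeasure.
Context d1 d2 (T1 : measurableType d1) (T2 : measurableType d2) (R : realType).
Variables (m : {measure set T1 -> \bar R}) (f : T1 -> T2) (mf : measurable_fun setT f).

Lemma measurable_preimage A : measurable A -> measurable (f @^-1` A).
Proof. by move=> mA; rewrite -[X in measurable X]setTI; exact: mf. Qed.

Let image0 : image_measure m mf set0 = 0%E.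
Proof. exact: (measure0 (pushforward m f)). Qed.

Let image_ge0 A : (0 <= image_measure m mf A)%E.
Proof. exact: measure_ge0. Qed.

Let image_sigma_additive : semi_sigma_additive (image_measure m mf).
Proof. exact: measure_semi_sigma_additive. Qed.

HB.instance Definition _ := isMeasure.Build _ _ _ (image_measure m mf)
  image0 image_ge0 image_sigma_additive.

End ImageMeasure.

Section ImageProbability.
Context d1 d2 (T1 : measurableType d1) (T2 : measurableType d2) (R : realType).
Variables (m : probability T1 R) (f : T1 -> T2) (mf : measurable_fun setT f).

Let image_setT : image_measure m mf setT = 1%E.
Proof.
by rewrite -(probability_setT m) /image_measure /pushforward; congr (m _); rewrite preimage_setT.
Qed.

HB.instance Definition _ := Measure_isProbability.Build _ _ _ (image_measure m mf) image_setT.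

End ImageProbability.

Section SequenceSpace.
Context {R : realType}.
Implicit Types (B : nat -> set R).

Definition cylinder (n : nat) B : set (nat -> R) := [set s | forall i, (i < n)%N -> B i (s i)].

Definition cylinders : set (set (nat -> R)) :=
  [set C | exists n B, (forall i, measurable (B i)) /\ C = cylinder n B].

Definition sequences : Type := g_sigma_algebraType cylinders.

HB.instance Definition _ := Measurable.on sequences.

Definition shift_seq (n : nat) (s : sequences) : sequences := fun i => s (n + i)%N.

(** Dependence on the first [n] coordinates alone is stated as invariance of a set under the
    preimage by [truncate_seq n]. *)
Definition truncate_seq (n : nat) (s : sequences) : sequences :=
  fun i => if (i < n)%N then s i else 0.

Lemma measurable_cylinder n B : (forall i, measurable (B i)) ->
  measurable (cylinder n B : set sequences).
Proof. by move=> mB; apply: sub_sigma_algebra; exists n, B. Qed.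

Lemma cylinderI n m B B' :
  cylinder n B `&` cylinder m B' = cylinder (maxn n m)
    (fun i => (if (i < n)%N then B i else setT) `&` (if (i < m)%N then B' i else setT)).
Proof.
apply/seteqP; split=> s.
  by move=> [h h'] i _; split; case: ifP => // im; [exact: h|exact: h'].
move=> h; split=> i im; have := h i; rewrite leq_max im ?orbT => /(_ erefl) [] //.
Qed.

Lemma cylinders_setI : setI_closed cylinders.
Proof.
move=> _ _ [n [B [mB ->]]] [m [B' [mB' ->]]]; rewrite cylinderI.
exists (maxn n m), (fun i => (if (i < n)%N then B i else setT) `&`
  (if (i < m)%N then B' i else setT)); split=> // i.
by apply: measurableI; case: ifP.
Qed.

Lemma cylinder_setT n : cylinder n (fun=> setT) = setT.
Proof. by apply/seteqP; split. Qed.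

Lemma cylinder_unique (m1 m2 : {measure set sequences -> \bar R}) :
  (forall n B, (forall i, measurable (B i)) -> m1 (cylinder n B) = m2 (cylinder n B)) ->
  (m1 setT < +oo)%E -> forall A, measurable A -> m1 A = m2 A.
Proof.
move=> m12 m1T A mA.
apply: (@measure_unique _ R sequences cylinders (fun=> setT)) => //.
- exact: cylinders_setI.
- by move=> _; exists 0%N, (fun=> setT); rewrite cylinder_setT; split=> // i; exact: measurableT.
- by apply/seteqP; split=> // s _; exists 0%N.
- by move=> _ [n [B [mB ->]]]; exact: m12.
Qed.

Lemma measurable_to_sequences d (T : measurableType d) (f : T -> sequences) :
  (forall n B, (forall i, measurable (B i)) -> measurable (f @^-1` cylinder n B)) ->
  measurable_fun setT f.
Proof.
move=> mf; apply: (@measurability _ _ _ _ setT f cylinders) => // _ [_ [n [B [mB ->]]] <-].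
by rewrite setTI; apply: mf.
Qed.

Lemma measurable_coordinate i : measurable_fun setT (fun s : sequences => s i).
Proof.
move=> _ B mB; rewrite setTI.
rewrite (_ : _ @^-1` _ = cylinder i.+1 (fun j => if j == i then B else setT)).
  by apply: measurable_cylinder => j; case: ifP.
apply/seteqP; split=> s /=.
  by move=> Bs j _; case: eqP => // ->.
by move=> /(_ i (ltnSn i)); rewrite eqxx.
Qed.

Lemma measurable_shift n : measurable_fun setT (shift_seq n).
Proof.
apply: measurable_to_sequences => m B mB.
rewrite (_ : _ @^-1` _ = cylinder (n + m) (fun i => if (i < n)%N then setT else B (i - n)%N)).
  by apply: measurable_cylinder => i; case: ifP.
apply/seteqP; split=> s h i im.
  case: ltnP => // ni; have := h (i - n)%N; rewrite /shift_seq subnKC //; apply.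
  by rewrite ltn_subLR.
by have := h (n + i)%N; rewrite ltn_add2l im => /(_ isT); rewrite ltnNge leq_addr /= addKn.
Qed.

Lemma measurable_truncate n : measurable_fun setT (truncate_seq n).
Proof.
apply: measurable_to_sequences => m B mB.
rewrite (_ : _ @^-1` _ = \bigcap_(i in `I_m) ((fun s : sequences => truncate_seq n s i) @^-1` B i)).
  apply: bigcap_measurableType => i _; rewrite /truncate_seq; case: (i < n)%N.
    by rewrite -[X in measurable X]setTI; exact: measurable_coordinate.
  by rewrite -[X in measurable X]setTI; apply: measurable_cst.
by apply/seteqP; split=> s h i im; apply: h.
Qed.

(** * Stationarity, independence and the zero-one law *)

Section Law.
Variables (mu : probability R R) (lambda : probability sequences R).
Hypothesis lambda_cylinder : forall n B, (forall i, measurable (B i)) ->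
  lambda (cylinder n B) = (\prod_(i < n) mu (B i))%E.


Lemma lambda_shift n A : measurable A -> lambda (shift_seq n @^-1` A) = lambda A.
Proof.
move=> mA; apply: (@cylinder_unique (image_measure lambda (measurable_shift n)) lambda) => //.
  move=> m B mB; rewrite /= /image_measure /pushforward.
  rewrite (_ : _ @^-1` _ = cylinder (n + m) (fun i => if (i < n)%N then setT else B (i - n)%N)).
    rewrite !lambda_cylinder //; last by move=> i; case: ifP.
    rewrite big_split_ord /= [X in (X * _)%E]big1 ?mul1e.
      by apply: eq_bigr => i _; rewrite ltnNge leq_addr /= addKn.
    by move=> i _; rewrite ltn_ord probability_setT.
  apply/seteqP; split=> s h i im.
    case: ltnP => // ni; have := h (i - n)%N; rewrite /shift_seq subnKC //; apply.
    by rewrite ltn_subLR.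
  by have := h (n + i)%N; rewrite ltn_add2l im => /(_ isT); rewrite ltnNge leq_addr /= addKn.
by rewrite /= probability_setT ltry.
Qed.

(** As functions of [A] both sides are finite measures: [lambda] restricted to the cylinder and
    pushed by the shift, and a multiple of [lambda]. They agree on cylinders, hence everywhere. *)
Lemma cylinder_indep n B A : (forall i, measurable (B i)) -> measurable A ->
  lambda (cylinder n B `&` shift_seq n @^-1` A) = (lambda (cylinder n B) * lambda A)%E.
Proof.
move=> mB mA; have mC : measurable (cylinder n B : set sequences) := measurable_cylinder n mB.
have fC := fin_num_measure lambda _ mC.
have C0 : 0 <= fine (lambda (cylinder n B)) by exact: fine_ge0.
suff : image_measure (mrestr lambda mC) (measurable_shift n) A = mscale (NngNum C0) lambda A.
  by rewrite /image_measure /pushforward /mscale /mrestr /= fineK // setIC.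
apply: cylinder_unique => // [m B' mB'|]; rewrite /= /image_measure /pushforward /mscale /mrestr /=.
  rewrite fineK // [X in lambda X](_ : _ = cylinder (n + m)
      (fun i => if (i < n)%N then B i else B' (i - n)%N)).
    rewrite !lambda_cylinder //; last by move=> i; case: ifP.
    rewrite big_split_ord /=; congr (_ * _)%E.
      by apply: eq_bigr => i _; rewrite ltn_ord.
    by apply: eq_bigr => i _; rewrite ltnNge leq_addr /= addKn.
  apply/seteqP; split=> s.
    move=> [h h'] i im; case: ltnP => ni; first exact: h'.
    have := h (i - n)%N; rewrite /shift_seq subnKC //; apply; by rewrite ltn_subLR.
  move=> h; split=> i im.
    by have := h (n + i)%N; rewrite ltn_add2l im => /(_ isT); rewrite ltnNge leq_addr /= addKn.
  by have := h i; rewrite im; apply; rewrite ltn_addr.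
by rewrite preimage_setT setTI -ge0_fin_numE.
Qed.

Lemma truncate_indep n A A' : measurable A -> measurable A' ->
  lambda (truncate_seq n @^-1` A `&` shift_seq n @^-1` A') = (lambda (truncate_seq n @^-1` A) * lambda A')%E.
Proof.
move=> mA mA'.
have mS : measurable (shift_seq n @^-1` A') := measurable_preimage (measurable_shift n) mA'.
have fA' := fin_num_measure lambda _ mA'.
have A'0 : 0 <= fine (lambda A') by exact: fine_ge0.
suff : image_measure (mrestr lambda mS) (measurable_truncate n) A =
    mscale (NngNum A'0) (image_measure lambda (measurable_truncate n)) A.
  by rewrite /image_measure /pushforward /mscale /mrestr /= fineK // muleC.
apply: cylinder_unique => // [m B mB|]; rewrite /= /image_measure /pushforward /mscale /mrestr /=.
  rewrite fineK // muleC.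
  (* The truncated sequence is 0 from [n] on: either every [B i] with [n <= i < m] contains 0, and
     the condition concerns the first [n] coordinates only, or the preimage is empty. *)
  have [B0|/existsNP[i /not_implyP[/andP[ni im] nB]]] :=
      pselect (forall i, (n <= i < m)%N -> B i 0).
    rewrite (_ : truncate_seq n @^-1` _ = cylinder n (fun i => if (i < m)%N then B i else setT)).
      by apply: cylinder_indep => // i; case: ifP.
    apply/seteqP; split=> s h i im.
      by case: ifP => // iM; have := h i iM; rewrite /truncate_seq im.
    rewrite /truncate_seq; case: ltnP => ni; last by apply: B0; rewrite ni.
    by have := h i ni; rewrite im.
  have -> : truncate_seq n @^-1` cylinder m B = set0.
    by apply/seteqP; split=> // s /(_ i im); rewrite /truncate_seq ltnNge ni.
  by rewrite set0I measure0 mul0e.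
by rewrite preimage_setT setTI -ge0_fin_numE // fin_num_measure.
Qed.

Lemma block_indep n A A' : measurable A -> measurable A' -> truncate_seq n @^-1` A = A ->
  lambda (A `&` shift_seq n @^-1` A') = (lambda A * lambda A')%E.
Proof. by move=> mA mA' tA; rewrite -{1 2}tA truncate_indep // tA. Qed.

(* A set increasing under adding coordinates in front agrees almost surely with all its
   shifts, hence is independent of every cylinder and of itself. *)
Lemma zero_one A : measurable A -> shift_seq 1 @^-1` A `<=` A ->
  lambda A = 0%E \/ lambda A = 1%E.
Proof.
move=> mA sA.
have sAn n : shift_seq n @^-1` A `<=` A.
  elim: n => [|n IH] s.
    by rewrite /= (_ : shift_seq 0 s = s).
  by move=> h; apply: sA; apply: (IH (shift_seq 1 s)); exact: h.
have mSn n := measurable_preimage (measurable_shift n) mA.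
have fA := fin_num_measure lambda _ mA.
have A0 : 0 <= fine (lambda A) by exact: fine_ge0.
have AA : lambda A = (lambda A * lambda A)%E.
  suff : mrestr lambda mA A = mscale (NngNum A0) lambda A.
    by rewrite /mscale /mrestr /= fineK // setIid.
  apply: cylinder_unique => // [n B mB|]; rewrite /= /mscale /mrestr /=; last first.
    by rewrite setTI -ge0_fin_numE.
  rewrite fineK //; have mC : measurable (cylinder n B : set sequences) := measurable_cylinder n mB.
  rewrite muleC -(cylinder_indep n mB mA).
  have mD : measurable (A `\` shift_seq n @^-1` A) by exact: measurableD.
  have D0 : lambda (A `\` shift_seq n @^-1` A) = 0%E.
    rewrite measureD //; last by rewrite -ge0_fin_numE.
    have -> : A `&` shift_seq n @^-1` A = shift_seq n @^-1` A by apply/setIidr/sAn.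
    transitivity (lambda A - lambda A)%E; last exact: subee.
    by congr (_ - _)%E; exact: lambda_shift.
  have -> : cylinder n B `&` A = (cylinder n B `&` shift_seq n @^-1` A) `|`
      (cylinder n B `&` (A `\` shift_seq n @^-1` A)).
    rewrite -setIUr; congr (_ `&` _); apply/seteqP; split=> s.
      by move=> As; have [h|h] := pselect ((shift_seq n @^-1` A) s); [left|right].
    by case=> [|[]//]; exact: sAn.
  rewrite measureU.
  - rewrite [X in (_ + X)%E](_ : _ = 0%E) ?adde0 //.
    apply/eqP; rewrite eq_le measure_ge0 andbT -D0; apply: le_measure; rewrite ?inE //.
    by apply: measurableI.
  - exact: measurableI.
  - exact: measurableI.
  - by apply/seteqP; split=> // s [[_ h] [_ []]].
move: AA; rewrite -(fineK fA) -EFinM => -[] h.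
have : fine (lambda A) * (fine (lambda A) - 1) = 0 by rewrite mulrBr mulr1 -h subrr.
move/eqP; rewrite mulf_eq0 subr_eq0 => /orP[/eqP->|/eqP->]; [by left|by right].
Qed.

End Law.
End SequenceSpace.

(** * Environments that are good at every scale *)

Section UnionBound.
Context {R : realType} d {T : measurableType d} (P : probability T R).

Lemma union_bound (A : set T) (B : nat -> set T) (n : nat) (x : R) :
  measurable A -> (forall i, measurable (B i)) ->
  (forall i, (i < n)%N -> (P (B i) <= x%:E)%E) ->
  (forall t, A t -> exists2 i, (i < n)%N & B i t) -> (P A <= (n%:R * x)%:E)%E.
Proof.
move=> mA mB Bx AB.
apply: (@le_trans _ _ (P (\big[setU/set0]_(i < n) B i))).
  apply: le_measure; rewrite ?inE //; first exact: bigsetU_measurable.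
  by move=> t /AB [i i_n Bt]; rewrite -bigcup_mkord; exists i.
apply: (le_trans (Boole_inequality P (fun i _ => mB i))).
apply: (@le_trans _ _ (\sum_(i < n) x%:E)%E); first by apply: lee_sum => i _; apply: Bx.
by rewrite sumEFin sumr_const card_ord mulr_natl.
Qed.

End UnionBound.

Section Environment.
Context {R : realType}.
Variables (mu : probability R R) (lambda : probability (@sequences R) R).
Hypothesis lambda_cylinder : forall n (B : nat -> set R), (forall i, measurable (B i)) ->
  lambda (cylinder n B) = (\prod_(i < n) mu (B i))%E.
Variables (c : nat) (kap : R -> R) (E0 : @sequences R -> nat -> Prop).
Hypotheses (c9 : (9 <= c)%N) (mkap : measurable_fun setT kap).
Hypothesis E0_shift : forall s a j, E0 s (a + j) = E0 (shift_seq (a * width c) s) j.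
Hypothesis E0_local : forall s s' j,
  (forall i, (i < j.+1 * width c)%N -> s i = s' i) -> E0 s j = E0 s' j.
Hypothesis E0_measurable : forall j, measurable [set s | E0 s j].
Hypothesis E0_prob : (lambda [set s | ~ E0 s 0%N] <= ((2 ^+ (32 * c))^-1)%:E)%E.
Hypothesis cost_prob : forall n, (c <= n)%N ->
  (lambda [set s | ((max_cost n)%:R < \sum_(0 <= i < width n) kap (s i))%R]
    <= ((2 ^+ (40 * n + 33))^-1)%:E)%E.

Definition env (s : @sequences R) (k j : nat) : Prop :=
  good_env c (fun i => kap (s i)) (E0 s) k j.

Let bad k j : set (@sequences R) := [set s | ~ env s k j].

Let cost (W j : nat) (s : @sequences R) : R := \sum_(j * W <= i < j.+1 * W) kap (s i).

Lemma cost_shift W a j s : cost W (a + j) s = cost W j (shift_seq (a * W) s).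
Proof.
rewrite /cost -addnS !mulnDl -{1}[(a * W + j * W)%N]addnC big_addn.
rewrite [(a * W + j.+1 * W)%N]addnC addnK.
by apply: eq_bigr => i _; rewrite /shift_seq addnC.
Qed.

Lemma env_shift s k a j : env s k (a + j) = env (shift_seq (a * width (c + k)) s) k j.
Proof.
rewrite /env; elim: k s a j => [|k IH] s a j /=; first by rewrite addn0 E0_shift.
set l := branching (c + k); set W := width (c + k).
have -> : (a * width (c + k.+1) = a * l * W)%N by rewrite addnS widthS mulnA.
set s' := shift_seq (a * l * W) s.
have blockE i : block l (a + j) i -> exists2 i', i = (a * l + i')%N & block l j i'.
  by rewrite /block /= => ij; exists (i - a * l)%N; nia.
have blockD i : block l j i -> block l (a + j) (a * l + i).
  by rewrite /block /=; nia.
apply/propext; split=> -[[b Eb] M].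
  split; last by move=> i ij; rewrite -[X in X <= _]/(cost W i s') -cost_shift; apply/M/blockD.
  exists (b - a * l)%N => i ij ib; rewrite -IH; apply: Eb; first exact: blockD.
  by move=> aib; apply: ib; rewrite -aib addKn.
split; last first.
  by move=> i /blockE[i' -> ij]; rewrite -[X in X <= _]/(cost W _ s) cost_shift; apply: M.
exists (a * l + b)%N => i /blockE[i' -> ij] ib; rewrite IH; apply: Eb => //.
by move=> i'b; apply: ib; rewrite i'b.
Qed.

Lemma env_local s s' k j : (forall i, (i < j.+1 * width (c + k))%N -> s i = s' i) ->
  env s k j = env s' k j.
Proof.
rewrite /env; elim: k j => [|k IH] j ss' /=; first by apply: E0_local; rewrite -(addn0 c).
set l := branching (c + k); set W := width (c + k).
have ss'W i i' : block l j i -> (i' < i.+1 * W)%N -> s i' = s' i'.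
  rewrite /block /= => /andP[_ ij] i'i; apply: ss'; apply: leq_trans i'i _.
  by rewrite addnS widthS -/l -/W mulnA leq_mul2r ij orbT.
have IH' i : block l j i ->
   good_env c (fun i => kap (s i)) (E0 s) k i = good_env c (fun i => kap (s' i)) (E0 s') k i.
  by move=> ij; apply: IH => i'; exact: ss'W.
have costE i : block l j i -> \sum_(i * W <= i0 < i.+1 * W) kap (s i0) =
    \sum_(i * W <= i0 < i.+1 * W) kap (s' i0).
  move=> ij; rewrite big_nat [RHS]big_nat; apply: eq_bigr => i' /andP[_ i'i].
  by rewrite (ss'W i).
apply/propext; split=> -[[b Eb] M]; (split; [exists b => i ij ib|move=> i ij]).
- by rewrite -IH' //; apply: Eb.
- by rewrite -costE //; apply: M.
- by rewrite IH' //; apply: Eb.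
- by rewrite costE //; apply: M.
Qed.

Lemma measurable_cost W j : measurable_fun setT (cost W j).
Proof.
rewrite /cost; apply: (@measurable_sum _ _ _ _ _ _ (fun i (s : @sequences R) => kap (s i))) => i.
exact: (measurableT_comp mkap (measurable_coordinate i)).
Qed.

Lemma measurable_imply d (T : measurableType d) (Q : Prop) (A : set T) :
  measurable A -> measurable [set t | Q -> A t].
Proof.
move=> mA; have [q|nq] := pselect Q.
  have -> // : [set t | Q -> A t] = A by apply/seteqP; split=> t; [move=> /= /(_ q)|move=> ? ?].
have -> : [set t | Q -> A t] = setT by apply/seteqP; split=> // t _ /nq.
exact: measurableT.
Qed.

Lemma env_measurable k j : measurable [set s | env s k j].
Proof.
rewrite /env; elim: k j => [|k IH] j; first exact: E0_measurable.
set l := branching (c + k); set W := width (c + k).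
have -> : [set s | good_env c (fun i => kap (s i)) (E0 s) k.+1 j] =
    (\bigcup_b \bigcap_i [set s | block l j i -> i <> b ->
      good_env c (fun i => kap (s i)) (E0 s) k i]) `&`
    \bigcap_i [set s | block l j i -> (cost W i s <= (max_cost (c + k))%:R)%R].
  apply/seteqP; split=> s.
    by move=> [[b Eb] M]; split; [exists b => // i _ ij ib; apply: Eb|move=> i _ ij; exact: M].
  by move=> [[b _ Eb] M]; split; [exists b => i; exact: Eb|move=> i; exact: M].
apply: measurableI.
  apply: bigcupT_measurable => b; apply: bigcapT_measurable => i.
  by do 2 apply: measurable_imply; exact: IH.
apply: bigcapT_measurable => i; apply: measurable_imply.
have := measurable_preimage (measurable_cost W i) (measurable_itv `]-oo, (max_cost (c + k))%:R]).
by congr measurable; apply/seteqP; split=> s /=; rewrite in_itv.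
Qed.

Lemma bad_measurable k j : measurable (bad k j).
Proof. by apply: measurableC; exact: env_measurable. Qed.

Lemma bad_shift k a j : bad k (a + j) = shift_seq (a * width (c + k)) @^-1` bad k j.
Proof. by apply/seteqP; split=> s; rewrite /bad /= env_shift. Qed.

Lemma lambda_bad k j : lambda (bad k j) = lambda (bad k 0).
Proof.
rewrite -[j in LHS]addn0 bad_shift (lambda_shift lambda_cylinder) //.
exact: bad_measurable.
Qed.

(** Block [i] depends on the coordinates before its right end, and block [j] is read off the
    sequence shifted to that end. *)
Lemma lambda_bad2 k i j : (i < j)%N ->
  lambda (bad k i `&` bad k j) = (lambda (bad k 0) * lambda (bad k 0))%E.
Proof.
move=> ij; rewrite -(subnKC ij) bad_shift (block_indep lambda_cylinder).
- by rewrite !lambda_bad.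
- exact: bad_measurable.
- exact: bad_measurable.
- apply/seteqP; split=> s; rewrite /bad /= (@env_local s (truncate_seq (i.+1 * width (c + k)) s)) //;
    by move=> i' i'i; rewrite /truncate_seq i'i.
Qed.

(** A bad block of scale [n + 1] has two bad sub-blocks among its [l = 2 ^ (8 n)], or one that is
    too costly. With [q = 2 ^ (- 32 n)] the union bound gives [l ^ 2 q ^ 2 = 2 ^ (- 48 n)] and
    [l 2 ^ (- 40 n - 33) = 2 ^ (- 32 n - 33)], each at most half of [2 ^ (- 32 (n + 1))]. *)
Lemma lambda_bad_le k : (lambda (bad k 0) <= ((2 ^+ (32 * (c + k)))^-1)%:E)%E.
Proof.
elim: k => [|k IH]; first by rewrite addn0.
set n := (c + k)%N in IH *; set l := branching n; set W := width n.
set q : R := (2 ^+ (32 * n))^-1 in IH.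
have q0 : 0 <= q by rewrite invr_ge0 exprn_ge0.
pose B1 i : set (@sequences R) := [set s | exists2 j, (j < l)%N & (i < j)%N /\ bad k i s /\ bad k j s].
pose B2 i : set (@sequences R) := [set s | ((max_cost n)%:R < cost W i s)%R].
have mpair i j : measurable ([set s | (i < j)%N /\ bad k i s /\ bad k j s] : set (@sequences R)).
  have [ij|ij] := boolP (i < j)%N; last first.
    by rewrite (_ : [set _ | _] = set0) //; apply/seteqP; split=> // s [].
  rewrite (_ : [set _ | _] = bad k i `&` bad k j); first by apply: measurableI; exact: bad_measurable.
  by apply/seteqP; split=> s [] //.
have mB1 i : measurable (B1 i).
  rewrite (_ : B1 i = \bigcup_(j in `I_l) [set s | (i < j)%N /\ bad k i s /\ bad k j s]).
    by apply: bigcup_measurable => j _; exact: mpair.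
  by apply/seteqP; split=> s [j jl h]; exists j.
have mB2 i : measurable (B2 i).
  have := measurable_preimage (measurable_cost W i) (measurable_itv `](max_cost n)%:R, +oo[).
  by congr measurable; apply/seteqP; split=> s /=; rewrite in_itv /= andbT.
have pB1 i : (lambda (B1 i) <= (l%:R * (q * q))%:E)%E.
  apply: (@union_bound _ _ _ lambda _ (fun j => [set s | (i < j)%N /\ bad k i s /\ bad k j s])) => //.
    move=> j _; have [ij|ij] := boolP (i < j)%N; last first.
      rewrite (_ : [set _ | _] = set0) ?measure0 ?lee_fin ?mulr_ge0 //.
      by apply/seteqP; split=> // s [].
    rewrite (_ : [set _ | _] = bad k i `&` bad k j); last by apply/seteqP; split=> s [] //.
    by rewrite lambda_bad2 // EFinM; apply: lee_pmul.
have pB2 i : (lambda (B2 i) <= ((2 ^+ (40 * n + 33))^-1)%:E)%E.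
  apply: le_trans (cost_prob (_ : c <= n)%N); last by rewrite /n; lia.
  have -> : B2 i = shift_seq (i * W) @^-1` [set s | ((max_cost n)%:R < \sum_(0 <= i < W) kap (s i))%R].
    have cE s : cost W i s = \sum_(0 <= i0 < W) kap (shift_seq (i * W) s i0).
      by rewrite -[i in LHS]addn0 cost_shift /cost mul0n mul1n.
    by apply/seteqP; split=> s; rewrite /B2 /mkset cE.
  rewrite (lambda_shift lambda_cylinder) //.
  have := mB2 0%N; congr measurable; apply/seteqP; split=> s; rewrite /B2 /cost /= mul0n mul1n //.
apply: (@le_trans _ _ (lambda (\big[setU/set0]_(i < l) B1 i `|` \big[setU/set0]_(i < l) B2 i))).
  apply: le_measure; rewrite ?inE; [exact: bad_measurable| |].
    by apply: measurableU; apply: bigsetU_measurable.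
  move=> s /=; rewrite /env /= -/n -/l -/W => nE.
  rewrite -!bigcup_mkord.
  have [[i il iM]|noM] := pselect (exists2 i, (i < l)%N & B2 i s); first by right; exists i.
  left.
  have nob : ~ one_bad l (env s k) 0.
    move=> ob; apply: nE; split=> // j jl; rewrite leNgt; apply/negP => jM.
    by apply: noM; exists j; [move: jl; rewrite /block /= ?mul0n mul1n|exact: jM].
  have get b : exists j, [/\ (j < l)%N, j <> b & bad k j s].
    apply: contrapT => nj; apply: nob; exists b => j jl jb; apply: contrapT => bj.
    by apply: nj; exists j; split=> //; move: jl; rewrite /block /= ?mul0n mul1n.
  (* The index [l] lies outside the block, so [get l] yields any bad sub-block, and [get j] a second
     one. *)
  have [j [jl _ bj]] := get l; have [j' [j'l jj' bj']] := get j.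
  have [lt|lt|jj] := ltngtP j j'; last by case: jj'.
    by exists j => //; exists j'.
  by exists j' => //; exists j.
apply: (@le_trans _ _ (lambda (\big[setU/set0]_(i < l) B1 i) +
    lambda (\big[setU/set0]_(i < l) B2 i))%E).
  by apply: measureU2; apply: bigsetU_measurable.
apply: (@le_trans _ _ ((l%:R * (l%:R * (q * q)))%:E + (l%:R * (2 ^+ (40 * n + 33))^-1)%:E)%E).
  apply: leeD.
    apply: (@union_bound _ _ _ lambda _ B1) => //; first exact: bigsetU_measurable.
    by move=> s; rewrite -bigcup_mkord => -[i il h]; exists i.
  apply: (@union_bound _ _ _ lambda _ B2) => //; first exact: bigsetU_measurable.
  by move=> s; rewrite -bigcup_mkord => -[i il h]; exists i.
rewrite -EFinD lee_fin [(c + k.+1)%N]addnS -/n /l /branching /q.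
pose t : R := 2 ^+ (8 * n).
have t0 : 0 < t by rewrite exprn_gt0.
have tbig : 2 ^+ 33 <= t * t.
  by rewrite -exprD ler_eXn2l ?ltr1n //; rewrite /n; lia.
have -> : (2 ^ (8 * n))%:R = t by rewrite natrX.
have e32 : 2 ^+ (32 * n) = t ^+ 4 by rewrite /t -exprM; congr (_ ^+ _); lia.
have e40 : 2 ^+ (40 * n + 33) = t ^+ 5 * 2 ^+ 33 by rewrite /t -exprM exprD; congr (_ ^+ _ * _); lia.
have e32' : 2 ^+ (32 * n.+1) = t ^+ 4 * 2 ^+ 32 by rewrite -e32 -exprD; congr (_ ^+ _); lia.
rewrite e32 e40 e32'.
have -> : t * (t * ((t ^+ 4)^-1 * (t ^+ 4)^-1)) = (t ^+ 4)^-1 * (t * t)^-1.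
  by field; rewrite gt_eqF.
have -> : t * (t ^+ 5 * 2 ^+ 33)^-1 = (t ^+ 4)^-1 * (2 ^+ 33)^-1.
  by field; rewrite gt_eqF.
rewrite -mulrDr [leRHS]invfM; apply: ler_wpM2l; first by rewrite invr_ge0 exprn_ge0 // ltW.
have h : (t * t)^-1 <= (2 ^+ 33)^-1 by rewrite lef_pV2 ?posrE ?mulr_gt0 ?exprn_gt0.
apply: le_trans (lerD h (lexx _)) _.
by rewrite [(2 ^+ 33)^-1](_ : _ = (2 ^+ 32)^-1 / 2) -?splitr // exprS invfM mulrC.
Qed.

(** The initial blocks of each level are exactly the sub-blocks of block 0 of the next one. *)
Definition all_good : set (@sequences R) :=
  [set s | forall k j, (j < branching (c + k))%N -> env s k j].

Lemma measurable_all_good : measurable all_good.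
Proof.
rewrite (_ : all_good = \bigcap_k \bigcap_j [set s | (j < branching (c + k))%N -> env s k j]).
  apply: bigcapT_measurable => k; apply: bigcapT_measurable => j.
  by apply: measurable_imply; exact: env_measurable.
by apply/seteqP; split=> s h k; [move=> _ j _; exact: h|move=> j; apply: h].
Qed.

(** The union bound over [2 ^ (8 n)] initial blocks leaves [2 ^ (- 24 n)] at scale [n = c + k],
    which is at most [2 ^ (- k - 2)]; these sum to 1/2. *)
Lemma all_good_pos : (0 < lambda all_good)%E.
Proof.
suff h : (lambda (~` all_good) <= (2^-1)%:E)%E.
  rewrite -[all_good]setCK probability_setC; last by apply: measurableC; exact: measurable_all_good.
  rewrite sube_gt0; apply: le_lt_trans h _.
  by rewrite lte_fin invf_lt1 // ltr1n.
pose U k : set (@sequences R) := \bigcup_(j in `I_(branching (c + k))) bad k j.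
have mU k : measurable (U k) by apply: bigcup_measurable => j _; exact: bad_measurable.
have pU k : (lambda (U k) <= 0 + (2^-1 / (2 ^ k.+1)%:R)%:E)%E.
  rewrite add0e; apply: (@le_trans _ _ ((branching (c + k))%:R * (2 ^+ (32 * (c + k)))^-1)%:E).
    apply: (@union_bound _ _ _ lambda _ (bad k)) => //; first exact: bad_measurable.
    by move=> j _; rewrite lambda_bad; exact: lambda_bad_le.
  rewrite lee_fin /branching !natrX.
  have -> : 2^-1 / 2 ^+ k.+1 = (2 ^+ k.+2)^-1 :> R by rewrite [in RHS]exprS invfM.
  rewrite ler_pdivrMr ?exprn_gt0 // mulrC ler_pdivlMr ?exprn_gt0 //.
  by rewrite -exprD ler_eXn2l ?ltr1n //; lia.
apply: (@le_trans _ _ (\sum_(0 <= k <oo) (0 + (2^-1 / (2 ^ k.+1)%:R)%:E))%E).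
  apply: (@le_trans _ _ (\sum_(0 <= k <oo) lambda (U k))%E).
    apply: measure_sigma_subadditive => //.
      by apply: measurableC; exact: measurable_all_good.
    by move=> s /existsNP[k /existsNP[j /not_implyP[jk nE]]]; exists k => //; exists j.
  by apply: lee_nneseries => // k _; exact: pU.
apply: le_trans (epsilon_trick xpredT _ _) _ => //.
by rewrite eseries0 // add0e.
Qed.

End Environment.

(** * The moment bound *)

Section BoundedExpectation.
Context {R : realType} d {T : measurableType d} (P : probability T R).
Implicit Types f g : T -> R.

(** Truncated spacings and their products are bounded, which makes integrability automatic. *)
Definition bounded_measurable f := measurable_fun setT f /\ exists B, forall x, `|f x| <= B.

Lemma bounded_measurable_integrable f :
  bounded_measurable f -> P.-integrable setT (EFin \o f).
Proof.
move=> [mf [B fB]]; apply: measurable_bounded_integrable => //.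
  by rewrite -ge0_fin_numE // fin_num_measure.
exists B; split; first exact: num_real.
by move=> x Bx y _ /=; apply: le_trans (fB y) (ltW Bx).
Qed.

Lemma bounded_measurable_cst (a : R) : bounded_measurable (fun=> a).
Proof. by split; [exact: measurable_cst|exists `|a|]. Qed.

Lemma bounded_measurableD f g : bounded_measurable f -> bounded_measurable g ->
  bounded_measurable (fun x => f x + g x).
Proof.
move=> [mf [B fB]] [mg [B' gB]]; split; first exact: measurable_funD.
by exists (B + B') => x; apply: le_trans (ler_normD _ _) (lerD _ _).
Qed.

Lemma bounded_measurableM f g : bounded_measurable f -> bounded_measurable g ->
  bounded_measurable (fun x => f x * g x).
Proof.
move=> [mf [B fB]] [mg [B' gB]]; split; first exact: measurable_funM.
by exists (B * B') => x; rewrite normrM; apply: ler_pM.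
Qed.

Lemma bounded_measurable_sum (s : seq nat) (h : nat -> T -> R) :
  (forall i, bounded_measurable (h i)) -> bounded_measurable (fun x => \sum_(i <- s) h i x).
Proof.
move=> bh; elim: s => [|i s IH].
  by under eq_fun do rewrite big_nil; exact: bounded_measurable_cst.
by under eq_fun do rewrite big_cons; exact: bounded_measurableD.
Qed.

Lemma expect_sum (s : seq nat) (h : nat -> T -> R) : (forall i, bounded_measurable (h i)) ->
  \int[P]_x (\sum_(i <- s) h i x) = \sum_(i <- s) \int[P]_x h i x.
Proof.
move=> bh; elim: s => [|i s IH].
  by rewrite big_nil; under eq_Rintegral do rewrite big_nil; rewrite Rintegral_cst // mul0r.
rewrite big_cons -IH; under eq_Rintegral do rewrite big_cons.
rewrite RintegralD //; apply: bounded_measurable_integrable => //.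
exact: bounded_measurable_sum.
Qed.

Lemma expect_cst (a : R) : \int[P]_x a = a.
Proof.
transitivity (a * fine (P setT)); first exact: Rintegral_cst.
by rewrite probability_setT mulr1.
Qed.

Lemma expectD f g : bounded_measurable f -> bounded_measurable g ->
  \int[P]_x (f x + g x) = \int[P]_x f x + \int[P]_x g x.
Proof. by move=> bf bg; rewrite RintegralD //; apply: bounded_measurable_integrable. Qed.

Lemma expectZ (a : R) f : bounded_measurable f -> \int[P]_x (a * f x) = a * \int[P]_x f x.
Proof. by move=> bf; rewrite RintegralZl //; apply: bounded_measurable_integrable. Qed.

Lemma expect_le f g : bounded_measurable f -> bounded_measurable g -> (forall x, f x <= g x) ->
  \int[P]_x f x <= \int[P]_x g x.
Proof.
by move=> bf bg fg; apply: le_Rintegral => //; apply: bounded_measurable_integrable.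
Qed.

Lemma bounded_measurable_indic (A : set T) : measurable A -> bounded_measurable (\1_A : T -> R).
Proof.
move=> mA; split; first exact: measurable_indic.
by exists 1 => x; rewrite indicE; case: (x \in A); rewrite ?normr0 ?normr1.
Qed.

Lemma expect_indic (A : set T) : measurable A -> \int[P]_x (\1_A x) = fine (P A).
Proof. by move=> mA; rewrite /Rintegral integral_indic // setIT. Qed.

End BoundedExpectation.

(** * The tail of the total spacing of a block *)

Section CostTail.
Context {R : realType}.
Variables (mu : probability R R) (lambda : probability (@sequences R) R).
Hypothesis lambda_cylinder : forall n (B : nat -> set R), (forall i, measurable (B i)) ->
  lambda (cylinder n B) = (\prod_(i < n) mu (B i))%E.

Lemma coordinate_law i (B : set R) : measurable B ->
  lambda ((fun s : sequences => s i) @^-1` B) = mu B.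
Proof.
move=> mB; rewrite (_ : _ @^-1` _ = cylinder i.+1 (fun j => if j == i then B else setT)).
  rewrite lambda_cylinder; last by move=> j; case: ifP.
  rewrite (bigD1 (@ord_max i)) //= eqxx big1 ?mule1 // => j jn.
  by rewrite ifN ?probability_setT.
apply/seteqP; split=> s /=; first by move=> Bs j _; case: eqP => // ->.
by move=> /(_ i (ltnSn i)); rewrite eqxx.
Qed.

Lemma pair_law i j (A B : set R) : i != j -> measurable A -> measurable B ->
  lambda ((fun s : sequences => (s i, s j)) @^-1` (A `*` B)) = (mu A * mu B)%E.
Proof.
move=> ij mA mB; pose n := (maxn i j).+1.
have i_n : (i < n)%N by rewrite ltnS leq_maxl.
have j_n : (j < n)%N by rewrite ltnS leq_maxr.
rewrite (_ : _ @^-1` _ = cylinder n (fun k => if k == i then A else if k == j then B else setT)).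
  rewrite lambda_cylinder; last by move=> k; case: ifP => // _; case: ifP.
  rewrite (bigD1 (Ordinal i_n)) //= eqxx (bigD1 (Ordinal j_n)) /=; last first.
    by rewrite -val_eqE /= eq_sym.
  rewrite eq_sym (negbTE ij) eqxx big1 ?mule1 // => k /andP[ki kj].
  by rewrite -!val_eqE /= in ki kj; rewrite (negbTE ki) (negbTE kj) probability_setT.
apply/seteqP; split=> s /=.
  by move=> [As Bs] k _; case: eqP => [->//|_]; case: eqP => // ->.
move=> h; have := h i i_n; have := h j j_n.
by rewrite !eqxx eq_sym (negbTE ij).
Qed.

Lemma expect_coordinate i (f : R -> R) : measurable_fun setT f -> (forall x, 0 <= f x) ->
  \int[lambda]_s f (s i) = \int[mu]_x f x.
Proof.
move=> mf f0; rewrite /Rintegral; congr fine.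
have mi := @measurable_coordinate R i.
transitivity (\int[pushforward lambda (fun s : sequences => s i)]_x (f x)%:E)%E.
  apply/esym; apply: (ge0_integral_pushforward mi lambda measurableT).
    exact/measurable_EFinP.
  by move=> x _; rewrite lee_fin.
apply: (@eq_measure_integral _ _ _ _ mu (image_measure lambda mi)) => A mA _.
exact: coordinate_law.
Qed.

(** The joint law of two coordinates agrees with the product law on rectangles, hence everywhere,
    and Fubini's theorem factors the integral. *)
Lemma expect_pair i j (f : R -> R) : i != j -> bounded_measurable f -> (forall x, 0 <= f x) ->
  \int[lambda]_s (f (s i) * f (s j)) = (\int[mu]_x f x) ^+ 2.
Proof.
move=> ij bf f0; have [mf _] := bf.
have If : (\int[mu]_x (f x)%:E = (\int[mu]_x f x)%:E)%E.
  rewrite /Rintegral fineK //; apply: integrable_fin_num => //.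
  exact: bounded_measurable_integrable.
pose pr (s : @sequences R) : R * R := (s i, s j).
have mpr : measurable_fun setT pr by apply/measurable_fun_pairP; split; exact: measurable_coordinate.
pose g (x : R * R) : \bar R := (f x.1 * f x.2)%:E.
have mg : measurable_fun setT g.
  by apply/measurable_EFinP; apply: measurable_funM; apply: measurableT_comp.
have g0 x : (0 <= g x)%E by rewrite lee_fin mulr_ge0.
rewrite /Rintegral (_ : (\int[lambda]_s (f (s i) * f (s j))%:E)%E =
  ((\int[mu]_x f x)%:E * (\int[mu]_x f x)%:E)%E) ?expr2 //.
transitivity (\int[pushforward lambda pr]_x g x)%E.
  by apply/esym; apply: (ge0_integral_pushforward mpr lambda measurableT).
transitivity (\int[(mu \x mu)%E]_x g x)%E.
  apply: (@eq_measure_integral _ _ _ _ (mu \x mu)%E (image_measure lambda mpr)) => A mA _.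
  apply/esym; apply: (@product_measure_unique _ _ _ _ _ mu mu (image_measure lambda mpr)) => //.
  by move=> A' B' mA' mB'; exact: pair_law.
rewrite fubini_tonelli1 //.
transitivity (\int[mu]_x ((\int[mu]_y f y)%:E * (f x)%:E))%E.
  apply: eq_integral => x _; rewrite /fubini_F /g /=.
  under eq_integral do rewrite EFinM.
  by rewrite ge0_integralZl_EFin ?If 1?muleC //; [move=> y _; rewrite lee_fin|exact/measurable_EFinP].
rewrite ge0_integralZl_EFin ?If //.
- by move=> y _; rewrite lee_fin.
- exact/measurable_EFinP.
- by rewrite /Rintegral fine_ge0 // integral_ge0 // => y _; rewrite lee_fin.
Qed.

Variables (eta A : R).
Hypotheses (eta1 : 1 < eta) (eta2 : eta <= 2) (A0 : 0 <= A).
Hypothesis moment : (\int[mu]_x (`|x| `^ eta)%:E <= A%:E)%E.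

(** One inequality for three uses: the mean of a truncated spacing, its second moment, and the
    chance that one spacing exceeds the truncation level. *)
Lemma markov_moment (f : R -> R) (a b : R) : bounded_measurable f -> 0 <= a -> 0 <= b ->
  (forall x, 0 <= f x) -> (forall x, f x <= b + a * `|x| `^ eta) -> \int[mu]_x f x <= b + a * A.
Proof.
move=> bf a0 b0 f0 fle; have [mf _] := bf.
have If : (\int[mu]_x (f x)%:E = (\int[mu]_x f x)%:E)%E.
  rewrite /Rintegral fineK //; apply: integrable_fin_num => //.
  exact: bounded_measurable_integrable.
have mpow : measurable_fun setT (fun x : R => `|x| `^ eta).
  by apply: (measurableT_comp (measurable_powR eta)); exact: normr_measurable.
rewrite -lee_fin -If.
apply: (@le_trans _ _ (\int[mu]_x (b%:E + a%:E * (`|x| `^ eta)%:E))%E).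
  apply: ge0_le_integral => //.
  - by move=> x _; rewrite lee_fin.
  - exact/measurable_EFinP.
  - have -> : (fun x : R => b%:E + a%:E * (`|x| `^ eta)%:E)%E =
      EFin \o (fun x : R => b + a * `|x| `^ eta) by [].
    by apply/measurable_EFinP; apply: measurable_funD => //; apply: measurable_funM.
  - by move=> x _; rewrite -EFinM -EFinD lee_fin.
have mpowE : measurable_fun setT (fun x : R => (`|x| `^ eta)%:E) by exact/measurable_EFinP.
have -> : (\int[mu]_x (b%:E + a%:E * (`|x| `^ eta)%:E) =
    b%:E + a%:E * \int[mu]_x (`|x| `^ eta)%:E)%E.
  transitivity (\int[mu]_x b%:E + \int[mu]_x (a%:E * (`|x| `^ eta)%:E))%E.
    apply: ge0_integralD => //.
    - by move=> x _; rewrite mule_ge0 ?lee_fin ?powR_ge0.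
    - exact: measurable_funeM.
  congr (_ + _)%E.
    by transitivity (b%:E * mu setT)%E; [exact: integral_cst|rewrite probability_setT mule1].
  by apply: ge0_integralZl_EFin => // x _; rewrite lee_fin powR_ge0.
rewrite EFinD; apply: leeD => //; rewrite EFinM; apply: lee_pmul => //.
by apply: integral_ge0 => x _; rewrite lee_fin powR_ge0.
Qed.

(* Truncation at level [M], then Chebyshev; the pointwise inequality behind Chebyshev is
   [(M/2)^2 1_(S > M) + 2 m S <= S^2 + m^2] with [m] the mean of [S]. *)
Lemma cost_tail (L : nat) (M : R) : 0 < M -> 2 * L%:R * (1 + A) <= M ->
  (lambda [set s | (M < \sum_(0 <= i < L) `|s i|)%R] <= (5 * A * L%:R / (M `^ eta))%:E)%E.
Proof.
move=> M0 LM; pose y (x : R) : R := Num.min `|x| M.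
have y0 x : 0 <= y x by rewrite le_min normr_ge0 ltW.
have yM x : y x <= M by rewrite ge_min lexx orbT.
have eta0 : 0 < eta by have := eta1; lra.
have my : measurable_fun setT y.
  by apply: measurable_minr => //; exact: normr_measurable.
have bounded_y : bounded_measurable y by split=> //; exists M => x; rewrite ger0_norm.
have Mpow : 0 < M `^ eta by exact: powR_gt0.
have big_x (x : R) : M < `|x| -> M `^ eta <= `|x| `^ eta.
  by move=> Mx; apply: ge0_ler_powR; rewrite ?nnegrE ?normr_ge0 ?ltW.
have y_mean : \int[mu]_x y x <= 1 + 1 * A.
  apply: markov_moment => // x; rewrite mul1r; apply: (@le_trans _ _ `|x|).
    by rewrite ge_min lexx.
  have [x1|x1] := leP `|x| 1; first by apply: le_trans x1 _; rewrite lerDl powR_ge0.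
  apply: (@le_trans _ _ (`|x| `^ eta)); last by rewrite lerDr.
  by rewrite -{1}(powRr1 (normr_ge0 x)); apply: ler_powR; rewrite ltW.
set m := \int[mu]_x y x in y_mean *.
have m0 : 0 <= m by rewrite /m /Rintegral fine_ge0 // integral_ge0 // => x _; rewrite lee_fin.
have by2 : bounded_measurable (fun x => y x * y x) by exact: bounded_measurableM.
(* Pointwise, [y ^ 2] is at most [M ^ (2 - eta)] times the power [eta] of the spacing; this is where
   [eta <= 2] enters. *)
have y_var : \int[mu]_x (y x * y x) <= 0 + M ^+ 2 / M `^ eta * A.
  apply: markov_moment => //; first by rewrite divr_ge0 ?exprn_ge0 ?ltW.
    by move=> x; rewrite mulr_ge0.
  move=> x; rewrite add0r; have [xM|xM] := leP `|x| M; last first.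
    rewrite (_ : y x = M); last by rewrite /y min_r // ltW.
    rewrite -expr2 -mulrA; apply: ler_peMr; first by rewrite exprn_ge0 // ltW.
    by rewrite mulrC ler_pdivlMr // mul1r big_x.
  rewrite (_ : y x = `|x|); last by rewrite /y min_l.
  have [->|x0] := eqVneq x 0; first by rewrite normr0 mul0r mulr_ge0 ?divr_ge0 ?exprn_ge0 ?powR_ge0 ?ltW.
  have nx : 0 < `|x| by rewrite normr_gt0.
  rewrite mulrAC ler_pdivlMr // -expr2 -!powR_mulrn ?normr_ge0 ?(ltW M0) //.
  have e1 : `|x| `^ 2%:R = `|x| `^ eta * `|x| `^ (2%:R - eta).
    by rewrite -powRD ?(gt_eqF nx) ?implybT //; congr (_ `^ _); ring.
  have e2 : M `^ 2%:R = M `^ eta * M `^ (2%:R - eta).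
    by rewrite -powRD ?(gt_eqF M0) ?implybT //; congr (_ `^ _); ring.
  have h : `|x| `^ (2%:R - eta) <= M `^ (2%:R - eta).
    by apply: ge0_ler_powR; rewrite ?nnegrE ?subr_ge0 ?normr_ge0 //; exact: ltW.
  rewrite e1 e2 [leRHS](_ : _ = `|x| `^ eta * M `^ eta * M `^ (2%:R - eta)); last by ring.
  rewrite mulrAC; apply: ler_wpM2l => //.
  by rewrite mulr_ge0 ?powR_ge0.
pose Y i (s : @sequences R) := y (s i).
have bY i : bounded_measurable (Y i).
  split; first exact: (measurableT_comp my (@measurable_coordinate R i)).
  by exists M => s; rewrite /Y ger0_norm.
pose S (s : @sequences R) := \sum_(0 <= i < L) Y i s.
have bS : bounded_measurable S by exact: bounded_measurable_sum.
have S_mean : \int[lambda]_s S s = L%:R * m.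
  rewrite expect_sum // (eq_bigr (fun=> m)) => [|i _]; last exact: expect_coordinate.
  by rewrite big_const_seq count_predT size_iota subn0 iter_addr addr0 mulr_natl.
have S_square : \int[lambda]_s (S s * S s) <= L%:R * (M ^+ 2 / M `^ eta * A) + (L%:R * m) ^+ 2.
  have -> : (fun s => S s * S s) = (fun s => \sum_(0 <= i < L) \sum_(0 <= j < L) Y i s * Y j s).
    by apply/funext => s; rewrite /S mulr_suml; apply: eq_bigr => i _; rewrite mulr_sumr.
  rewrite expect_sum; last by move=> i; apply: bounded_measurable_sum => j; exact: bounded_measurableM.
  have -> : L%:R * (M ^+ 2 / M `^ eta * A) + (L%:R * m) ^+ 2 =
      \sum_(0 <= i < L) (M ^+ 2 / M `^ eta * A + \sum_(0 <= j < L) m ^+ 2).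
    rewrite !big_const_seq !count_predT !size_iota !subn0 !iter_addr !addr0.
    by rewrite -(mulr_natl (_ + _) L) -(mulr_natl (m ^+ 2) L); ring.
  rewrite big_nat [leRHS]big_nat; apply: ler_sum => i /andP[_ iL].
  rewrite expect_sum; last by move=> j; exact: bounded_measurableM.
  rewrite (bigD1_seq i) ?iota_uniq ?mem_index_iota //=.
  rewrite [X in _ <= _ + X](bigD1_seq i) ?iota_uniq ?mem_index_iota //=; apply: lerD.
    rewrite (@expect_coordinate i (fun x => y x * y x)); first by rewrite -(add0r (_ * A)).
      by apply: measurable_funM.
    by move=> x; exact: mulr_ge0.
  apply: (@le_trans _ _ (\sum_(0 <= j < L | j != i) m ^+ 2)); last by rewrite lerDr sqr_ge0.
  apply: ler_sum => j ji; rewrite (@expect_pair i j y) //.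
  by rewrite eq_sym.
have mS : measurable [set s | (M < S s)%R].
  have := measurable_preimage bS.1 (measurable_itv `]M, +oo[).
  by congr measurable; apply/seteqP; split=> s /=; rewrite in_itv /= andbT.
(* The mean of [S] is at most half of the threshold, so exceeding [M] is a deviation of at least
   [M / 2]. *)
have LM2 : L%:R * m <= M / 2.
  have : L%:R * m <= L%:R * (1 + A) by apply: ler_wpM2l => //; lra.
  by have := LM; lra.
have large_S : fine (lambda [set s | (M < S s)%R]) <= 4 * A * L%:R / (M `^ eta).
  have bI := @bounded_measurable_indic R _ _ _ mS.
  have pointwise s : (M / 2) ^+ 2 * \1_([set s | (M < S s)%R]) s + (2 * (L%:R * m)) * S s <=
      S s * S s + (L%:R * m) ^+ 2.
    rewrite indicE; have [|] := boolP (s \in _).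
      by rewrite inE /= => MS; rewrite mulr1; have := M0; nra.
    by move=> _; rewrite mulr0 add0r; have := sqr_ge0 (S s - L%:R * m); lra.
  have := @expect_le _ _ _ lambda _ _ _ _ pointwise.
  have b1 : bounded_measurable (fun s => (M / 2) ^+ 2 * \1_([set s | (M < S s)%R]) s).
    by apply: bounded_measurableM => //; exact: bounded_measurable_cst.
  have b2 : bounded_measurable (fun s => 2 * (L%:R * m) * S s).
    by apply: bounded_measurableM => //; exact: bounded_measurable_cst.
  have b3 : bounded_measurable (fun s => S s * S s) by exact: bounded_measurableM.
  move=> /(_ (bounded_measurableD b1 b2) (bounded_measurableD b3 (bounded_measurable_cst _))).
  rewrite expectD // expectD //; last exact: bounded_measurable_cst.
  rewrite expectZ // expectZ // expect_indic // expect_cst S_mean.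
  set p := fine _; set Lm := L%:R * m in S_square LM2 *; set SS := \int[lambda]_s _ in S_square *.
  move=> h; have {}h : (M / 2) ^+ 2 * p <= L%:R * (M ^+ 2 / M `^ eta * A) by lra.
  have M2 : 0 < M ^+ 2 by rewrite exprn_gt0.
  rewrite -(ler_pM2l M2); apply: (@le_trans _ _ (4 * ((M / 2) ^+ 2 * p))).
    by rewrite -subr_ge0; have -> : 4 * ((M / 2) ^+ 2 * p) - M ^+ 2 * p = 0 by field.
  have -> : M ^+ 2 * (4 * A * L%:R / M `^ eta) = 4 * (L%:R * (M ^+ 2 / M `^ eta * A)) by ring.
  by rewrite ler_pM2l.
have mbig i : measurable ([set s | (M < `|s i|)%R] : set (@sequences R)).
  have := measurable_preimage (measurableT_comp (@normr_measurable R setT) (@measurable_coordinate R i))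
    (measurable_itv `]M, +oo[).
  by congr measurable; apply/seteqP; split=> s /=; rewrite in_itv /= andbT.
have mbigR : measurable [set x : R | (M < `|x|)%R].
  have := measurable_preimage (@normr_measurable R setT) (measurable_itv `]M, +oo[).
  by congr measurable; apply/seteqP; split=> s /=; rewrite in_itv /= andbT.
have big_le i : (lambda [set s | (M < `|s i|)%R] <= (A / (M `^ eta))%:E)%E.
  rewrite -[X in lambda X]/((fun s : sequences => s i) @^-1` [set x : R | (M < `|x|)%R]).
  rewrite coordinate_law // -[X in (X <= _)%E]fineK ?fin_num_measure // lee_fin -expect_indic //.
  rewrite -[leRHS]add0r mulrC; apply: markov_moment => //.
  - exact: bounded_measurable_indic.
  - by rewrite invr_ge0 ltW.
  move=> x; rewrite add0r indicE; have [|] := boolP (x \in _).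
    by rewrite inE /= => Mx; rewrite mulrC ler_pdivlMr // mul1r big_x.
  by move=> _; rewrite mulr_ge0 ?invr_ge0 ?powR_ge0 // ltW.
(* Truncation changes nothing unless some spacing exceeds [M]; this event adds one [A L / M ^ eta]
   to the four from Chebyshev's inequality, whence the constant 5. *)
pose U := \bigcup_(i in `I_L) [set s : @sequences R | (M < `|s i|)%R].
have mU : measurable U by apply: bigcup_measurable => i _; exact: mbig.
have pU : (lambda U <= (L%:R * (A / M `^ eta))%:E)%E.
  by apply: (@union_bound _ _ _ lambda _ (fun i => [set s : @sequences R | (M < `|s i|)%R])).
apply: (@le_trans _ _ (lambda (U `|` [set s | (M < S s)%R]))).
  apply: le_measure; rewrite ?inE.
  - have ms : measurable_fun setT (fun s : @sequences R => \sum_(0 <= i < L) `|s i|).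
      apply: (@measurable_sum _ _ _ _ _ _ (fun i (s : @sequences R) => `|s i|)) => i.
      exact: (measurableT_comp (@normr_measurable R setT) (@measurable_coordinate R i)).
    have := measurable_preimage ms (measurable_itv `]M, +oo[).
    by congr measurable; apply/seteqP; split=> s /=; rewrite in_itv /= andbT.
  - exact: measurableU.
  - move=> s /= Ms; have [[i iL iM]|nbig] := pselect (exists2 i, (i < L)%N & M < `|s i|).
      by left; exists i.
    right; rewrite /S big_nat (eq_bigr (fun i => `|s i|)) -?big_nat // => i /andP[_ iL].
    by rewrite /Y /y min_l // leNgt; apply/negP => iM; apply: nbig; exists i.
apply: (@le_trans _ _ (lambda U + lambda [set s | (M < S s)%R])%E); first exact: measureU2.
apply: (@le_trans _ _ ((L%:R * (A / M `^ eta))%:E + (4 * A * L%:R / (M `^ eta))%:E)%E).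
  by apply: leeD => //; rewrite -[X in (X <= _)%E]fineK ?fin_num_measure ?lee_fin.
by rewrite -EFinD lee_fin le_eqVlt; apply/orP; left; apply/eqP; ring.
Qed.

End CostTail.

(** * The critical parameter *)

Section Percolation.
Context {R : realType}.

Lemma reach_le K K' (w : edge -> bool) : (K <= K')%N -> reach K' w -> reach K w.
Proof.
move=> KK' [v vK' c]; apply: (@connected_reach _ _ v).
  by apply: open_connected_mono c => e /andP[].
by case: vK' => h; [left|right]; exact: leq_trans h.
Qed.

(** Positivity of the infimum of [theta s p K] over [K], with a lower bound of the form
    [1 / (m + 1)] so that the event is visibly measurable in [s]. *)
Definition theta_positive (s : nat -> R) (p : R) : Prop :=
  exists m : nat, forall K, m.+1%:R^-1 <= theta s p K.

Section Realized.
Variables (s : nat -> R) (p : R).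
Context d {Omega : measurableType d} (P : probability Omega R) (W : edge -> Omega -> bool).
Hypotheses (p01 : 0 <= p <= 1) (bW : bond_field P s p W).

Let reachW K : set Omega := [set om | reach K (W ^~ om)].

Lemma realized_reach K : measurable (reachW K) /\ P (reachW K) = (theta s p K)%:E.
Proof.
have [mW iW pW] := bW.
exact: (realization mW iW pW (fun=> false) (uniq_box_edges K) (@reach_determined K)).
Qed.

Lemma percolates_bigcap :
  [set om | percolates (fun e => W e om)] = \bigcap_K reachW K.
Proof.
apply/seteqP; split=> om.
  by move=> /percolates_reach h K _; exact: h.
by move=> h; apply/percolates_reach => K; exact: h.
Qed.

Lemma percolation_prob_zero : ~ theta_positive s p ->
  P [set om | percolates (fun e => W e om)] = 0%E.
Proof.
move=> np; rewrite percolates_bigcap; apply/eqP; rewrite eq_le measure_ge0 andbT.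
apply/lee_addgt0Pr => e e0; rewrite add0e.
have [m me] : exists m : nat, m.+1%:R^-1 < e.
  exists (Num.bound e^-1); rewrite invf_plt ?posrE ?ltr0n //.
  have /archi_boundP h : 0 <= e^-1 by rewrite invr_ge0 ltW.
  by apply: lt_trans h _; rewrite ltr_nat.
have [K hK] : exists K, theta s p K < m.+1%:R^-1.
  by apply: contrapT => nK; apply: np; exists m => K; rewrite leNgt; apply/negP => h; apply: nK; exists K.
have [mK PK] := realized_reach K.
apply: (@le_trans _ _ (P (reachW K))).
  apply: le_measure; rewrite ?inE //.
    by apply: bigcapT_measurable => K'; case: (realized_reach K').
  by move=> om; apply.
by rewrite PK lee_fin ltW // (lt_trans hK).
Qed.

(** The events [reachW K] decrease to percolation, so a lower bound common to all [K] passes to the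
    limit. *)
Lemma percolation_prob_pos : theta_positive s p ->
  (0 < P [set om | percolates (fun e => W e om)])%E.
Proof.
move=> [m hm]; rewrite percolates_bigcap.
have mcap : measurable (\bigcap_K reachW K).
  by apply: bigcapT_measurable => K'; case: (realized_reach K').
have cv : P (reachW K) @[K --> \oo] --> P (\bigcap_K reachW K).
  apply: nonincreasing_cvg_mu => //.
  - by rewrite -ge0_fin_numE // fin_num_measure //; case: (realized_reach 0).
  - by move=> K; case: (realized_reach K).
  - by move=> K K' KK'; apply/subsetPset => om; exact: reach_le.
have m0 : (0 < (m.+1%:R^-1 : R)%:E)%E by rewrite lte_fin invr_gt0.
apply: (lt_le_trans m0); rewrite -(cvg_lim _ cv) //.
apply: lime_ge; first by apply/cvg_ex; exists (P (\bigcap_K reachW K)).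
by apply: nearW => K; rewrite (realized_reach K).2 lee_fin.
Qed.

End Realized.

(** A finite average is a polynomial in the weights. *)
Lemma measurable_avg d (T : measurableType d) (I : eqType) (pi : T -> I -> R) (F : seq I)
    (f : (I -> bool) -> R) (w : I -> bool) :
  (forall e, measurable_fun setT (fun t => pi t e)) ->
  measurable_fun setT (fun t => avg (pi t) F f w).
Proof.
move=> mpi; elim: F w => [|e F IH] w /=; first exact: measurable_cst.
apply: measurable_funD; apply: measurable_funM => //.
by apply: measurable_funB => //; exact: measurable_cst.
Qed.

Definition percolating (p : R) : set (@sequences R) := [set s | theta_positive s p].

Lemma measurable_theta p K : measurable_fun setT (fun s : @sequences R => theta s p K).
Proof.
apply: measurable_avg => -[h [i n]]; rewrite /bond_weight.
case: h.
  apply: (eq_measurable_fun (fun s : @sequences R => p `^ `|s i|)) => [s _|].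
    by rewrite edge_lengthE.
  apply: (measurableT_comp (measurable_powRr p)).
  exact: (measurableT_comp (@normr_measurable R setT) (measurable_coordinate i)).
apply: (eq_measurable_fun (fun s : @sequences R => p `^ 1)) => [s _|].
  by rewrite edge_lengthE.
exact: measurable_cst.
Qed.

Lemma percolating_measurable p : measurable (percolating p).
Proof.
rewrite (_ : percolating p =
  \bigcup_m \bigcap_K ((fun s : @sequences R => theta s p K) @^-1` `[m.+1%:R^-1, +oo[)).
  apply: bigcupT_measurable => m; apply: bigcapT_measurable => K.
  by apply: (measurable_preimage (measurable_theta p K)); exact: measurable_itv.
apply/seteqP; split=> s.
  by move=> [m h]; exists m => // K _ /=; rewrite in_itv /= andbT; exact: h.
by move=> [m _ h]; exists m => K; have := h K I; rewrite /= in_itv /= andbT.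
Qed.

Lemma percolating_mono p p' : 0 <= p -> p <= p' -> p' <= 1 -> percolating p `<=` percolating p'.
Proof.
move=> p0 pp' p'1 s [m h]; exists m => K; apply: le_trans (h K) _.
exact: theta_mono.
Qed.

Lemma theta_positive_ge (s : nat -> R) p (e : R) :
  0 < e -> (forall K, e <= theta s p K) -> theta_positive s p.
Proof.
move=> e0 h; exists (Num.bound e^-1) => K; apply: le_trans (h K).
rewrite invf_ple ?posrE ?ltr0n //.
have /archi_boundP b : 0 <= e^-1 by rewrite invr_ge0 ltW.
by apply: le_trans (ltW b) _; rewrite ler_nat.
Qed.

Lemma percolating_shift p : 0 < p -> p <= 1 -> shift_seq 1 @^-1` percolating p `<=` percolating p.
Proof.
move=> p0 p1 s [m h].
apply: (@theta_positive_ge s p (p `^ `|s 0%N| * m.+1%:R^-1)).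
  by rewrite mulr_gt0 ?powR_gt0 ?invr_gt0.
move=> K; apply: le_trans (theta_shift s K (_ : 0 <= p <= 1)); last by rewrite p1 ltW.
by apply: ler_wpM2l; [exact: powR_ge0|exact: h].
Qed.

End Percolation.

(** * The law of the environment *)

Section Law.
Context {R : realType} d {Omega : measurableType d} (P : probability Omega R).
Variables (xi : nat -> Omega -> R) (mu : probability R R).
Hypothesis iid : iid_with_law P xi mu.

Definition environment (om : Omega) : @sequences R := fun k => xi k om.

Lemma environment_cylinder n (B : nat -> set R) :
  environment @^-1` cylinder n B = \big[setI/setT]_(i <- iota 0 n) (xi i @^-1` B i).
Proof.
rewrite -bigcap_seq; apply/seteqP; split=> om h i /=.
  by rewrite mem_iota => i_n; exact: h.
by move=> i_n; apply: h; rewrite /= mem_iota.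
Qed.

Lemma measurable_environment : measurable_fun setT environment.
Proof.
have [mxi _ _] := iid.
apply: measurable_to_sequences => n B mB; rewrite environment_cylinder.
by apply: bigsetI_measurable => i _; exact: measurable_preimage.
Qed.

Lemma environment_law n (B : nat -> set R) : (forall i, measurable (B i)) ->
  image_measure P measurable_environment (cylinder n B) = (\prod_(i < n) mu (B i))%E.
Proof.
have [_ ind law] := iid => mB.
transitivity (P (environment @^-1` cylinder n B)); first by [].
rewrite environment_cylinder (ind (iota 0 n) B (iota_uniq 0 n) mB).
rewrite -(big_mkord xpredT (fun i => mu (B i))) /index_iota subn0.
by apply: eq_bigr => i _; exact: law.
Qed.

End Law.

Section SmallSets.
Context {R : realType} d {T : measurableType d} (P : probability T R).

Lemma eventually_small (F : nat -> set T) (e : R) : 0 < e ->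
  (forall n, measurable (F n)) -> (forall n m, (n <= m)%N -> F m `<=` F n) ->
  P (\bigcap_n F n) = 0%E -> exists n, (P (F n) <= e%:E)%E.
Proof.
move=> e0 mF nF F0.
have cv : P (F n) @[n --> \oo] --> P (\bigcap_n F n).
  apply: nonincreasing_cvg_mu => //.
  - by rewrite -ge0_fin_numE // fin_num_measure.
  - exact: bigcapT_measurable.
  - by move=> n m nm; apply/subsetPset; exact: nF.
apply: contrapT => nF'.
have : (e%:E <= P (\bigcap_n F n))%E.
  rewrite -(cvg_lim _ cv) //; apply: lime_ge; first by apply/cvg_ex; exists (P (\bigcap_n F n)).
  by apply: nearW => n; rewrite leNgt; apply/negP => h; apply: nF'; exists n; exact: ltW.
by rewrite F0 lee_fin leNgt e0.
Qed.

End SmallSets.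

(** * A non-percolating and a percolating parameter *)

Section Phases.
Context {R : realType}.
Variables (mu : probability R R) (lambda : probability (@sequences R) R).
Hypothesis lambda_cylinder : forall n (B : nat -> set R), (forall i, measurable (B i)) ->
  lambda (cylinder n B) = (\prod_(i < n) mu (B i))%E.

Lemma percolating_zero_one p : 0 < p -> p <= 1 ->
  lambda (percolating p) = 0%E \/ lambda (percolating p) = 1%E.
Proof.
move=> p0 p1; apply: (zero_one lambda_cylinder); first exact: percolating_measurable.
exact: percolating_shift.
Qed.

(** With [p = exp (- x)] and [exp (- y) <= 1 / y], the three terms of [x] answer the three demands:
    1 gives [p <= 1 / 2], [2 W / e] gives [W p <= e / 2], and [2 / (e t)] gives [p ^ t <= e / 2]. *)
Lemma small_p (e t W : R) : 0 < e -> 0 < t -> 0 <= W ->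
  exists p : R, [/\ 0 < p, p <= 2^-1 & W * p + p `^ t <= e].
Proof.
move=> e0 t0 W0; pose x := 1 + 2 * W / e + 2 / (e * t).
have x1 : 1 <= x.
  by rewrite /x -addrA lerDl addr_ge0 // ?divr_ge0 ?mulr_ge0 // ltW // mulr_gt0.
have inv y : 0 < y -> expR (- y) <= y^-1 :> R.
  move=> y0; rewrite expRN lef_pV2 ?posrE ?expR_gt0 //.
  by have := @expR_ge1Dx R y; lra.
have half_e : 0 < e / 2 by lra.
exists (expR (- x)); split; first exact: expR_gt0.
  apply: (@le_trans _ _ (expR (- 1))); first by rewrite ler_expR lerN2.
  rewrite expRN lef_pV2 ?posrE ?expR_gt0 //.
  by have := @expR_ge1Dx R 1; lra.
have h1 : W * expR (- x) <= e / 2.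
  apply: (@le_trans _ _ (W * x^-1)); first by apply: ler_wpM2l => //; apply: inv; lra.
  rewrite ler_pdivrMr; last lra.
  have -> : W = e / 2 * (2 * W / e) by field; rewrite gt_eqF.
  apply: ler_wpM2l; first exact: ltW.
  rewrite /x -addrA [X in _ <= 1 + X]addrC addrA lerDr addr_ge0 //.
  by rewrite divr_ge0 // ltW // mulr_gt0.
have h2 : expR (- x) `^ t <= e / 2.
  have -> : expR (- x) `^ t = expR (- (x * t)).
    by rewrite /powR gt_eqF ?expR_gt0 // expRK; congr expR; ring.
  apply: le_trans (inv _ _) _; first by rewrite mulr_gt0 //; lra.
  have -> : e / 2 = (2 / (e * t) * t)^-1 by field; rewrite !gt_eqF.
  rewrite lef_pV2 ?posrE; last 2 first.
  - by rewrite mulr_gt0 //; lra.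
  - by rewrite !mulr_gt0 // invr_gt0 mulr_gt0.
  apply: ler_wpM2r; first exact: ltW.
  by rewrite /x lerDr addr_ge0 // divr_ge0 ?mulr_ge0 // ltW.
lra.
Qed.

Lemma subcritical : mu [set x : R | 0 < x] = 1%E ->
  exists p : R, [/\ 0 < p, p <= 1 & lambda (percolating p) = 0%E].
Proof.
move=> mu_pos; have [c c9] : exists c, (9 <= c)%N by exists 9%N.
pose W := width c.
pose F n : set R := [set x | `|x| < n.+1%:R^-1].
have mF n : measurable (F n).
  have := measurable_preimage (@normr_measurable R setT) (measurable_itv `]-oo, n.+1%:R^-1[).
  by congr measurable; apply/seteqP; split=> s /=; rewrite in_itv.
have m0 : mu [set 0] = 0%E.
  apply/eqP; rewrite eq_le measure_ge0 andbT.
  have mpos : measurable [set x : R | 0 < x].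
    have := @measurable_itv R `]0, +oo[.
    by congr measurable; apply/seteqP; split=> s /=; rewrite in_itv /= andbT.
  apply: (@le_trans _ _ (mu (~` [set x : R | 0 < x]))).
    by apply: le_measure; rewrite ?inE //; [exact: measurableC|move=> x /= ->; rewrite ltxx].
  by rewrite probability_setC // mu_pos subee.
(* As [mu] gives no mass to 0, a spacing is below [1 / (n + 1)] with probability as small as base
   blocks require, for some [n]. *)
have [n Fn] : exists n, (mu (F n) <= ((2 ^+ (32 * c))^-1)%:E)%E.
  have e0 : 0 < (2 ^+ (32 * c))^-1 :> R by rewrite invr_gt0 exprn_gt0.
  apply: (eventually_small e0 mF).
    move=> n m nm x; rewrite /F /= => /lt_le_trans; apply.
    by rewrite lef_pV2 ?posrE ?ltr0n // ler_nat.
  rewrite (_ : \bigcap_n F n = [set 0]) //; apply/seteqP; split=> x; last first.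
    by move=> -> n _; rewrite /F /= normr0 invr_gt0.
  move=> h; apply: contrapT => /eqP x0; have nx : 0 < `|x| by rewrite normr_gt0.
  have := h (Num.bound `|x|^-1) I; rewrite /F /= => /ltW; apply/negP; rewrite -ltNge.
  have /archi_boundP b : 0 <= `|x|^-1 by rewrite invr_ge0.
  rewrite invf_plt ?posrE ?ltr0n //; apply: lt_trans b _; by rewrite ltr_nat.
pose t : R := n.+1%:R^-1.
have t0 : 0 < t by rewrite invr_gt0.
have [p [p0 p_half p_base]] := @small_p (expR (- (decay c)%:R)) t W%:R (expR_gt0 _) t0 (ler0n _ _).
have p1 : p <= 1 by lra.
exists p; split=> //.
pose E0 (s : @sequences R) j : Prop := t <= `|s (j * width c)%N|.
have mE0 j : measurable [set s | E0 s j].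
  have := measurable_preimage (measurableT_comp (@normr_measurable R setT)
    (@measurable_coordinate R (j * width c))) (measurable_itv `[t, +oo[).
  by congr measurable; apply/seteqP; split=> s /=; rewrite in_itv /= andbT.
pose kap : R -> R := fun=> 1.
have good := @all_good_pos R mu lambda lambda_cylinder c kap E0.
have {}good : (0 < lambda (all_good c kap E0))%E.
  apply: good => //.
  - exact: measurable_cst.
  - by move=> s a j; rewrite /E0 /shift_seq mulnDl.
  - move=> s s' j ss'; rewrite /E0 ss' // mulSn.
    by have := width_gt0 c; lia.
  - rewrite (_ : [set s | ~ E0 s 0%N] = (fun s : @sequences R => s 0%N) @^-1` F n).
      by rewrite (coordinate_law lambda_cylinder).
    by apply/seteqP; split=> s; rewrite /E0 /F /= mul0n; [move/negP; rewrite -ltNge|rewrite ltNge => /negP].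
  (* All costs are 1, so a block costs exactly its width, which never exceeds [max_cost]. *)
  - move=> k _; rewrite (_ : [set _ | _] = set0) ?measure0 ?lee_fin ?invr_ge0 ?exprn_ge0 //.
    apply/seteqP; split=> // s; rewrite /kap /= sumr_const_nat subn0 ltr_nat /max_cost.
    by rewrite ltnNge leq_pmull // expn_gt0.
have [//|full] := percolating_zero_one p0 p1.
suff : (lambda (all_good c kap E0) <= lambda (~` percolating p))%E.
  rewrite probability_setC; last exact: percolating_measurable.
  by rewrite full subee // leNgt good.
apply: le_measure; rewrite ?inE.
- by apply: measurable_all_good => //; exact: measurable_cst.
- by apply: measurableC; exact: percolating_measurable.
move=> s sgood [m hm].
have [k hk] : exists k, 3 * expR (- (decay (c + k))%:R) < m.+1%:R^-1 :> R.
  (* [decay (c + k)] is at least [k], so with this [k] it is enough that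
     [3 (m + 1) < 2 ^ (3 (m + 1))]. *)
  exists (3 * m.+1)%N; rewrite expRN ltr_pdivrMr ?expR_gt0 // mulrC ltr_pdivlMr //.
  rewrite -natrM; apply: lt_le_trans (expR_nat_ge2X _); rewrite ltr_nat.
  apply: leq_trans (ltn_expl _ (ltnSn 1)) _; rewrite leq_exp2l //.
  apply: leq_trans (decay_large _); last by lia.
  apply: leq_trans (ltnW (ltn_expl _ (ltnSn 1))); lia.
have [K hK] := @theta_upper_bound R c s p t c9 (ltW p0) p_half p_base t0 sgood k.
by have := hm K; rewrite leNgt (le_lt_trans hK hk).
Qed.

(** The second moment bound for truncated spacings wants [eta <= 2]; the exponent may be lowered,
    since on either side of 1 the smaller power is at most 1 plus the larger one. *)
Lemma finite_moment : (exists2 eta : R, 1 < eta & (\int[mu]_x ((`|x| `^ eta)%:E) < +oo)%E) ->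
  exists eta A : R, [/\ 1 < eta, eta <= 2, 0 <= A & (\int[mu]_x (`|x| `^ eta)%:E <= A%:E)%E].
Proof.
move=> [eta eta1 fin]; pose eta' := Num.min eta 2.
have eta'1 : 1 < eta' by rewrite lt_min eta1 ltr1n.
have eta'2 : eta' <= 2 by rewrite ge_min lexx orbT.
have mpow (b : R) : measurable_fun setT (fun x : R => (`|x| `^ b)%:E).
  apply/measurable_EFinP; apply: (measurableT_comp (measurable_powR b)).
  exact: normr_measurable.
have int0 (b : R) : (0 <= \int[mu]_x (`|x| `^ b)%:E)%E.
  by apply: integral_ge0 => x _; rewrite lee_fin powR_ge0.
have le : (\int[mu]_x (`|x| `^ eta')%:E <= 1 + \int[mu]_x (`|x| `^ eta)%:E)%E.
  apply: (@le_trans _ _ (\int[mu]_x (1%:E + (`|x| `^ eta)%:E))%E).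
    apply: (ge0_le_integral mu measurableT _ (mpow eta') _ _).
    - by move=> x _; rewrite lee_fin powR_ge0.
    - by apply: (emeasurable_funD _ (mpow eta)); exact: measurable_cst.
    - move=> x _; rewrite -EFinD lee_fin.
      have [x1|x1] := leP `|x| 1.
        apply: (@le_trans _ _ 1); last by rewrite lerDl powR_ge0.
        have -> : 1 = 1 `^ eta' :> R by rewrite powR1.
        apply: ge0_ler_powR; rewrite ?nnegrE //.
        exact: (le_trans ler01 (ltW eta'1)).
      apply: (@le_trans _ _ (`|x| `^ eta)); last by rewrite lerDr.
      by apply: ler_powR; [exact: ltW|rewrite ge_min lexx].
  have -> : (\int[mu]_x (1%:E + (`|x| `^ eta)%:E) =
      \int[mu]_x 1%:E + \int[mu]_x (`|x| `^ eta)%:E)%E.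
    by apply: ge0_integralD => // x _; rewrite lee_fin powR_ge0.
  apply: leeD => //.
  have -> : (\int[mu]_x 1%:E = 1%:E * mu setT)%E by exact: integral_cst.
  by rewrite mul1e probability_setT.
exists eta', (fine (\int[mu]_x (`|x| `^ eta')%:E)%E); split=> //.
  exact: fine_ge0.
rewrite fineK // ge0_fin_numE //; apply: le_lt_trans le _.
by rewrite lte_add_pinfty // ltry.
Qed.

(** [max_cost ^ eta] is at least [width * width ^ (eta - 1)], and [width ^ (eta - 1) >= 2 ^ (48 n)]
    once [(n - 1) (eta - 1) >= 12], which the first term of [x] ensures. The other terms let [2 ^ n]
    dominate the constants in [A], and [41 n + 33 <= 48 n]. *)
Lemma large_scale (eta A : R) : 1 < eta -> 0 <= A -> exists c, (9 <= c)%N /\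
  forall n, (c <= n)%N -> 2 * (1 + A) <= 2 ^+ n /\
    5 * A * (width n)%:R / ((max_cost n)%:R `^ eta) <= (2 ^+ (40 * n + 33))^-1.
Proof.
move=> eta1 A0.
have eta0 : 0 < eta - 1 by lra.
pose x := 12 / (eta - 1) + (2 * (1 + A) + 5 * A).
have x0 : 0 <= x by rewrite /x addr_ge0 ?divr_ge0 ?(ltW eta0) //; lra.
have xb := archi_boundP x0.
exists (9 + Num.bound x)%N; split; first by rewrite leq_addr.
move=> n cn; have n9 : (9 <= n)%N by apply: leq_trans cn; rewrite leq_addr.
have xn : x <= n.-1%:R.
  by apply: (le_trans (ltW xb)); rewrite ler_nat; lia.
have n2 : n.-1%:R <= 2 ^+ n :> R.
  by rewrite -natrX ler_nat; apply: leq_trans (leq_pred n) (ltnW (ltn_expl _ (ltnSn 1))).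
have q0 : 0 <= 12 / (eta - 1) by rewrite divr_ge0 // ltW.
have A2n : 2 * (1 + A) + 5 * A <= 2 ^+ n by move: xn; rewrite /x; lra.
split; first by lra.
have L0 : 0 < (width n)%:R :> R by rewrite ltr0n width_gt0.
have LM : (width n)%:R <= (max_cost n)%:R :> R.
  by rewrite ler_nat /max_cost leq_pmull // expn_gt0.
have M0 : 0 < (max_cost n)%:R :> R by apply: lt_le_trans LM.
have Meta : (width n)%:R * 2 ^+ (48 * n) <= (max_cost n)%:R `^ eta.
  have -> : eta = 1 + (eta - 1) by ring.
  rewrite powRD; last by rewrite (gt_eqF M0) implybT.
  rewrite powRr1 ?(ltW M0) //; apply: ler_pM => //.
  apply: (@le_trans _ _ ((width n)%:R `^ (eta - 1))); last first.
    by apply: ge0_ler_powR; rewrite ?nnegrE // ltW.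
  rewrite /width natrX -powR_mulrn // -powRrM -powR_mulrn //.
  apply: ler_powR; first by rewrite ler1n.
  rewrite !natrM.
  have h : 12 <= n.-1%:R * (eta - 1).
    by rewrite -ler_pdivrMr //; move: xn; rewrite /x; lra.
  have n0 : 0 <= n%:R :> R by [].
  have -> : 4 * (n%:R * n.-1%:R) * (eta - 1) = 4 * (n%:R * (n.-1%:R * (eta - 1))) by ring.
  have -> : 48%:R * n%:R = 4 * (n%:R * 12) :> R by ring.
  by rewrite ler_pM2l // ler_wpM2l.
rewrite ler_pdivrMr ?powR_gt0 // [leRHS]mulrC ler_pdivlMr ?exprn_gt0 //.
apply: le_trans Meta.
have -> : 5 * A * (width n)%:R * 2 ^+ (40 * n + 33) = (width n)%:R * (5 * A * 2 ^+ (40 * n + 33)) by ring.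
rewrite ler_pM2l //; apply: (@le_trans _ _ (2 ^+ n * 2 ^+ (40 * n + 33))).
  by apply: ler_wpM2r; [rewrite exprn_ge0|lra].
by rewrite -exprD ler_eXn2l ?ltr1n //; lia.
Qed.

Lemma supercritical :
  (exists2 eta : R, 1 < eta & (\int[mu]_x ((`|x| `^ eta)%:E) < +oo)%E) ->
  exists p : R, [/\ 0 < p, p < 1 & lambda (percolating p) = 1%E].
Proof.
move=> /finite_moment [eta [A [eta1 eta2 A0 moment]]].
have [c [c9 hc]] := large_scale eta1 A0.
pose W := width c.
pose S j (s : @sequences R) := \sum_(j * W <= i < j.+1 * W) `|s i|.
have mS j : measurable_fun setT (S j).
  apply: (@measurable_sum _ _ _ _ _ _ (fun i (s : @sequences R) => `|s i|)) => i.
  exact: (measurableT_comp (@normr_measurable R setT) (measurable_coordinate i)).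
pose F n : set (@sequences R) := [set s | n%:R < S 0%N s].
have mF n : measurable (F n).
  have := measurable_preimage (mS 0%N) (measurable_itv `]n%:R, +oo[).
  by congr measurable; apply/seteqP; split=> s /=; rewrite in_itv /= andbT.
have [n Fn] : exists n, (lambda (F n) <= ((2 ^+ (32 * c))^-1)%:E)%E.
  have e0 : 0 < (2 ^+ (32 * c))^-1 :> R by rewrite invr_gt0 exprn_gt0.
  apply: (eventually_small e0 mF).
    by move=> n m nm s; rewrite /F /=; apply: le_lt_trans; rewrite ler_nat.
  rewrite (_ : \bigcap_n F n = set0) ?measure0 //; apply/seteqP; split=> // s h.
  have S0 : 0 <= S 0%N s by apply: sumr_ge0 => i _.
  by have := h (Num.bound (S 0%N s)) I; rewrite /F /= ltNge (ltW (archi_boundP S0)).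
pose T : R := n%:R; have T0 : 0 <= T by [].
(* With [p = exp (- delta)] the condition on base rows reads [delta (1 + T) <= exp (- decay c)]; the
   cap at 1 gives [exp (- 1) <= p]. *)
pose delta := Num.min 1 (expR (- (decay c)%:R) / (1 + T)).
have delta0 : 0 < delta by rewrite lt_min ltr01 divr_gt0 ?expR_gt0 //; lra.
have delta1 : delta <= 1 by rewrite ge_min lexx.
pose p := expR (- delta).
have p1 : p < 1 by rewrite -[ltRHS]expR0 ltr_expR oppr_lt0.
have p0 : 0 < p by exact: expR_gt0.
exists p; split=> //.
pose E0 (s : @sequences R) (j : nat) : Prop := S j s <= T.
pose kap : R -> R := fun x => `|x|.
have mkap : measurable_fun setT kap by exact: (@normr_measurable R setT).
have mE0 j : measurable [set s | E0 s j].
  have := measurable_preimage (mS j) (measurable_itv `]-oo, T]).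
  by congr measurable; apply/seteqP; split=> s /=; rewrite in_itv.
have good : (0 < lambda (all_good c kap E0))%E.
  have good := @all_good_pos R mu lambda lambda_cylinder c kap E0; apply: good => //.
  - by move=> s a j; rewrite /E0 /S (cost_shift kap).
  - move=> s s' j ss'; rewrite /E0 /S; congr (_ <= _).
    by rewrite big_nat [RHS]big_nat; apply: eq_bigr => i /andP[_ ij]; rewrite ss'.
  - rewrite (_ : [set s | ~ E0 s 0%N] = F n) //.
    by apply/seteqP; split=> s; rewrite /E0 /F /=; [move/negP; rewrite -ltNge|rewrite ltNge => /negP].
  - move=> k ck; have [h1 h2] := hc k ck.
    apply: (@le_trans _ _ (5 * A * (width k)%:R / ((max_cost k)%:R `^ eta))%:E).
      have M0 : 0 < (max_cost k)%:R :> R by rewrite ltr0n muln_gt0 expn_gt0 width_gt0.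
      have LM : 2 * (width k)%:R * (1 + A) <= (max_cost k)%:R :> R.
        by rewrite /max_cost natrM natrX mulrAC; apply: ler_wpM2r.
      have tail := cost_tail lambda_cylinder eta1 eta2 moment M0 LM.
      exact: tail.
    by rewrite lee_fin.
have sub : all_good c kap E0 `<=` percolating p.
  move=> s sgood; apply: (@theta_positive_ge _ s p 2^-1); first by rewrite invr_gt0.
  move=> K; apply: (@theta_lower_bound R c s p T c9 (ltW p1)) => //.
    by rewrite ler_expR lerN2.
  rewrite /p expRK opprK.
  apply: (@le_trans _ _ (expR (- (decay c)%:R) / (1 + T) * (1 + T))).
    by apply: ler_wpM2r; [lra|rewrite ge_min lexx orbT].
  by rewrite divfK // gt_eqF //; lra.
have [full|//] := percolating_zero_one p0 (ltW p1).
have : (lambda (all_good c kap E0) <= lambda (percolating p))%E.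
  apply: le_measure => //; rewrite inE; last exact: percolating_measurable.
  exact: measurable_all_good.
by rewrite full leNgt good.
Qed.

End Phases.

(** Laws on sequences are determined by cylinders, so all i.i.d. sequences with law [mu] share one
    environment law. This makes the critical value depend on [mu] alone. *)
Lemma environment_image {R : realType} (mu : probability R R)
    d (Omega : measurableType d) (P : probability Omega R) (xi : nat -> Omega -> R)
    (iid : iid_with_law P xi mu) (lambda : probability (@sequences R) R) (A : set (@sequences R)) :
  (forall n (B : nat -> set R), (forall i, measurable (B i)) ->
    lambda (cylinder n B) = (\prod_(i < n) mu (B i))%E) ->
  measurable A -> P (environment xi @^-1` A) = lambda A.
Proof.
move=> lambda_cylinder mA.
transitivity (image_measure P (measurable_environment iid) A); first by [].
apply: cylinder_unique => // [n B mB|].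
  transitivity (\prod_(i < n) mu (B i))%E; last by rewrite -lambda_cylinder.
  exact: environment_law.
have total : image_measure P (measurable_environment iid) setT = 1%E by exact: probability_setT.
apply: le_lt_trans (ltry 1); rewrite -[leRHS]total; exact: lexx.
Qed.

Theorem theorem1p1 (R : realType) (mu : probability R R) :
  mu [set x : R | 0 < x] = 1%E ->
  (exists2 eta : R, 1 < eta & (\int[mu]_x ((`|x| `^ eta)%:E) < +oo)%E) ->
  exists pc : R, 0 < pc < 1 /\
    forall d (Omega : measurableType d) (P : probability Omega R)
           (xi : nat -> Omega -> R),
      iid_with_law P xi mu ->
      (forall p : R, 0 <= p -> p < pc ->
         {ae P, forall om, perc_prob_zero (fun k => xi k om) p}) /\
      (forall p : R, pc < p -> p <= 1 ->
         {ae P, forall om, perc_prob_pos (fun k => xi k om) p}).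
Proof.
move=> mu_pos moment.
(* The critical value must be chosen before any i.i.d. sequence is given. If no law on sequences has
   the product values on cylinders, there is no i.i.d. sequence with law [mu], and any value will
   do. *)
have [real|noreal] := pselect (exists lambda : probability (@sequences R) R,
    forall n (B : nat -> set R), (forall i, measurable (B i)) ->
    lambda (cylinder n B) = (\prod_(i < n) mu (B i))%E); last first.
  exists 2^-1; split; first by lra.
  move=> d Omega P xi iid; exfalso; apply: noreal.
  by exists (image_measure P (measurable_environment iid)) => n B; exact: environment_law.
have [lambda lambda_cylinder] := real.
have [p0 [p0_gt0 p0_le1 null0]] := subcritical lambda_cylinder mu_pos.
have [p1 [p1_gt0 p1_lt1 full1]] := supercritical lambda_cylinder moment.
(* The critical value is the supremum of this set; it lies between [p0] and [p1]. *)
pose null : set R := [set p | 0 < p <= 1 /\ lambda (percolating p) = 0%E].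
have null_p0 : null p0 by split=> //; rewrite p0_gt0.
have null_ub : ubound null p1.
  move=> p [/andP[p_gt0 p_le1] nullp]; rewrite leNgt; apply/negP => p1p.
  have : (lambda (percolating p1) <= lambda (percolating p))%E.
    apply: le_measure; rewrite ?inE; try exact: percolating_measurable.
    by apply: percolating_mono => //; exact: ltW.
  by rewrite full1 nullp lee_fin ler10.
have has_sup_null : has_sup null by split; [exists p0|exists p1].
exists (sup null); split.
  apply/andP; split.
    by apply: lt_le_trans p0_gt0 _; apply: ub_le_sup => //; exists p1.
  by apply: le_lt_trans p1_lt1; apply: ge_sup => //; exists p0.
move=> d Omega P xi iid.
have law := environment_image iid lambda_cylinder.
have mpre p : measurable (environment xi @^-1` percolating p).
  by apply: (measurable_preimage (measurable_environment iid)); exact: percolating_measurable.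
split=> p.
  (* Some [p'] above [p] lies in [null]; by monotonicity the exceptional environments are among
     those that percolate at [p']. *)
  move=> p_ge0 p_sup; have [p' [/andP[p'_gt0 p'_le1] nullp'] pp'] := sup_gt (ex_intro _ p0 null_p0) p_sup.
  exists (environment xi @^-1` percolating p'); split=> //.
    by rewrite law //; exact: percolating_measurable.
  move=> om /= nzero; apply: contrapT => nperc; apply: nzero => d' Omega' P' W bW.
  apply: (percolation_prob_zero bW) => perc; apply: nperc.
  exact: (percolating_mono p_ge0 (ltW pp') p'_le1).
move=> sup_p p_le1.
have p_gt0 : 0 < p.
  by apply: lt_trans sup_p; apply: lt_le_trans p0_gt0 _; apply: ub_le_sup => //; exists p1.
(* Above the supremum the null alternative of the zero-one law is excluded, so almost every
   environment percolates. *)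
have [nullp|fullp] := percolating_zero_one lambda_cylinder p_gt0 p_le1.
  have : p <= sup null by apply: ub_le_sup; [exists p1|split=> //; rewrite p_gt0].
  by rewrite leNgt sup_p.
exists (~` (environment xi @^-1` percolating p)); split.
- exact: measurableC.
- rewrite probability_setC // law; last exact: percolating_measurable.
  by rewrite fullp subee.
- move=> om /= npos perc; apply: npos => d' Omega' P' W bW.
  exact: (percolation_prob_pos bW).
Qed.
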